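(* Let $X$ be a standard subproduct system over $\mathbb N^2$ with $E=X(1,0)$, $F=X(0,1)$, $\dim E=m$, $\dim F=n$, and let $u$ be a commutation relation for $X$. Then there exists an $(m,n)$-homogeneous ideal of polynomials $J\subset\mathbb C[z_1,\dots,z_m,w_1,\dots,w_n]$ such that the character space $\mathcal M(\mathcal A_X)$ (equipped with the weak-* topology) is homeomorphic to the homogeneous polyball variety $\Omega^{m,n}(J)$. More specifically, if $\{p_{i,j}\}_{i,j=1}^{m,n}$ are the polynomials associated with $u$ relative to some choice of orthonormal bases for $E$ and $F$, then $J$ is the ideal generated by the set $$\{p_{i,j}\}_{i,j=1}^{m,n}\cup\bigcup_{i,j\ge0}\{q^x : x\in (E^{\otimes i}\otimes F^{\otimes j})\ominus X(i,j)\},$$ where $q^x$ is the polynomial associated with the vector $x$ relative to the same choice of bases.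
   Context: $\mathbb N=\{0,1,2,\dots\}$. A subproduct system (over $\mathbb N^2$) is a family $X=\{X(s)\}_{s\in\mathbb N^2}$ of finite-dimensional complex Hilbert spaces with $\dim X(0)=1$ (so $X(0)=\mathbb C$), together with coisometries $U_{s,t}:X(s)\otimes X(t)\to X(s+t)$, such that $U_{s,0},U_{0,s}$ are the natural isomorphisms and $U_{s+t,r}(U_{s,t}\otimes I_{X(r)})=U_{s,t+r}(I_{X(s)}\otimes U_{t,r})$ for all $s,t,r$. For a unitary $u:F\otimes E\to E\otimes F$ put $u^{(1,k)}=(I_{E^{\otimes(k-1)}}\otimes u)(I_{E^{\otimes(k-2)}}\otimes u\otimes I_E)\cdots(u\otimes I_{E^{\otimes(k-1)}}):F\otimes E^{\otimes k}\to E^{\otimes k}\otimes F$ and $u^{(j,k)}=(u^{(1,k)}\otimes I_{F^{\otimes(j-1)}})\cdots(I_{F^{\otimes(j-1)}}\otimes u^{(1,k)}):F^{\otimes j}\otimes E^{\otimes k}\to E^{\otimes k}\otimes F^{\otimes j}$ (identity if $j=0$ or $k=0$), and $W^u_{(i,j),(k,l)}=I_{E^{\otimes i}}\otimes u^{(j,k)}\otimes I_{F^{\otimes l}}:E^{\otimes i}\otimes F^{\otimes j}\otimes E^{\otimes k}\otimes F^{\otimes l}\to E^{\otimes(i+k)}\otimes F^{\otimes(j+l)}$. A subproduct system $X$ with $E=X(1,0)$, $F=X(0,1)$ is standard with commutation relation $u$ ($u:F\otimes E\to E\otimes F$ unitary) if $X(i,j)\subset E^{\otimes i}\otimes F^{\otimes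 j}$ for all $i,j$ and, with $p_{(i,j)}$ the orthogonal projection of $E^{\otimes i}\otimes F^{\otimes j}$ onto $X(i,j)$, one has $U_{(i,j),(k,l)}=p_{(i+k,j+l)}W^u_{(i,j),(k,l)}|_{X(i,j)\otimes X(k,l)}$, $p_{(i+k,j+l)}\le W^u_{(i,j),(k,l)}(p_{(i,j)}\otimes I)(W^u_{(i,j),(k,l)})^*$ and $p_{(i+k,j+l)}\le W^u_{(i,j),(k,l)}(I\otimes p_{(k,l)})(W^u_{(i,j),(k,l)})^*$. $\mathcal F_X=\bigoplus_{s\in\mathbb N^2}X(s)$ (Hilbert direct sum). For $\eta\in X(s)$, $L^{(s)}_\eta\in B(\mathcal F_X)$ is given by $L^{(s)}_\eta\xi=U_{s,t}(\eta\otimes\xi)$ for $\xi\in X(t)$. The tensor algebra $\mathcal A_X$ is the norm-closed subalgebra of $B(\mathcal F_X)$ generated by all $L^{(s)}_\eta$, $s\in\mathbb N^2$, $\eta\in X(s)$. $\mathcal M(\mathcal A_X)$ is the set of characters (nonzero multiplicative linear functionals) of $\mathcal A_X$. For $I\subset\mathbb C[z_1,\dots,z_m,w_1,\dots,w_n]$ the polyball variety is $\Omega^{m,n}(I)=\{(z,w)\in\mathbb C^m\times\mathbb C^n: p(z,w)=0\ \forall p\in I,\ \|z\|\le1,\ \|w\|\le1\}$ (Euclidean norms). A polynomial is $(m,n)$-homogeneous of degree $(d_m,d_n)$ if all its monomials have total degree $d_m$ in $z_1,\dots,z_m$ and total degree $d_n$ in $w_1,\dots,w_n$; an ideal is $(m,n)$-homogeneous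 if generated by $(m,n)$-homogeneous polynomials; $\Omega^{m,n}(J)$ is called homogeneous if $J$ is. Given orthonormal bases $\{e_i\}_{i=1}^m$ of $E$ and $\{f_j\}_{j=1}^n$ of $F$, write $u(f_j\otimes e_i)=\sum_{k,l}u_{(k,l),(i,j)}e_k\otimes f_l$; the polynomials associated with $u$ are $p_{i,j}=w_jz_i-\sum_{k=1}^m\sum_{l=1}^n u_{(k,l),(i,j)}z_kw_l$. For $x=\sum a_{s_1,\dots,s_i}^{t_1,\dots,t_j}\,e_{s_1}\otimes\cdots\otimes e_{s_i}\otimes f_{t_1}\otimes\cdots\otimes f_{t_j}\in E^{\otimes i}\otimes F^{\otimes j}$, $q^x=\sum a_{s_1,\dots,s_i}^{t_1,\dots,t_j}\,z_{s_1}\cdots z_{s_i}w_{t_1}\cdots w_{t_j}$ (commutative polynomial). *)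

(* Defs.v *)
From HB Require Import structures.
From mathcomp Require Import all_boot all_order all_algebra.
From mathcomp Require Import spectral complex ring.
From mathcomp Require Import all_classical all_reals all_analysis.
(* The notations of mpoly clash with those of mathcomp-analysis; [mpoly k R],
   [mpolyX _ (mnm1 i)] and [meval v p] are {mpoly R[k]}, 'X_i and p.@[v]. *)
From mathcomp Require Import -(notations) mpoly.

Set Implicit Arguments.
Unset Strict Implicit.
Unset Printing Implicit Defensive.

Import Order.TTheory GRing.Theory Num.Theory.
Import numFieldNormedType.Exports.

Local Open Scope classical_set_scope.
Local Open Scope ring_scope.
Local Open Scope complex_scope.

(* E = C^m and F = C^n. The standard basis of the full Fock space
   (+)_(i,j) E^(x)i (x) F^(x)j is indexed by pairs of words (a, b); the pair
   stands for e_(a_1) (x) ... (x) e_(a_i) (x) f_(b_1) (x) ... (x) f_(b_j) and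
   has degree (i, j). A vector is the function giving its coordinates, and
   E^(x)i (x) F^(x)j is the set of functions supported in degree (i, j), so no
   casts are needed between e.g. the degrees (s + t) + r and s + (t + r). *)
Section Tensors.
Variables (R : realType) (m n : nat).
Local Notation C := R[i].
Local Notation word := (seq 'I_m * seq 'I_n)%type.
Local Notation tensor := (word -> C).
(* Coordinates of vectors of (E^i (x) F^j) (x) (E^k (x) F^l). *)
Local Notation tensor2 := (word * word -> C).
Implicit Types s t : nat * nat.

Definition deg (w : word) : nat * nat := (size w.1, size w.2).

Definition words s : seq word :=
  [seq (tval a, tval b) | a <- enum {: s.1.-tuple 'I_m},
                          b <- enum {: s.2.-tuple 'I_n}].

Definition homog s : set tensor := [set x | forall w, deg w != s -> x w = 0].

(* Linear in the first argument; only the components of degree s count. *)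
Definition dotp s (x y : tensor) : C := \sum_(w <- words s) x w * conjc (y w).

Definition dotp2 s t (x y : tensor2) : C :=
  \sum_(v <- words s) \sum_(w <- words t) x (v, w) * conjc (y (v, w)).

Definition tprod (x y : tensor) : tensor2 := fun p => x p.1 * y p.2.

Definition tensor_set (A B : set tensor) : set tensor2 :=
  [set z | exists (d : nat) (x y : 'I_d -> tensor),
     (forall i, A (x i) /\ B (y i)) /\ z = \sum_(i < d) tprod (x i) (y i)].

Definition subspace_in (A : set tensor) : Prop :=
  A 0 /\ forall (c : C) (x y : tensor), A x -> A y -> A (c *: x + y).

Definition linear_on (D : set tensor2) (f : tensor2 -> tensor) : Prop :=
  forall (c : C) (x y : tensor2), D x -> D y -> f (c *: x + y) = c *: f x + f y.

(* U U^* = I for U : A (x) B -> D, where A, B, D are in degrees s, t, s + t. *)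
Definition coisometry s t (A B D : set tensor) (U : tensor2 -> tensor) : Prop :=
  exists Ustar : tensor -> tensor2, forall z, D z ->
    [/\ tensor_set A B (Ustar z),
        forall x : tensor2, tensor_set A B x ->
          dotp (s + t) (U x) z = dotp2 s t x (Ustar z)
      & U (Ustar z) = z].

(* The fibers are subspaces X(i, j) of E^(x)i (x) F^(x)j, as they are for a
   standard subproduct system. By linearity, the unit and associativity laws
   are only stated on elementary tensors. *)
Record subproduct_system := SubproductSystem {
  fiber :> nat * nat -> set tensor;
  smul : nat * nat -> nat * nat -> tensor2 -> tensor;
  fiber_sub : forall s, fiber s `<=` homog s;
  fiber_subspace : forall s, subspace_in (fiber s);
  fiber0 : fiber (0, 0)%N = homog (0, 0)%N;
  smul_linear : forall s t,
    linear_on (tensor_set (fiber s) (fiber t)) (smul s t);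
  smul_fiber : forall s t (z : tensor2),
    tensor_set (fiber s) (fiber t) z -> fiber (s + t) (smul s t z);
  smul_coisometry : forall s t,
    coisometry s t (fiber s) (fiber t) (fiber (s + t)) (smul s t);
  smul_unitr : forall s x c, fiber s x -> fiber (0, 0)%N c ->
    smul s (0, 0)%N (tprod x c) = c ([::], [::]) *: x;
  smul_unitl : forall s x c, fiber s x -> fiber (0, 0)%N c ->
    smul (0, 0)%N s (tprod c x) = c ([::], [::]) *: x;
  smulA : forall s t r x y z, fiber s x -> fiber t y -> fiber r z ->
    smul (s + t) r (tprod (smul s t (tprod x y)) z) =
    smul s (t + r) (tprod x (smul t r (tprod y z)))
}.

Definition orth s (A : set tensor) : set tensor :=
  [set x | homog s x /\ forall y, A y -> dotp s x y = 0].

(* The orthogonal projection of the degree s part onto A. *)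
Definition oproj s (A : set tensor) : tensor -> tensor :=
  fun x => xget 0 [set y | A y /\ forall z, A z -> dotp s (x - y) z = 0].

Definition op_le s (P Q : tensor -> tensor) : Prop :=
  forall x, homog s x -> dotp s (P x) x <= dotp s (Q x) x.

(* P (x) I and I (x) P *)
Definition proj_id (P : tensor -> tensor) : tensor2 -> tensor2 :=
  fun x p => P (fun v => x (v, p.2)) p.1.

Definition id_proj (P : tensor -> tensor) : tensor2 -> tensor2 :=
  fun x p => P (fun v => x (p.1, v)) p.2.

(* u (k, l) (j, i) is the coefficient of e_k (x) f_l in u (f_j (x) e_i). *)
Local Notation commutation := ('I_m * 'I_n -> 'I_n * 'I_m -> C).

Definition unitary (u : commutation) : Prop :=
  (forall p q, \sum_r u p r * conjc (u q r) = (p == q)%:R) /\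
  (forall p q, \sum_r conjc (u r p) * u r q = (p == q)%:R).

(* The coefficient of e_a' (x) f_l in u^(1,k) (f_j (x) e_a), computed from
   u^(1,k+1) = (I_E (x) u^(1,k)) (u (x) I). *)
Fixpoint u1k (u : commutation) (a' : seq 'I_m) (l j : 'I_n) (a : seq 'I_m) : C :=
  match a', a with
  | [::], [::] => (l == j)%:R
  | k :: a', i :: a => \sum_(h < n) u (k, h) (j, i) * u1k u a' l h a
  | _, _ => 0
  end.

(* The coefficient of e_a' (x) f_b' in u^(j,k) (f_b (x) e_a), computed from
   u^(j+1,k) = (u^(1,k) (x) I) (I_F (x) u^(j,k)). *)
Fixpoint ujk (u : commutation) (a' : seq 'I_m) (b' b : seq 'I_n)
    (a : seq 'I_m) : C :=
  match b', b with
  | [::], [::] => (a' == a)%:R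
  | l :: b', j :: b =>
      \sum_(c : (size a).-tuple 'I_m) u1k u a' l j c * ujk u c b' b a
  | _, _ => 0
  end.

(* The coefficient of the basis vector w in W^u (v (x) v'). *)
Definition Wcoef (u : commutation) (w v v' : word) : C :=
  ((take (size v.1) w.1 == v.1) && (drop (size v.2) w.2 == v'.2))%:R *
  ujk u (drop (size v.1) w.1) (take (size v.2) w.2) v.2 v'.1.

Definition Wop u s t (x : tensor2) : tensor := fun w =>
  \sum_(v <- words s) \sum_(v' <- words t) Wcoef u w v v' * x (v, v').

(* The adjoint of Wop u s t. *)
Definition Wadj u s t (x : tensor) : tensor2 := fun p =>
  if (deg p.1 == s) && (deg p.2 == t) then
    \sum_(w <- words (s + t)) conjc (Wcoef u w p.1 p.2) * x w
  else 0.

Definition standard (X : subproduct_system) (u : commutation) : Prop :=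
  let p s := oproj s (X s) in
  [/\ unitary u,
      X (1, 0)%N = homog (1, 0)%N /\ X (0, 1)%N = homog (0, 1)%N,
      forall s t (z : tensor2), tensor_set (X s) (X t) z ->
        smul X s t z = p (s + t) (Wop u s t z),
      forall s t, op_le (s + t) (p (s + t))
        (fun x => Wop u s t (proj_id (p s) (Wadj u s t x)))
    & forall s t, op_le (s + t) (p (s + t))
        (fun x => Wop u s t (id_proj (p t) (Wadj u s t x)))].

End Tensors.

Section FockSpace.
Variables (R : realType) (m n : nat).
Local Notation C := R[i].
Local Notation word := (seq 'I_m * seq 'I_n)%type.
Local Notation tensor := (word -> C).

Definition sqmod (z : C) : R := complex.Re z ^+ 2 + complex.Im z ^+ 2.

Definition component s (x : tensor) : tensor :=
  fun w => if deg w == s then x w else 0.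

Definition fock_pred (X : subproduct_system R m n) : {pred tensor} :=
  mem [set x : tensor | (forall s, X s (component s x)) /\
    (\esum_(w in [set: word]) (sqmod (x w))%:E < +oo)%E].

Record fock (X : subproduct_system R m n) :=
  Fock { fock_val :> tensor; _ : fock_pred X fock_val }.

HB.instance Definition _ X := [isSub for @fock_val X].
HB.instance Definition _ X := [Choice of fock X by <:].

Lemma sqmod_ge0 z : 0 <= sqmod z.
Proof. by rewrite addr_ge0 ?sqr_ge0. Qed.

Lemma sqmodM z1 z2 : sqmod (z1 * z2) = sqmod z1 * sqmod z2.
Proof. by case: z1 z2 => [a b] [c d]; rewrite /sqmod /=; ring. Qed.

Lemma sqmodD_le z1 z2 : sqmod (z1 + z2) <= sqmod z1 *+ 2 + sqmod z2 *+ 2.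
Proof.
case: z1 z2 => [a b] [c d]; rewrite /sqmod /= -subr_ge0.
have -> : (a ^+ 2 + b ^+ 2) *+ 2 + (c ^+ 2 + d ^+ 2) *+ 2 -
  ((a + c) ^+ 2 + (b + d) ^+ 2) = (a - c) ^+ 2 + (b - d) ^+ 2 by ring.
by rewrite addr_ge0 ?sqr_ge0.
Qed.

Lemma fock_submod_closed X : submod_closed (fock_pred X).
Proof.
split.
  rewrite /fock_pred unfold_in /= inE; split.
    move=> s; have [X0 _] := fiber_subspace X s.
    by congr (X s _): X0; apply/funext => w; rewrite /component; case: ifP.
  rewrite esum1 ?ltry// => w _.
  by rewrite /sqmod /= expr0n /= addr0.
move=> c x y; rewrite /fock_pred !unfold_in /= !inE => -[Xx nx] [Xy ny]; split.
  move=> s; have [_ XD] := fiber_subspace X s.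
  have -> : component s (c *: x + y) = c *: component s x + component s y.
    apply/funext => w; rewrite /component !fctE.
    by case: ifP => //; rewrite scaler0 addr0.
  exact: XD.
pose N := (Num.truncn (sqmod c)).+1.
pose g (w : word) : \bar R := (\sum_(j < N) (sqmod (x w) *+ 2)%:E)%E.
apply: (@le_lt_trans _ _
  (\esum_(w in [set: word]) (g w + (sqmod (y w) *+ 2)%:E))%E).
  apply: le_esum => w _; rewrite /g sumEFin -EFinD lee_fin.
  apply: (le_trans (sqmodD_le _ _)); rewrite lerD2r !fctE.
  have -> : sqmod (c *: x w) = sqmod c * sqmod (x w) by exact: sqmodM.
  rewrite sumr_const card_ord -[_ *+ N]mulr_natl -mulrnAr.
  rewrite ler_wpM2r ?mulrn_wge0 ?sqmod_ge0//.
  by rewrite ltW// truncnS_gt.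
have two f : (\esum_(w in [set: word]) (sqmod (f w))%:E < +oo)%E ->
    (\esum_(w in [set: word]) (sqmod (f w) *+ 2)%:E < +oo)%E.
  move=> nf; under eq_esum do rewrite mulr2n EFinD.
  rewrite esumD ?lte_add_pinfty// => w _; exact: sqmod_ge0.
rewrite esumD; first last.
- by move=> w _; rewrite lee_fin mulrn_wge0 ?sqmod_ge0.
- by move=> w _; rewrite sume_ge0// => j _; rewrite lee_fin mulrn_wge0 ?sqmod_ge0.
rewrite lte_add_pinfty ?two//.
rewrite esum_sum; last by move=> w j _ _; rewrite lee_fin mulrn_wge0 ?sqmod_ge0.
by rewrite ?lte_sum_pinfty// => j _; exact: two.
Qed.

HB.instance Definition _ X :=
  GRing.isSubmodClosed.Build C tensor (fock_pred X) (fock_submod_closed X).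
HB.instance Definition _ X := [SubChoice_isSubLmodule of fock X by <:].

End FockSpace.

Section TensorAlgebra.
Variables (R : realType) (m n : nat).
Local Notation C := R[i].
Local Notation word := (seq 'I_m * seq 'I_n)%type.
Local Notation tensor := (word -> C).
Variable X : subproduct_system R m n.
Local Notation op := (fock X -> fock X).

Definition fock_norm (x : fock X) : R :=
  Num.sqrt (fine (\esum_(w in [set: word]) (sqmod (x w))%:E)).

Definition bounded_op : set op :=
  [set T | linear T /\ exists M : R, forall x, fock_norm (T x) <= M * fock_norm x].

Definition op_norm (T : op) : R :=
  sup [set fock_norm (T x) | x in [set x | fock_norm x <= 1]].

(* T is the bounded operator L_eta, for some eta in some X(s). *)
Definition creation_op : set op :=
  [set T | bounded_op T /\ exists s (eta : tensor), X s eta /\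
    forall t (x : fock X), X t x -> T x = smul X s t (tprod eta x) :> tensor].

Definition closed_subalgebra (S : set op) : Prop :=
  [/\ S `<=` bounded_op,
      S (fun=> 0),
      forall (c : C) A B, S A -> S B -> S (c \*: A \+ B),
      forall A B, S A -> S B -> S (A \o B)
    & forall T, bounded_op T ->
        (forall e : R, 0 < e -> exists2 A, S A & op_norm (T \- A) < e) -> S T].

Definition tensor_algebra : set op := smallest closed_subalgebra creation_op.

(* The topology of pointwise convergence on A_X induces the weak-* topology. *)
Definition characters : set {ptws tensor_algebra -> C^o} :=
  [set chi | [/\ forall (c : C) (A B D : tensor_algebra),
                   val D = c \*: val A \+ val B -> chi D = c * chi A + chi B,
                 forall A B D : tensor_algebra,
                   val D = val A \o val B -> chi D = chi A * chi B
               & exists A, chi A != 0]].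

End TensorAlgebra.
Arguments bounded_op {R m n} X.
Arguments creation_op {R m n} X.
Arguments closed_subalgebra {R m n X}.
Arguments tensor_algebra {R m n} X.
Arguments characters {R m n} X.

Section PolyballVariety.
Variables (R : realType) (m n : nat).
Local Notation C := R[i].
(* C[z_1, ..., z_m, w_1, ..., w_n] *)
Local Notation poly_zw := (mpoly (m + n) C).

Definition zvar (i : 'I_m) : poly_zw := mpolyX C (mnm1 (lshift n i)).
Definition wvar (j : 'I_n) : poly_zw := mpolyX C (mnm1 (rshift m j)).

Definition is_ideal (I : set poly_zw) : Prop :=
  [/\ I 0, forall p q, I p -> I q -> I (p + q) & forall a p, I p -> I (a * p)].

Definition ideal_gen (G : set poly_zw) : set poly_zw := smallest is_ideal G.

Definition bihomogeneous (dm dn : nat) (p : poly_zw) : Prop :=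
  forall mu, mu \in msupp p ->
    (\sum_(i < m) mu (lshift n i) = dm /\ \sum_(j < n) mu (rshift m j) = dn)%N.

Definition homogeneous_ideal (J : set poly_zw) : Prop :=
  exists G : set poly_zw,
    (forall p, G p -> exists dm dn, bihomogeneous dm dn p) /\ J = ideal_gen G.

Definition euclidean_norm k (z : 'rV[C^o]_k) : R :=
  Num.sqrt (\sum_i sqmod (z 0 i)).

Definition polyball_variety (I : set poly_zw) :
    set ('rV[C^o]_m * 'rV[C^o]_n)%type :=
  [set zw | [/\ forall p, I p -> meval (fun i => row_mx zw.1 zw.2 0 i : C) p = 0,
                euclidean_norm zw.1 <= 1
              & euclidean_norm zw.2 <= 1]].

End PolyballVariety.

(* The orthonormal bases (e_i) of C^m and (f_j) of C^n are the rows of unitary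
   matrices e and f. *)
Section AssociatedPolynomials.
Variables (R : realType) (m n : nat).
Local Notation C := R[i].
Local Notation word := (seq 'I_m * seq 'I_n)%type.
Local Notation tensor := (word -> C).
Variables (e : 'M[C]_m) (f : 'M[C]_n).

(* e_(a_1) (x) ... (x) e_(a_i) (x) f_(b_1) (x) ... (x) f_(b_j) for v = (a, b) *)
Definition basis_tensor (v : word) : tensor := fun w =>
  if deg w == deg v then
    (\prod_(ac <- zip v.1 w.1) e ac.1 ac.2) *
    (\prod_(bd <- zip v.2 w.2) f bd.1 bd.2)
  else 0.

(* The coefficient of e_k (x) f_l in u (f_j (x) e_i), for the bases e and f. *)
Definition basis_coef (u : 'I_m * 'I_n -> 'I_n * 'I_m -> C)
    (k : 'I_m) (l : 'I_n) (i : 'I_m) (j : 'I_n) : C :=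
  \sum_(k' < m) \sum_(l' < n) \sum_(j' < n) \sum_(i' < m)
    conjc (e k k' * f l l') * u (k', l') (j', i') * (f j j' * e i i').

Definition comm_poly (u : 'I_m * 'I_n -> 'I_n * 'I_m -> C)
    (i : 'I_m) (j : 'I_n) : mpoly (m + n) C :=
  wvar R m j * zvar R n i -
  \sum_(k < m) \sum_(l < n) basis_coef u k l i j *: (zvar R n k * wvar R m l).

Definition tensor_poly s (x : tensor) : mpoly (m + n) C :=
  \sum_(v <- words m n s) dotp s x (basis_tensor v) *:
    ((\prod_(a <- v.1) zvar R n a) * (\prod_(b <- v.2) wvar R m b)).

Definition assoc_ideal (X : subproduct_system R m n)
    (u : 'I_m * 'I_n -> 'I_n * 'I_m -> C) : set (mpoly (m + n) C) :=
  ideal_gen ([set comm_poly u ij.1 ij.2 | ij in [set: 'I_m * 'I_n]] `|`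
             \bigcup_s [set tensor_poly s x | x in orth s (X s)]).

End AssociatedPolynomials.

Definition homeomorphic (S T : topologicalType) : Prop :=
  exists (f : S -> T) (g : T -> S),
    [/\ continuous f, continuous g, cancel f g & cancel g f].

(* Main.v *)
Require Import Defs.
From HB Require Import structures.
From mathcomp Require Import all_boot all_order all_algebra.
From mathcomp Require Import spectral complex.
From mathcomp Require Import all_classical all_reals all_analysis.
From mathcomp Require Import -(notations) mpoly.
From mathcomp Require Import ring lra.
Import Order.TTheory GRing.Theory Num.Theory.
Import numFieldNormedType.Exports.
Local Open Scope classical_set_scope.
Local Open Scope ring_scope.
Local Open Scope complex_scope.

(** A character [chi] is determined by the numbers [z_i = chi L_(e_i)] and
[w_j = chi L_(f_j)], and the point is to see which [(z, w)] occur. Evaluating a tensor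
at [(z, w)] means replacing [e_i] by [z_i], [f_j] by [w_j] and tensor products by
products; for the standard bases this is [eval_tensor]. The generators of the ideal say
that evaluation vanishes on the complements of the fibers ([kills_orth]) and does not
see the commutation relation ([commutes]). A unitary change of bases transforms the
points linearly, so it is enough to treat the standard bases ([variety_iff]).

From characters to points. In a standard system, multiplying from the left by a letter
is concatenation followed by the projection onto a fiber ([smul_delta]). Hence the
creation operator of the projection of a word is the product of the creation operators
of its letters ([ev_create_word]), and [chi (L_x)] is the evaluation of [x]. Applied to
tensors orthogonal to a fiber and to the tensors [u (f_j (x) e_i)], this yields both
groups of relations. Characters of the norm-closed algebra are contractive, by the
Neumann series ([character_contractive]), so that [|z|^2 = chi (L_x)], with [x] the
conjugate of [z] in [E], is at most [|L_x| <= |z|]; thus [|z| <= 1], and likewise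
[|w| <= 1].

From points to characters. Let [nu] be the formal vector of the Fock space whose
coordinates are the conjugates of the evaluations of words. The relations say that its
components lie in the fibers and that [nu] is an eigenvector of all adjoints
[L_eta^*]; the eigenvalue is the conjugate of the evaluation of [eta]. On the boundary
of the polyball [nu] is not square summable. Its truncations to the degrees in a box
are nevertheless approximate eigenvectors, in the sense of [approx_eigen]: as
[|z|, |w| <= 1], the degrees within a fixed distance of the boundary of a large box
carry a negligible part of the mass ([geometric_tail], [approx_creation]). The set of
operators that have a continuous family of approximate eigenvalues over the variety is
a closed subalgebra, the eigenvalues being unique and bounded by the operator norm;
so it contains the tensor algebra ([symbol_exists]). The eigenvalues at a point form
a character, and the continuity of the families is the continuity of the inverse map
for the weak-* topology. Finally every character arises in this way from its point,
since an operator of the tensor algebra has [chi T] as approximate eigenvalue there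
([character_approx]). *)

Set Implicit Arguments.
Unset Strict Implicit.
Unset Printing Implicit Defensive.

(** * The modulus of a complex number *)

Definition cabs (R : realType) (z : R[i]) : R := Num.sqrt (sqmod z).

Section Modulus.
Variable R : realType.
Local Notation C := R[i].
Implicit Types x y z : C.

Lemma cabsE z : cabs z = ComplexField.Normc.normc z.
Proof. by case: z. Qed.

Lemma norm_cabs z : `|z| = (cabs z)%:C.
Proof. by rewrite normc_def. Qed.

Lemma sqr_cabs z : cabs z ^+ 2 = sqmod z.
Proof. by rewrite sqr_sqrtr ?sqmod_ge0. Qed.

Lemma cabs_ge0 z : 0 <= cabs z.
Proof. exact: sqrtr_ge0. Qed.

Lemma cabsM x y : cabs (x * y) = cabs x * cabs y.
Proof. by rewrite !cabsE ComplexField.Normc.normcM. Qed.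

Lemma cabsD x y : cabs (x + y) <= cabs x + cabs y.
Proof. by rewrite !cabsE; exact: (@le_normcD R). Qed.

Lemma cabsN x : cabs (- x) = cabs x.
Proof. by rewrite !cabsE; exact: (@normcN R). Qed.

Lemma cabs0 : cabs (0 : C) = 0.
Proof. by rewrite /cabs /sqmod /= expr0n addr0 sqrtr0. Qed.

Lemma cabs1 : cabs (1 : C) = 1.
Proof. by rewrite /cabs /sqmod /= expr0n expr1n addr0 sqrtr1. Qed.

Lemma cabs_eq0 z : cabs z = 0 -> z = 0.
Proof. by rewrite cabsE => /ComplexField.Normc.eq0_normc. Qed.

Lemma cabs_conj z : cabs (conjc z) = cabs z.
Proof. by case: z => a b; rewrite /cabs /sqmod /= sqrrN. Qed.

Lemma cabsV z : cabs z^-1 = (cabs z)^-1.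
Proof. by rewrite !cabsE ComplexField.Normc.normcV. Qed.

Lemma cabs_real (a : R) : 0 <= a -> cabs a%:C = a.
Proof. by move=> a0; rewrite /cabs /sqmod /= expr0n addr0 sqrtr_sqr ger0_norm. Qed.

Lemma cabsB x y : cabs (x - y) = cabs (y - x).
Proof. by rewrite -cabsN opprB. Qed.

Lemma cabs_dist x y z : cabs (x - z) <= cabs (x - y) + cabs (y - z).
Proof. by apply: le_trans (cabsD _ _); rewrite addrA subrK. Qed.

Lemma cabs_sum I (r : seq I) (F : I -> C) :
  cabs (\sum_(i <- r) F i) <= \sum_(i <- r) cabs (F i).
Proof.
elim: r => [|i r IH]; first by rewrite !big_nil cabs0.
by rewrite !big_cons (le_trans (cabsD _ _))// lerD2l.
Qed.

Lemma sqmod_conj z : sqmod (conjc z) = sqmod z.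
Proof. by rewrite -!sqr_cabs cabs_conj. Qed.

Lemma mul_conj z : z * conjc z = (sqmod z)%:C.
Proof.
by case: z => a b; apply/eqP; rewrite eq_complex /sqmod /=; apply/andP; split;
  apply/eqP; ring.
Qed.

Lemma sqmod_eq0 z : sqmod z = 0 -> z = 0.
Proof. by move=> z0; apply: cabs_eq0; rewrite /cabs z0 sqrtr0. Qed.

Lemma abs_Re_le z : `|complex.Re z| <= cabs z.
Proof. by rewrite -sqrtr_sqr ler_wsqrtr// /sqmod lerDl sqr_ge0. Qed.

Lemma abs_Im_le z : `|complex.Im z| <= cabs z.
Proof. by rewrite -sqrtr_sqr ler_wsqrtr// /sqmod lerDr sqr_ge0. Qed.

Lemma cabs_le_ReIm z : cabs z <= `|complex.Re z| + `|complex.Im z|.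
Proof.
case: z => a b /=; have -> : a +i* b = a%:C + (0 +i* b) :> C.
  by apply/eqP; rewrite eq_complex /= addr0 add0r !eqxx.
rewrite (le_trans (cabsD _ _))// /cabs /sqmod /= !expr0n /= addr0 add0r.
by rewrite !sqrtr_sqr.
Qed.

Lemma cabs_eq0P z : (forall e : R, 0 < e -> cabs z <= e) -> z = 0.
Proof.
move=> H; apply: cabs_eq0; apply/eqP; rewrite eq_le cabs_ge0 andbT.
by apply/ler_addgt0Pl => e e0; rewrite addr0; exact: H.
Qed.

(** [R[i]] is complete; the rate of convergence is kept because both uses of
this need an explicit estimate of the distance to the limit. *)
Lemma complex_cauchy_rate (u : nat -> C) (d : nat -> R) :
  (forall k l, (k <= l)%N -> cabs (u l - u k) <= d k) ->
  (forall e : R, 0 < e -> exists k, d k < e) ->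
  exists c : C, forall k, cabs (u k - c) <= d k.
Proof.
move=> ud d0.
have lim_part (h : C -> R) : (forall x y, h (x - y) = h x - h y) ->
    (forall x, `|h x| <= cabs x) -> cvgn (h \o u).
  move=> hB hle; apply/cauchy_cvgP/cauchy_exP => e e0.
  have [k dk] := d0 e e0; exists (h (u k)); exists k => // l /= kl.
  rewrite /ball /= distrC -hB; apply: le_lt_trans dk.
  exact: le_trans (hle _) (ud _ _ kl).
have cR : cvgn (@complex.Re R \o u).
  by apply: lim_part => [[? ?] [? ?]//|]; exact: abs_Re_le.
have cI : cvgn (@complex.Im R \o u).
  by apply: lim_part => [[? ?] [? ?]//|]; exact: abs_Im_le.
exists (limn (@complex.Re R \o u) +i* limn (@complex.Im R \o u)) => k.
apply/ler_addgt0Pl => e e0; have e20 : 0 < e / 2 by rewrite divr_gt0.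
have /cvgrPdist_le /(_ _ e20) [K1 _ H1] := cR.
have /cvgrPdist_le /(_ _ e20) [K2 _ H2] := cI.
pose l := maxn k (maxn K1 K2).
apply: (le_trans (cabs_dist _ (u l) _)); rewrite addrC lerD//; last first.
  by rewrite cabsB ud// leq_max leqnn.
rewrite cabsB (le_trans (cabs_le_ReIm _))// (splitr e) lerD//.
- have := H1 l; rewrite /= /l !leq_max leqnn orbT => /(_ isT).
  by case: (u _).
- have := H2 l; rewrite /= /l !leq_max leqnn !orbT => /(_ isT).
  by case: (u _).
Qed.

End Modulus.

(** * Finite l2 norms *)

Section FiniteL2.
Variables (R : realType) (T : Type).
Local Notation C := R[i].
Implicit Types (W : seq T) (x y : T -> C).

Definition l2 W x : R := Num.sqrt (\sum_(w <- W) sqmod (x w)).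

Lemma sum_sqmod_ge0 W x : 0 <= \sum_(w <- W) sqmod (x w).
Proof. by apply: sumr_ge0 => w _; exact: sqmod_ge0. Qed.

Lemma l2_ge0 W x : 0 <= l2 W x.
Proof. exact: sqrtr_ge0. Qed.

Lemma sqr_l2 W x : l2 W x ^+ 2 = \sum_(w <- W) sqmod (x w).
Proof. by rewrite sqr_sqrtr// sum_sqmod_ge0. Qed.

(** Cauchy-Schwarz in the plane, for the vectors [(a, sqrt c)] and [(b, sqrt d)]:
the inductive step of both [cauchy_schwarz] and [l2D]. *)
Lemma cauchy_schwarz_plane (a b c d : R) : 0 <= a -> 0 <= b -> 0 <= c -> 0 <= d ->
  a * b + Num.sqrt c * Num.sqrt d <=
  Num.sqrt (a ^+ 2 + c) * Num.sqrt (b ^+ 2 + d).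
Proof.
move=> a0 b0 c0 d0.
rewrite -(@ler_pXn2r _ 2)//; last 2 first.
- by rewrite nnegrE addr_ge0 ?mulr_ge0 ?sqrtr_ge0.
- by rewrite nnegrE mulr_ge0 ?sqrtr_ge0.
rewrite exprMn !sqr_sqrtr ?addr_ge0 ?sqr_ge0//.
have := sqr_sqrtr c0; have := sqr_sqrtr d0.
move: (Num.sqrt c) (Num.sqrt d) => s t <- <-.
rewrite -subr_ge0; have -> : (a ^+ 2 + s ^+ 2) * (b ^+ 2 + t ^+ 2) -
   (a * b + s * t) ^+ 2 = (a * t - b * s) ^+ 2 by ring.
exact: sqr_ge0.
Qed.

Lemma cauchy_schwarz W x y :
  cabs (\sum_(w <- W) x w * y w) <= l2 W x * l2 W y.
Proof.
elim: W => [|w W IH]; first by rewrite !big_nil cabs0 mulr_ge0 ?l2_ge0.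
rewrite !big_cons (le_trans (cabsD _ _))// cabsM.
apply: (@le_trans _ _ (cabs (x w) * cabs (y w) + l2 W x * l2 W y)).
  by rewrite lerD2l.
by rewrite /l2 !big_cons -!(sqr_cabs (_ w)) cauchy_schwarz_plane ?cabs_ge0 ?sum_sqmod_ge0.
Qed.

Lemma l2D W x y : l2 W (fun w => x w + y w) <= l2 W x + l2 W y.
Proof.
elim: W => [|w W IH]; first by rewrite /l2 !big_nil !sqrtr0 addr0.
have cons_sqr z : l2 (w :: W) z ^+ 2 = cabs (z w) ^+ 2 + l2 W z ^+ 2.
  by rewrite !sqr_l2 big_cons sqr_cabs.
have step : cabs (x w) * cabs (y w) + l2 W x * l2 W y <=
    l2 (w :: W) x * l2 (w :: W) y.
  by rewrite /l2 !big_cons -!(sqr_cabs (_ w)) cauchy_schwarz_plane ?cabs_ge0 ?sum_sqmod_ge0.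
have sq (a b : R) : 0 <= a -> 0 <= b -> a <= b -> a ^+ 2 <= b ^+ 2.
  by move=> a0 b0; rewrite ler_pXn2r ?nnegrE.
rewrite -(@ler_pXn2r _ 2) ?nnegrE ?addr_ge0 ?l2_ge0//.
rewrite [X in _ <= X]sqrrD !cons_sqr.
have := sq _ _ (cabs_ge0 _) (addr_ge0 (cabs_ge0 _) (cabs_ge0 _)) (cabsD (x w) (y w)).
have := sq _ _ (l2_ge0 _ _) (addr_ge0 (l2_ge0 _ _) (l2_ge0 _ _)) IH.
rewrite !(sqrrD (l2 _ _)) !(sqrrD (cabs _)).
move: step; lra.
Qed.

Lemma l2Z W c x : l2 W (fun w => c * x w) = cabs c * l2 W x.
Proof.
rewrite /l2; under eq_bigr do rewrite sqmodM.
by rewrite -mulr_sumr sqrtrM ?sqmod_ge0.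
Qed.

Lemma eq_l2 W x y : x =1 y -> l2 W x = l2 W y.
Proof. by move=> xy; rewrite /l2; under eq_bigr do rewrite xy. Qed.

End FiniteL2.

(** * Words, boxes of degrees and the norm of the Fock space *)

Section Boxes.
Variables m n : nat.
Local Notation word := (seq 'I_m * seq 'I_n)%type.

Lemma mem_words s (w : word) : (w \in words m n s) = (deg w == s).
Proof.
case: s w => i j [a b]; apply/allpairsP/eqP => [[[/= c d] [_ _ [-> ->]]]|[<- <-]].
  by rewrite /deg /= !size_tuple.
by exists (in_tuple a, in_tuple b); rewrite !mem_enum.
Qed.

Lemma uniq_words s : uniq (words m n s).
Proof.
by apply: allpairs_uniq; rewrite ?enum_uniq// => -[a b] [c d] _ _ /=
  [/val_inj -> /val_inj ->].
Qed.

Definition degs N : seq (nat * nat) := [seq (i, j) | i <- iota 0 N, j <- iota 0 N].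

Lemma mem_degs N s : (s \in degs N) = (s.1 < N)%N && (s.2 < N)%N.
Proof.
case: s => i j; apply/allpairsP/andP => /= [[[a b] [/=]]|[iN jN]].
  by rewrite !mem_iota !add0n => ? ? [-> ->].
by exists (i, j); rewrite !mem_iota.
Qed.

Lemma uniq_degs N : uniq (degs N).
Proof. by apply: allpairs_uniq; rewrite ?iota_uniq// => -[a b] [c d] _ _. Qed.

Definition box N : seq word := flatten [seq words m n s | s <- degs N].

Lemma mem_box N w : (w \in box N) = (deg w \in degs N).
Proof.
apply/flatten_mapP/idP => [[s sN]|wN]; first by rewrite mem_words => /eqP ->.
by exists (deg w); rewrite // mem_words.
Qed.

Lemma uniq_box N : uniq (box N).
Proof.
rewrite /box; elim: (degs N) (uniq_degs N) => //= s r IH /andP[sr ur].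
rewrite cat_uniq uniq_words IH// andbT /=.
apply/hasPn => w /flatten_mapP[t tr]; rewrite !mem_words => /eqP ->.
by apply: contraNN sr => /eqP <-.
Qed.

Lemma big_box (V : nmodType) N (F : word -> V) :
  \sum_(w <- box N) F w = \sum_(s <- degs N) \sum_(w <- words m n s) F w.
Proof. by rewrite big_flatten big_map. Qed.

Lemma big_degs (V : nmodType) N (F : nat * nat -> V) :
  \sum_(s <- degs N) F s = \sum_(0 <= i < N) \sum_(0 <= j < N) F (i, j).
Proof. by rewrite big_allpairs /index_iota !subn0. Qed.

Lemma box_mono N M : (N <= M)%N -> {subset box N <= box M}.
Proof.
move=> NM w; rewrite !mem_box !mem_degs => /andP[a b].
by rewrite (leq_trans a)// (leq_trans b).
Qed.

Lemma sub_box (r : seq word) : exists N, {subset r <= box N}.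
Proof.
elim: r => [|w r [N IH]]; first by exists 0%N.
exists (maxn N (maxn (size w.1) (size w.2)).+1) => v.
rewrite inE => /predU1P[->|/IH /box_mono -> //]; last exact: leq_maxl.
by rewrite mem_box mem_degs /deg /= !leq_max !ltnS !leq_max !leqnn !orbT.
Qed.

Lemma ler_sum_sub (R : realDomainType) (T : eqType) (r s : seq T) (F : T -> R) :
  uniq r -> uniq s -> {subset r <= s} -> (forall x, 0 <= F x) ->
  \sum_(x <- r) F x <= \sum_(x <- s) F x.
Proof.
move=> ur us rs F0; rewrite [leRHS](bigID (mem r))/=.
have -> : \sum_(x <- s | x \in r) F x = \sum_(x <- r) F x.
  rewrite -big_filter; apply: perm_big; apply: uniq_perm; rewrite ?filter_uniq//.
  by move=> x; rewrite mem_filter; case: (boolP (x \in r)) => // /rs ->.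
by rewrite lerDl sumr_ge0.
Qed.

End Boxes.

Section FockNorm.
Variables (R : realType) (m n : nat) (X : subproduct_system R m n).
Local Notation C := R[i].
Local Notation word := (seq 'I_m * seq 'I_n)%type.
Local Notation tensor := (word -> C).
Local Notation box := (box m n).
Implicit Types (x y : fock X) (N : nat).

Lemma fock_valP x : (forall s, X s (component s x)) /\
    (\esum_(w in [set: word]) (sqmod (x w))%:E < +oo)%E.
Proof.
case: x => x /=; rewrite -[fock_pred X x]/(x \in fock_pred X).
by rewrite /fock_pred unfold_in /= inE.
Qed.

Lemma fock_eqP x y : (x =1 y) -> x = y.
Proof. by move=> xy; apply: val_inj; apply/funext. Qed.

Lemma fockZDE c x y w : (c *: x + y) w = c * x w + y w.
Proof. by []. Qed.

Lemma fockDE x y w : (x + y) w = x w + y w.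
Proof. by []. Qed.

Lemma fockBE x y w : (x - y) w = x w - y w.
Proof. by []. Qed.

(** Every finite set of words lies in a box, so the sum defining the norm is the
supremum of its partial sums over boxes. *)
Lemma esum_le_box (x : tensor) (K : R) :
  (forall N, \sum_(w <- box N) sqmod (x w) <= K) ->
  (\esum_(w in [set: word]) (sqmod (x w))%:E <= K%:E)%E.
Proof.
move=> H; apply: ge_ereal_sup => _ [F [finF _] <-].
rewrite fsbig_finite//= sumEFin lee_fin.
have [N sN] := sub_box (finmap.enum_fset (fset_set F)).
by apply: le_trans (H N); apply: ler_sum_sub; rewrite ?uniq_box ?finmap.fset_uniq// => w;
  exact: sqmod_ge0.
Qed.

Lemma box_le_esum (x : tensor) N :
  ((\sum_(w <- box N) sqmod (x w))%:E <= \esum_(w in [set: word]) (sqmod (x w))%:E)%E.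
Proof.
apply: esum_ge; exists [set` box N]; first by split=> //; exact: finite_seq.
by rewrite -sumEFin fsbig_seq ?uniq_box.
Qed.

Lemma fock_norm_ge0 x : 0 <= fock_norm x.
Proof. exact: sqrtr_ge0. Qed.

Lemma sqr_fock_norm x :
  ((fock_norm x ^+ 2)%:E = \esum_(w in [set: word]) (sqmod (x w))%:E)%E.
Proof.
have [_ xoo] := fock_valP x.
have x0 : (0 <= \esum_(w in [set: word]) (sqmod (x w))%:E)%E.
  by apply: esum_ge0 => w _; rewrite lee_fin sqmod_ge0.
by rewrite sqr_sqrtr ?fine_ge0// fineK// ge0_fin_numE.
Qed.

Lemma box_le_norm x N : l2 (box N) x <= fock_norm x.
Proof.
rewrite -(@ler_pXn2r _ 2) ?nnegrE ?l2_ge0 ?fock_norm_ge0// sqr_l2.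
by rewrite -lee_fin sqr_fock_norm box_le_esum.
Qed.

Lemma norm_le_box x (K : R) : 0 <= K ->
  (forall N, l2 (box N) x <= K) -> fock_norm x <= K.
Proof.
move=> K0 H; rewrite -(@ler_pXn2r _ 2) ?nnegrE ?fock_norm_ge0//.
rewrite -lee_fin sqr_fock_norm; apply: esum_le_box => N.
by rewrite -sqr_l2 ler_pXn2r ?nnegrE ?l2_ge0.
Qed.

Lemma norm_lt_box x (K : R) : 0 <= K -> K < fock_norm x ->
  exists N, K < l2 (box N) x.
Proof.
move=> K0; apply: contraPP => /forallNP H; apply/negP; rewrite -leNgt.
by apply: norm_le_box => // N; rewrite leNgt; apply/negP.
Qed.

Lemma coord_le_norm x w : cabs (x w) <= fock_norm x.
Proof.
have [N sN] := @sub_box m n [:: w].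
apply: le_trans (box_le_norm x N).
rewrite -(@ler_pXn2r _ 2) ?nnegrE ?l2_ge0 ?cabs_ge0// sqr_l2 sqr_cabs.
rewrite (big_rem w) ?sN ?inE//= lerDl; apply: sumr_ge0 => v _; exact: sqmod_ge0.
Qed.

Lemma fock_normD x y : fock_norm (x + y) <= fock_norm x + fock_norm y.
Proof.
apply: norm_le_box => [|N]; first by rewrite addr_ge0 ?fock_norm_ge0.
by rewrite (le_trans (l2D _ _ _))// lerD// box_le_norm.
Qed.

Lemma fock_normZ c x : fock_norm (c *: x) <= cabs c * fock_norm x.
Proof.
apply: norm_le_box => [|N]; first by rewrite mulr_ge0 ?fock_norm_ge0 ?cabs_ge0.
by rewrite l2Z ler_wpM2l ?cabs_ge0 ?box_le_norm.
Qed.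

Lemma fock_norm0 : fock_norm (0 : fock X) = 0.
Proof.
apply/eqP; rewrite eq_le fock_norm_ge0 andbT.
by have := fock_normZ 0 0; rewrite scaler0 cabs0 mul0r.
Qed.

Lemma fock_normN x : fock_norm (- x) = fock_norm x.
Proof.
suff le y : fock_norm (- y) <= fock_norm y.
  by apply/eqP; rewrite eq_le le/= -{1}[x]opprK le.
by rewrite -scaleN1r (le_trans (fock_normZ _ _))// cabsN cabs1 mul1r.
Qed.

Lemma fock_norm_dist x y z :
  fock_norm (x - z) <= fock_norm (x - y) + fock_norm (y - z).
Proof. by apply: le_trans (fock_normD _ _); rewrite addrA subrK. Qed.

Lemma fock_norm_eq0 x : (forall e : R, 0 < e -> fock_norm x <= e) -> x = 0.
Proof.
move=> H; apply: fock_eqP => w; apply: cabs_eq0P => e /H; apply: le_trans.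
exact: coord_le_norm.
Qed.

End FockNorm.

(** * Orthogonal projections *)

Section InnerProduct.
Variables (R : realType) (T : eqType).
Local Notation C := R[i].
Implicit Types (W : seq T) (x y z : T -> C) (A : set (T -> C)).

Definition ip W x y : C := \sum_(w <- W) x w * conjc (y w).

Lemma ipDl W x y z : ip W (x + y) z = ip W x z + ip W y z.
Proof. by rewrite /ip -big_split; apply: eq_bigr => w _; rewrite mulrDl. Qed.

Lemma ipZl W c x z : ip W (c *: x) z = c * ip W x z.
Proof. by rewrite /ip mulr_sumr; apply: eq_bigr => w _; rewrite mulrA. Qed.

Lemma ip_conj W x y : ip W y x = conjc (ip W x y).
Proof.
rewrite /ip rmorph_sum; apply: eq_bigr => w _.
by rewrite rmorphM /= conjcK mulrC.
Qed.

Lemma ipBl W x y z : ip W (x - y) z = ip W x z - ip W y z.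
Proof. by rewrite ipDl -scaleN1r ipZl mulN1r. Qed.

Lemma ipZr W c x z : ip W z (c *: x) = conjc c * ip W z x.
Proof. by rewrite ip_conj ipZl rmorphM /= -ip_conj. Qed.

Lemma ipDr W x y z : ip W z (x + y) = ip W z x + ip W z y.
Proof. by rewrite ip_conj ipDl rmorphD /= -!ip_conj. Qed.

Lemma ipBr W x y z : ip W z (x - y) = ip W z x - ip W z y.
Proof. by rewrite ip_conj ipBl rmorphB /= -!ip_conj. Qed.

Lemma ipxx W x : ip W x x = (l2 W x ^+ 2)%:C.
Proof.
by rewrite sqr_l2 rmorph_sum; apply: eq_bigr => w _; rewrite mul_conj.
Qed.

Lemma ip_ge0 W x : 0 <= ip W x x.
Proof. by rewrite ipxx ler0c sqr_ge0. Qed.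

Lemma ip_eq0 W x : ip W x x = 0 -> forall w, w \in W -> x w = 0.
Proof.
rewrite ipxx sqr_l2 => /complexI/eqP; rewrite psumr_eq0 => [/allP H w /H|w _].
  by move=> /eqP/sqmod_eq0.
exact: sqmod_ge0.
Qed.

(** By induction on the support. The functions of [A] that vanish at one more
point [w] form a subspace [B] of codimension at most one; if it is not [A], then
the projection onto [A] is the projection onto [B] plus the projection onto the
line spanned by a vector [y0] of [A] orthogonal to [B], normalized by
[y0 w = 1]. *)
Lemma projection_exists W A : A 0 ->
  (forall c x y, A x -> A y -> A (c *: x + y)) ->
  (forall x, A x -> forall w, w \notin W -> x w = 0) ->
  forall x, exists2 y, A y & forall z, A z -> ip W (x - y) z = 0.
Proof.
elim: W A => [|w W IH] A A0 AZD AW.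
  by move=> x; exists 0 => // z _; rewrite /ip big_nil.
pose B : set (T -> C) := [set x | A x /\ x w = 0].
have BP x : exists2 y, B y & forall z, B z -> ip W (x - y) z = 0.
  apply: IH => [|c y z [Ay yw] [Az zw]|y [Ay yw] v vW]; first by split.
    by split; [exact: AZD|rewrite !fctE yw zw addr0 scaler0].
  by have [->//|vw] := eqVneq v w; apply: (AW _ Ay); rewrite inE negb_or vw.
have ipB x z : B z -> ip (w :: W) x z = ip W x z.
  by move=> [_ zw]; rewrite /ip big_cons zw conjc0 mulr0 add0r.
have [[y [Ay yw]]|Aw] := pselect (exists y, A y /\ y w != 0); last first.
  have AB z : A z -> B z.
    by move=> Az; split=> //; apply/eqP/negPn/negP => zw; apply: Aw; exists z.
  move=> x; have [y [Ay _] yB] := BP x; exists y => // z /AB Bz.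
  by rewrite ipB// yB.
have [y' [Ay' y'w] y'B] := BP ((y w)^-1 *: y).
pose y0 := (y w)^-1 *: y - y'.
have Ay0 : A y0.
  by rewrite /y0 -scaleN1r addrC; apply: (AZD) => //; rewrite -[_ *: y]addr0; exact: AZD.
have y0w : y0 w = 1.
  by rewrite /y0 !fctE y'w subr0 -[_ *: _]/(_ * _) mulVf.
have y0B z : B z -> ip (w :: W) y0 z = 0 by move=> Bz; rewrite ipB// y'B.
have d0 : ip (w :: W) y0 y0 != 0.
  by apply/eqP => /ip_eq0/(_ w); rewrite mem_head y0w => /(_ isT)/eqP; rewrite oner_eq0.
move=> x; have [x' [Ax' x'w] x'B] := BP x.
pose t := ip (w :: W) (x - x') y0 / ip (w :: W) y0 y0.
exists (t *: y0 + x'); first exact: AZD.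
have decomp : x - (t *: y0 + x') = x - x' - t *: y0 by rewrite opprD addrA addrAC.
have orth_y0 : ip (w :: W) (x - (t *: y0 + x')) y0 = 0.
  by rewrite decomp ipBl ipZl divfK ?subrr.
move=> z Az; pose z' := z - z w *: y0.
have Bz' : B z'.
  split; first by rewrite /z' addrC -scaleNr; exact: AZD.
  by rewrite /z' !fctE y0w -[_ *: _]/(_ * _) mulr1 subrr.
have -> : z = z' + z w *: y0 by rewrite subrK.
rewrite ipDr ipZr orth_y0 mulr0 addr0.
by rewrite decomp ipBl ipZl y0B// mulr0 subr0 ipB// x'B.
Qed.

End InnerProduct.

Section Fibers.
Variables (R : realType) (m n : nat) (X : subproduct_system R m n).
Local Notation C := R[i].
Local Notation word := (seq 'I_m * seq 'I_n)%type.
Local Notation tensor := (word -> C).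
Local Notation words := (words m n).
Implicit Types (x y z : tensor) (s t : nat * nat).

Definition fproj s : tensor -> tensor := oproj s (X s).

Lemma dotpE s x y : dotp s x y = ip (words s) x y.
Proof. by []. Qed.

Lemma fiberD s c x y : X s x -> X s y -> X s (c *: x + y).
Proof. by have [_] := fiber_subspace X s; apply. Qed.

Lemma fiber_0 s : X s 0.
Proof. by have [] := fiber_subspace X s. Qed.

Lemma fiberZ s c x : X s x -> X s (c *: x).
Proof. by move=> Xx; rewrite -[_ *: _]addr0; apply: fiberD => //; exact: fiber_0. Qed.

Lemma fiberB s x y : X s x -> X s y -> X s (x - y).
Proof. by move=> Xx Xy; rewrite addrC -scaleN1r; apply: fiberD. Qed.

Lemma fiber_sum s I (r : seq I) (F : I -> tensor) :
  (forall i, X s (F i)) -> X s (\sum_(i <- r) F i).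
Proof.
move=> XF; elim: r => [|i r IH]; first by rewrite big_nil; exact: fiber_0.
by rewrite big_cons -[F i]scale1r; apply: fiberD.
Qed.

Lemma fiber_eq0 s x w : X s x -> w \notin words s -> x w = 0.
Proof. by move=> /fiber_sub H; rewrite mem_words => /H. Qed.

Lemma homogB s x y : homog s x -> homog s y -> homog s (x - y).
Proof. by move=> hx hy w ws; rewrite !fctE hx// hy// subr0. Qed.

Lemma proj_spec s x : X s (fproj s x) /\
  forall z, X s z -> ip (words s) (x - fproj s x) z = 0.
Proof.
have [y Xy yP] := @projection_exists R word (words s) (X s) (fiber_0 s)
  (@fiberD s) (fun y Xy w => fiber_eq0 Xy) x.
rewrite /fproj /oproj.
exact: (@xgetPex _ 0 [set y | X s y /\ forall z, X s z -> dotp s (x - y) z = 0]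
   (ex_intro _ y (conj Xy yP))).
Qed.

Lemma proj_fiber s x : X s (fproj s x). Proof. exact: (proj_spec s x).1. Qed.

Lemma ip_proj s x z : X s z -> ip (words s) (fproj s x) z = ip (words s) x z.
Proof.
by move=> Xz; apply/esym/eqP; rewrite -subr_eq0 -ipBl (proj_spec s x).2.
Qed.

Lemma fiber_sep s x y : X s x -> X s y ->
  (forall z, X s z -> ip (words s) x z = ip (words s) y z) -> x = y.
Proof.
move=> Xx Xy H; apply/eqP; rewrite -subr_eq0; apply/eqP/funext => w.
have Xxy := fiberB Xx Xy.
case: (boolP (w \in words s)) => [|/(fiber_eq0 Xxy)//].
by apply: ip_eq0; rewrite ipBl H// subrr.
Qed.

Lemma eq_proj s x y : X s y ->
  (forall z, X s z -> ip (words s) x z = ip (words s) y z) -> fproj s x = y.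
Proof.
by move=> Xy H; apply: fiber_sep (proj_fiber _ _) Xy _ => z Xz; rewrite ip_proj// H.
Qed.

Lemma proj_fiber_id s x : X s x -> fproj s x = x.
Proof. by move=> Xx; apply: eq_proj. Qed.

Lemma projD s x y : fproj s (x + y) = fproj s x + fproj s y.
Proof.
apply: eq_proj => [|z Xz]; last by rewrite !ipDl !ip_proj.
by rewrite -[fproj s x]scale1r; apply: fiberD; exact: proj_fiber.
Qed.

Lemma projZ s c x : fproj s (c *: x) = c *: fproj s x.
Proof.
apply: eq_proj => [|z Xz]; last by rewrite !ipZl !ip_proj.
by apply: fiberZ; exact: proj_fiber.
Qed.

Lemma proj_sum s I (r : seq I) (F : I -> tensor) :
  fproj s (\sum_(i <- r) F i) = \sum_(i <- r) fproj s (F i).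
Proof.
elim: r => [|i r IH]; last by rewrite !big_cons projD IH.
by rewrite !big_nil proj_fiber_id//; exact: fiber_0.
Qed.

Lemma proj_homog s x : homog s (fproj s x).
Proof. exact: fiber_sub (proj_fiber _ _). Qed.

Lemma proj_orth s x : homog s x -> orth s (X s) (x - fproj s x).
Proof.
move=> hx; split; first by apply: homogB => //; exact: proj_homog.
by move=> z Xz; rewrite dotpE ipBl ip_proj// subrr.
Qed.

Lemma orth_proj0 s x : orth s (X s) x -> fproj s x = 0.
Proof.
move=> [_ xX]; apply: eq_proj => [|z Xz]; first exact: fiber_0.
by rewrite -dotpE xX// -(scale0r z) ipZl mul0r.
Qed.

(** The finite-dimensional subspace [X s] is its own double orthogonal, as [x] minus
its projection is orthogonal to [X s] and hence to [x]. *)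
Lemma fiber_bidual s x : homog s x ->
  (forall y, orth s (X s) y -> ip (words s) x y = 0) -> X s x.
Proof.
move=> hx H; have ro := proj_orth hx; set r := x - fproj s x in ro.
have -> : x = fproj s x; last exact: proj_fiber.
apply/eqP; rewrite -subr_eq0; apply/eqP/funext => w.
case: (boolP (w \in words s)) => [|]; last first.
  by rewrite mem_words => ws; rewrite -/r ro.1.
apply: ip_eq0; rewrite -/r {1}/r ipBl H// ip_conj.
by rewrite -dotpE ro.2 ?conjc0 ?subr0//; exact: proj_fiber.
Qed.

(** Orthogonality to each vector of [orth s (X s)] passes to limits of coordinates. *)
Lemma fiber_limit s x : homog s x ->
  (forall e : R, 0 < e -> exists2 y, X s y & forall w, cabs (x w - y w) <= e) ->
  X s x.
Proof.
move=> hx H; apply: fiber_bidual => // z [hz zX].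
pose M := \sum_(w <- words s) cabs (z w).
have M0 : 0 <= M by apply: sumr_ge0 => w _; exact: cabs_ge0.
apply: cabs_eq0P => e e0.
have e1 : 0 < e / (M + 1) by rewrite divr_gt0// ltr_wpDl.
have [y Xy xy] := H _ e1.
have -> : ip (words s) x z = ip (words s) (x - y) z.
  by rewrite ipBl [ip _ y z]ip_conj (zX y Xy : ip _ z y = 0) conjc0 subr0.
apply: (le_trans (cabs_sum _ _)).
apply: (@le_trans _ _ (\sum_(w <- words s) e / (M + 1) * cabs (z w))).
  by apply: ler_sum => w _; rewrite cabsM cabs_conj ler_wpM2r ?cabs_ge0// xy.
rewrite -mulr_sumr -/M mulrAC ler_pdivrMr ?ltr_wpDl// ler_wpM2l ?lerDl//.
exact: ltW.
Qed.

Lemma tprod_tensor_set (A B : set tensor) x y : A x -> B y ->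
  tensor_set A B (tprod x y).
Proof.
by move=> Ax By; exists 1%N, (fun=> x), (fun=> y); split=> //; rewrite big_ord1.
Qed.

Lemma smulZDr s t c x y z : X s x -> X t y -> X t z ->
  smul X s t (tprod x (c *: y + z)) =
  c *: smul X s t (tprod x y) + smul X s t (tprod x z).
Proof.
move=> Xx Xy Xz; rewrite -smul_linear; last 2 first.
- exact: tprod_tensor_set.
- exact: tprod_tensor_set.
congr (smul _ _ _ _); apply/funext => p; rewrite /tprod !fctE.
by rewrite -![_ *: _]/(_ * _); ring.
Qed.

Lemma smulZDl s t c x y z : X s x -> X s y -> X t z ->
  smul X s t (tprod (c *: x + y) z) =
  c *: smul X s t (tprod x z) + smul X s t (tprod y z).
Proof.
move=> Xx Xy Xz; rewrite -smul_linear; last 2 first.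
- exact: tprod_tensor_set.
- exact: tprod_tensor_set.
congr (smul _ _ _ _); apply/funext => p; rewrite /tprod !fctE.
by rewrite -![_ *: _]/(_ * _); ring.
Qed.

Lemma smul_tprod_fiber s t x y : X s x -> X t y ->
  X (s + t) (smul X s t (tprod x y)).
Proof. by move=> Xx Xy; apply: smul_fiber; exact: tprod_tensor_set. Qed.

(** A coisometry [U] is a contraction: with [y = U x],
[0 <= |x - U^* y|^2 = |x|^2 - 2 |y|^2 + |U^* y|^2] and [U U^* = I] turns the
last term into [|y|^2]. *)
Lemma smul_contraction s t x y : X s x -> X t y ->
  l2 (words (s + t)) (smul X s t (tprod x y)) <= l2 (words s) x * l2 (words t) y.
Proof.
move=> Xx Xy; have [Us UsP] := smul_coisometry X s t.
have xyT : tensor_set (X s) (X t) (tprod x y) by exact: tprod_tensor_set.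
set z := smul X s t _; have Xz : X (s + t) z by exact: smul_fiber.
have [Uz adj UUz] := UsP z Xz.
pose P := [seq (v, w) | v <- words s, w <- words t].
have dotp2E (a b : word * word -> C) : dotp2 s t a b = ip P a b.
  by rewrite /ip big_allpairs.
have h1 : ip P (tprod x y) (Us z) = ip (words (s + t)) z z.
  by rewrite -dotp2E -adj.
have h2 : ip P (Us z) (Us z) = ip (words (s + t)) z z.
  by rewrite -dotp2E -adj// UUz.
have : 0 <= ip P (tprod x y - Us z) (tprod x y - Us z) by exact: ip_ge0.
have h3 : ip P (Us z) (tprod x y) = ip (words (s + t)) z z.
  by rewrite ip_conj h1 ipxx conjc_real.
rewrite ipBl !ipBr h2 h3 h1 subrr subr0 !ipxx.
rewrite -rmorphB ler0c subr_ge0 => le.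
rewrite -(@ler_pXn2r _ 2) ?nnegrE ?mulr_ge0 ?l2_ge0// (le_trans le)//.
rewrite exprMn !sqr_l2 big_allpairs mulr_suml; apply: ler_sum => v _.
by rewrite mulr_sumr; apply: ler_sum => w _; rewrite sqmodM.
Qed.

Lemma component_homog s x : homog s (component s x).
Proof. by move=> w; rewrite /component; case: ifP. Qed.

Lemma component_id s x : homog s x -> component s x = x.
Proof.
by move=> hx; apply/funext => w; rewrite /component; case: ifPn => // /hx ->.
Qed.

Lemma component_neq s t x : homog s x -> t != s -> component t x = 0.
Proof.
move=> hx st; apply/funext => w; rewrite /component; case: ifP => // /eqP dw.
by apply: hx; rewrite dw.
Qed.

Lemma componentZD s c x y :
  component s (c *: x + y) = c *: component s x + component s y.
Proof.
apply/funext => w; rewrite /component !fctE -![_ *: _]/(_ * _).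
by case: ifP => //; rewrite mulr0 addr0.
Qed.

End Fibers.

Arguments fproj {R m n} X s x.

(** * Bounded operators on the Fock space *)

Section BoundedOperators.
Variables (R : realType) (m n : nat) (X : subproduct_system R m n).
Local Notation C := R[i].
Local Notation word := (seq 'I_m * seq 'I_n)%type.
Local Notation tensor := (word -> C).
Local Notation words := (words m n).
Local Notation box := (box m n).
Local Notation op := (fock X -> fock X).
Implicit Types (x y : fock X) (s t : nat * nat) (A B T : op).

Definition op_le_norm T (K : R) := forall x, fock_norm (T x) <= K * fock_norm x.

Lemma lin0 T : linear T -> T 0 = 0.
Proof.
by move=> lT; have := lT (-1) 0 0; rewrite scaleN1r oppr0 addr0 scaleN1r addNr.
Qed.

Lemma linZ T c x : linear T -> T (c *: x) = c *: T x.
Proof. by move=> lT; rewrite -[c *: x]addr0 lT lin0 ?addr0. Qed.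

Lemma linD T x y : linear T -> T (x + y) = T x + T y.
Proof. by move=> lT; have := lT 1 x y; rewrite !scale1r. Qed.

Lemma linB T x y : linear T -> T (x - y) = T x - T y.
Proof.
by move=> lT; rewrite [x - y]addrC -(scaleN1r y) lT scaleN1r addrC.
Qed.

Lemma lin_sum T I (r : seq I) (F : I -> fock X) : linear T ->
  T (\sum_(i <- r) F i) = \sum_(i <- r) T (F i).
Proof.
move=> lT; elim: r => [|i r IH]; first by rewrite !big_nil lin0.
by rewrite !big_cons linD// IH.
Qed.

Lemma bounded_opP T : bounded_op X T -> linear T /\ exists2 K, 0 <= K & op_le_norm T K.
Proof.
move=> [lT [K TK]]; split=> //; exists (Num.max 0 K); first by rewrite le_max lexx.
by move=> x; rewrite (le_trans (TK x))// ler_wpM2r ?fock_norm_ge0// le_max lexx orbT.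
Qed.

Lemma bounded_opW T K : linear T -> op_le_norm T K -> bounded_op X T.
Proof. by move=> lT TK; split=> //; exists K. Qed.

Lemma op_normP T : bounded_op X T -> op_le_norm T (op_norm T).
Proof.
move=> /bounded_opP[lT [K K0 TK]] x.
have [x0|x0] := eqVneq (fock_norm x) 0.
  have -> : x = 0 by apply: fock_norm_eq0 => e /ltW; rewrite x0.
  by rewrite lin0// fock_norm0 mulr0.
have xp : 0 < fock_norm x by rewrite lt_neqAle eq_sym x0 fock_norm_ge0.
set a := fock_norm x in x0 xp *.
have -> : T x = a%:C *: T ((a^-1)%:C *: x).
  rewrite -linZ// scalerA -rmorphM mulfV//.
  by rewrite rmorph1 scale1r.
apply: (le_trans (fock_normZ _ _)); rewrite cabs_real ?(ltW xp)// mulrC.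
rewrite ler_wpM2r ?(ltW xp)//; apply: ub_le_sup.
  exists K => _ [y y1 <-]; apply: (le_trans (TK _)).
  by rewrite -[leRHS]mulr1 ler_wpM2l.
exists ((a^-1)%:C *: x) => //=; apply: (le_trans (fock_normZ _ _)).
by rewrite cabs_real ?invr_ge0 ?(ltW xp)// mulVf.
Qed.

Lemma op_norm_le T K : 0 <= K -> op_le_norm T K -> op_norm T <= K.
Proof.
move=> K0 TK; apply: ge_sup.
  by exists (fock_norm (T 0)); exists 0 => //=; rewrite fock_norm0.
move=> _ [y y1 <-]; apply: (le_trans (TK _)).
by rewrite -[leRHS]mulr1 ler_wpM2l.
Qed.

Lemma op_norm_ge0 T : bounded_op X T -> 0 <= op_norm T.
Proof.
move=> bT; have := bT; move=> /bounded_opP[lT [K K0 TK]].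
apply: ub_le_sup; last first.
  by exists 0; rewrite /= ?fock_norm0// lin0 ?fock_norm0.
exists K => _ [y y1 <-]; apply: (le_trans (TK _)).
by rewrite -[leRHS]mulr1 ler_wpM2l.
Qed.

Lemma lin_comb c A B : linear A -> linear B -> linear (c \*: A \+ B).
Proof.
move=> lA lB d x y /=; rewrite lA lB !scalerDr !scalerA [c * d]mulrC.
by rewrite addrACA.
Qed.

Lemma bounded_comb c A B : bounded_op X A -> bounded_op X B ->
  bounded_op X (c \*: A \+ B).
Proof.
move=> /bounded_opP[lA [K K0 AK]] /bounded_opP[lB [L L0 BL]].
apply: (@bounded_opW _ (cabs c * K + L)); first exact: lin_comb.
move=> x /=; rewrite (le_trans (fock_normD _ _))// mulrDl lerD//.
by rewrite (le_trans (fock_normZ _ _))// -mulrA ler_wpM2l ?cabs_ge0.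
Qed.

Lemma bounded0 : bounded_op X (fun=> 0).
Proof.
apply: (@bounded_opW _ 0) => [c x y|x]; first by rewrite scaler0 addr0.
by rewrite fock_norm0 mul0r.
Qed.

Lemma bounded_comp A B : bounded_op X A -> bounded_op X B ->
  bounded_op X (A \o B).
Proof.
move=> /bounded_opP[lA [K K0 AK]] /bounded_opP[lB [L L0 BL]].
apply: (@bounded_opW _ (K * L)); first by move=> c x y /=; rewrite lB lA.
by move=> x /=; rewrite (le_trans (AK _))// -mulrA ler_wpM2l.
Qed.

Lemma sub_comb A B : A \- B = (-1 : C) \*: B \+ A.
Proof. by apply/funext => x /=; rewrite scaleN1r addrC. Qed.

Lemma bounded_sub A B : bounded_op X A -> bounded_op X B -> bounded_op X (A \- B).
Proof. by move=> bA bB; rewrite sub_comb; exact: bounded_comb. Qed.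

Lemma op_norm_dist A B T : bounded_op X A -> bounded_op X B -> bounded_op X T ->
  op_le_norm (A \- B) (op_norm (T \- A) + op_norm (T \- B)).
Proof.
move=> bA bB bT x /=; rewrite mulrDl -[A x - _](subrKA (T x)).
rewrite (le_trans (fock_normD _ _))// lerD//; last exact: op_normP (bounded_sub _ _) _.
rewrite -fock_normN opprB; exact: (op_normP (bounded_sub _ _)).
Qed.

(** ** Truncation *)

Lemma fock_intro (x : tensor) (K : R) : (forall s, X s (component s x)) ->
  (forall N, \sum_(w <- box N) sqmod (x w) <= K) -> x \in fock_pred X.
Proof.
move=> Xx xK; rewrite /fock_pred unfold_in /= inE; split=> //.
by apply: le_lt_trans (esum_le_box xK) _; rewrite ltry.
Qed.

Definition to_fock (x : tensor) : fock X := insubd (0 : fock X) x.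

Lemma to_fockK (x : tensor) : x \in fock_pred X -> to_fock x = x :> tensor.
Proof. by move=> xX; exact: (insubdK (0 : fock X) xX). Qed.

Lemma homog_fock s (x : tensor) : X s x -> x \in fock_pred X.
Proof.
move=> Xx; have hx := fiber_sub Xx.
apply: (@fock_intro _ (\sum_(w <- words s) sqmod (x w))).
  move=> t; have [->|ts] := eqVneq t s; first by rewrite component_id.
  by rewrite (component_neq hx ts); exact: fiber_0.
move=> N; rewrite (bigID (mem (words s)))/= [X in _ + X]big1 ?addr0; last first.
  by move=> w ws; rewrite (fiber_eq0 Xx ws) /sqmod expr0n addr0.
rewrite -big_filter; apply: ler_sum_sub; rewrite ?filter_uniq ?uniq_box ?uniq_words//.
  by move=> w; rewrite mem_filter => /andP[].
by move=> w; exact: sqmod_ge0.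
Qed.

Lemma to_fock_homog s (x : tensor) : X s x -> to_fock x = x :> tensor.
Proof. by move=> /homog_fock; exact: to_fockK. Qed.

Lemma fock_component x s : X s (component s x).
Proof. by have [] := fock_valP x. Qed.

Definition trunc N x : fock X := \sum_(s <- degs N) to_fock (component s x).

Lemma fock_sumE I (r : seq I) (F : I -> fock X) w :
  (\sum_(i <- r) F i : fock X) w = \sum_(i <- r) F i w.
Proof.
by elim: r => [|i r IH]; rewrite ?big_nil// !big_cons fockDE IH.
Qed.

Lemma truncE N x w : trunc N x w = if w \in box N then x w else 0.
Proof.
rewrite /trunc fock_sumE.
under eq_bigr do rewrite (to_fock_homog (fock_component _ _)) /component.
rewrite mem_box; case: ifPn => dw; last first.
  by apply: big1_seq => s /andP[_ sN]; case: eqP => // ds; rewrite ds sN in dw.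
rewrite (big_rem (deg w))//= eqxx big1_seq ?addr0// => s /andP[_].
by rewrite mem_rem_uniq ?uniq_degs// inE eq_sym => /andP[/negPf ->].
Qed.

(** A box carrying all but [e^2] of the squared norm of [x] will do. *)
Lemma trunc_cvg x (e : R) : 0 < e -> exists N, fock_norm (x - trunc N x) <= e.
Proof.
move=> e0; have [xe|ex] := leP (fock_norm x) e.
  exists 0%N; have -> : trunc 0 x = 0 by rewrite /trunc big_nil.
  by rewrite subr0.
pose K := Num.sqrt (fock_norm x ^+ 2 - e ^+ 2).
have K2 : K ^+ 2 = fock_norm x ^+ 2 - e ^+ 2.
  rewrite sqr_sqrtr// subr_ge0 ler_pXn2r ?nnegrE ?fock_norm_ge0 ?(ltW e0)//.
  exact: ltW.
have Kx : K < fock_norm x.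
  rewrite -(@ltr_pXn2r _ 2) ?nnegrE ?fock_norm_ge0 ?sqrtr_ge0// K2.
  by rewrite ltrBlDr ltrDl exprn_gt0.
have [N /ltW KN] := norm_lt_box (sqrtr_ge0 _) Kx; exists N.
apply: norm_le_box => [|M]; first exact: ltW.
rewrite -(@ler_pXn2r _ 2) ?nnegrE ?l2_ge0 ?(ltW e0)// sqr_l2.
have -> : \sum_(w <- box M) sqmod ((x - trunc N x) w) =
    \sum_(w <- [seq w <- box M | w \notin box N]) sqmod (x w).
  rewrite big_filter [RHS]big_mkcond; apply: eq_bigr => w _.
  rewrite fockBE truncE; case: (w \in box N); rewrite ?subr0//= subrr.
  by rewrite /sqmod expr0n addr0.
rewrite -(lerD2r (K ^+ 2)) {2}K2 addrC addrCA subrr addr0.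
apply: (@le_trans _ _ (l2 (box (maxn M N)) x ^+ 2)); last first.
  by rewrite ler_pXn2r ?nnegrE ?l2_ge0 ?fock_norm_ge0// box_le_norm.
apply: (@le_trans _ _ (l2 (box N) x ^+ 2 +
   \sum_(w <- [seq w <- box M | w \notin box N]) sqmod (x w))).
  by rewrite lerD2r ler_pXn2r ?nnegrE ?l2_ge0 ?sqrtr_ge0.
rewrite !sqr_l2 -big_cat; apply: ler_sum_sub.
- rewrite cat_uniq filter_uniq ?uniq_box// andbT /=; apply/hasPn => w.
  by rewrite mem_filter => /andP[].
- exact: uniq_box.
- move=> w; rewrite mem_cat mem_filter => /orP[|/andP[_]]; apply: box_mono;
  by rewrite leq_max leqnn ?orbT.
- by move=> w; exact: sqmod_ge0.
Qed.

(** The truncations of a vector are sums of vectors of the fibers and converge to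
it. *)
Lemma bounded_ext A B : bounded_op X A -> bounded_op X B ->
  (forall t x, X t x -> A x = B x) -> A = B.
Proof.
move=> bA bB AB; apply/funext => x; apply/eqP; rewrite -subr_eq0; apply/eqP.
have bD := bounded_sub bA bB; have [lD [K K0 DK]] := bounded_opP bD.
apply: fock_norm_eq0 => e e0.
have e1 : 0 < e / (K + 1) by rewrite divr_gt0// ltr_wpDl.
have [N xN] := trunc_cvg x e1.
have -> : A x - B x = (A \- B) (x - trunc N x).
  rewrite (linB _ _ lD) [X in _ = _ - X](_ : _ = 0) ?subr0//.
  rewrite /trunc lin_sum//; apply: big1_seq => s _ /=.
  have Xs := fock_component x s.
  by rewrite (AB s) ?subrr// (to_fock_homog Xs).
apply: (le_trans (DK _)); apply: (@le_trans _ _ (K * (e / (K + 1)))).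
  by rewrite ler_wpM2l.
rewrite mulrA ler_pdivrMr ?ltr_wpDl// mulrC ler_wpM2l ?lerDl//; exact: ltW.
Qed.

End BoundedOperators.

(** * Creation operators *)

Section Creation.
Variables (R : realType) (m n : nat) (X : subproduct_system R m n).
Local Notation C := R[i].
Local Notation word := (seq 'I_m * seq 'I_n)%type.
Local Notation tensor := (word -> C).
Local Notation words := (words m n).
Local Notation box := (box m n).
Local Notation op := (fock X -> fock X).
Implicit Types (x y : fock X) (s t : nat * nat) (eta : tensor).

Definition deg_le s t := (s.1 <= t.1)%N && (s.2 <= t.2)%N.
Definition deg_sub t s := ((t.1 - s.1)%N, (t.2 - s.2)%N).

Lemma deg_subK s t : deg_le s t -> s + deg_sub t s = t.
Proof.
case: s t => a b [c d] /andP[/= ac bd].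
by congr (_, _); rewrite /= -[LHS]/(_ + _)%N subnKC.
Qed.

Lemma deg_addK s t : deg_sub (s + t) s = t.
Proof.
by case: s t => a b [c d]; congr (_, _); rewrite /= -[(_ + _)%R]/(_ + _)%N addKn.
Qed.

Lemma deg_leD s t : deg_le s (s + t).
Proof. by rewrite /deg_le /= -![(_ + _)%R]/(_ + _)%N !leq_addr. Qed.

Lemma degsD N s t : (s + t \in degs N) = (s.1 + t.1 < N)%N && (s.2 + t.2 < N)%N.
Proof. by rewrite mem_degs. Qed.

(** The defining condition of [creation_op] only prescribes an operator on the
fibers. This is the resulting formula on coordinates: a word of degree [t] receives
only the contribution of the component of degree [t - s]. *)
Definition create s eta (x : tensor) : tensor := fun w =>
  if deg_le s (deg w) then
    let t := deg_sub (deg w) s in smul X s t (tprod eta (component t x)) w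
  else 0.

Definition creation s eta : op := fun x => to_fock X (create s eta x).

Lemma component_create s eta x t : X s eta ->
  component t (create s eta x) =
  if deg_le s t then smul X s (deg_sub t s) (tprod eta (component (deg_sub t s) x))
  else 0.
Proof.
move=> Xe; have hom : deg_le s t -> homog t (smul X s (deg_sub t s)
    (tprod eta (component (deg_sub t s) x))).
  move=> st; rewrite -{1}(deg_subK st); apply: fiber_sub.
  apply: smul_tprod_fiber => //; exact: fock_component.
apply/funext => w; rewrite /component /create; case: eqP => [->|/eqP dw].
  by case: ifP.
by case: ifP => // /hom ->.
Qed.

(** Used to bound the norm of a creation operator, which moves the component of
degree [t - s] to degree [t]. *)
Lemma sum_shift_le (A : realDomainType) N s (G : nat * nat -> A) :
  (forall t, 0 <= G t) ->
  \sum_(t <- degs N | deg_le s t) G (deg_sub t s) <= \sum_(t <- degs N) G t.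
Proof.
move=> G0; rewrite -big_filter -(big_map (deg_sub^~ s) xpredT).
apply: ler_sum_sub => //; rewrite ?uniq_degs//.
  rewrite map_inj_in_uniq ?filter_uniq ?uniq_degs// => a b.
  rewrite !mem_filter => /andP[sa _] /andP[sb _] ab.
  by rewrite -(deg_subK sa) -(deg_subK sb) ab.
move=> t /mapP[v]; rewrite mem_filter => /andP[sv vN] ->.
move: vN; rewrite !mem_degs => /andP[a b].
by rewrite !(leq_ltn_trans (leq_subr _ _)).
Qed.

Lemma l2_component s (x : tensor) : l2 (words s) (component s x) = l2 (words s) x.
Proof.
rewrite /l2; congr (Num.sqrt _); apply: eq_big_seq => w.
by rewrite mem_words /component => ->.
Qed.

Lemma create_box s eta x N : X s eta ->
  \sum_(w <- box N) sqmod (create s eta x w) <=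
  (l2 (words s) eta * l2 (box N) x) ^+ 2.
Proof.
move=> Xe; rewrite exprMn sqr_l2 [in leRHS](sqr_l2 (box N)) !big_box.
pose G t := \sum_(w <- words t) sqmod (x w).
apply: (@le_trans _ _ ((\sum_(w <- words s) sqmod (eta w)) *
    \sum_(t <- degs N | deg_le s t) G (deg_sub t s))); last first.
  rewrite ler_wpM2l ?sum_sqmod_ge0// sum_shift_le// => t; exact: sum_sqmod_ge0.
rewrite mulr_sumr [leRHS]big_mkcond; apply: ler_sum => t _.
have -> : \sum_(w <- words t) sqmod (create s eta x w) =
    l2 (words t) (component t (create s eta x)) ^+ 2.
  by rewrite l2_component sqr_l2.
rewrite component_create//; case: ifP => [st|_]; last first.
  rewrite (_ : l2 _ _ = 0) ?expr0n// /l2 big1 ?sqrtr0// => w _.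
  by rewrite /sqmod expr0n addr0.
rewrite -sqr_l2 /G -sqr_l2 -(l2_component (deg_sub t s)) -exprMn.
rewrite ler_pXn2r ?nnegrE ?mulr_ge0 ?l2_ge0//.
rewrite -{1}(deg_subK st); apply: smul_contraction => //; exact: fock_component.
Qed.

Lemma create_fock s eta x : X s eta -> create s eta x \in fock_pred X.
Proof.
move=> Xe; apply: (@fock_intro _ _ _ _ _ ((l2 (words s) eta * fock_norm x) ^+ 2)).
  move=> t; rewrite component_create//; case: ifP => [st|_]; last exact: fiber_0.
  rewrite -{1}(deg_subK st); apply: smul_tprod_fiber => //; exact: fock_component.
move=> N; apply: (le_trans (create_box _ _ Xe)).
rewrite ler_pXn2r ?nnegrE ?mulr_ge0 ?l2_ge0 ?fock_norm_ge0//.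
by rewrite ler_wpM2l ?l2_ge0 ?box_le_norm.
Qed.

Lemma creationE s eta x : X s eta -> creation s eta x = create s eta x :> tensor.
Proof. by move=> Xe; exact/to_fockK/create_fock. Qed.

Lemma creation_linear s eta : X s eta -> linear (creation s eta).
Proof.
move=> Xe c x y; apply: fock_eqP => w; rewrite fockZDE !creationE//.
rewrite /create; case: ifP => _; last by rewrite mulr0 addr0.
by rewrite /= componentZD smulZDr//; exact: fock_component.
Qed.

Lemma creation_norm s eta : X s eta ->
  op_le_norm (creation s eta) (l2 (words s) eta).
Proof.
move=> Xe x; apply: norm_le_box => [|N].
  by rewrite mulr_ge0 ?l2_ge0 ?fock_norm_ge0.
rewrite -(@ler_pXn2r _ 2) ?nnegrE ?mulr_ge0 ?l2_ge0 ?fock_norm_ge0// sqr_l2.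
rewrite creationE// (le_trans (create_box _ _ Xe))//.
rewrite ler_pXn2r ?nnegrE ?mulr_ge0 ?l2_ge0 ?fock_norm_ge0//.
by rewrite ler_wpM2l ?l2_ge0 ?box_le_norm.
Qed.

Lemma creation_bounded s eta : X s eta -> bounded_op X (creation s eta).
Proof.
move=> Xe; exact: bounded_opW (creation_linear Xe) (creation_norm Xe).
Qed.

Lemma creation_fiber s eta t x : X s eta -> X t x ->
  creation s eta x = smul X s t (tprod eta x) :> tensor.
Proof.
move=> Xe Xx; have hx := fiber_sub Xx.
rewrite creationE//; apply/funext => w.
have := component_create x (deg w) Xe; move/(congr1 (@^~ w)).
rewrite {1}/component eqxx => ->; case: ifP => st; last first.
  rewrite (fiber_eq0 (smul_tprod_fiber Xe Xx))// mem_words.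
  by apply: contraFN st => /eqP ->; exact: deg_leD.
have [e|ne] := eqVneq (deg_sub (deg w) s) t; first by rewrite e component_id.
rewrite (component_neq hx ne) (fiber_eq0 (smul_tprod_fiber Xe Xx)); last first.
  by rewrite mem_words; apply: contraNN ne => /eqP ->; rewrite deg_addK.
have X0 := fiber_0 X (deg_sub (deg w) s).
have := smulZDr 0 Xe X0 X0; rewrite scaler0 addr0 scale0r add0r.
set z := smul _ _ _ _; move/(congr1 (fun f => f - z)).
have := smulZDr 1 Xe X0 X0; rewrite scaler0 addr0 scale1r => /(congr1 (fun f => f - z)).
by rewrite -/z addrK subrr => <-.
Qed.

Lemma creation_is_creation_op s eta : X s eta -> creation_op X (creation s eta).
Proof.
move=> Xe; split; first exact: creation_bounded.
by exists s, eta; split=> // t x Xx; exact: creation_fiber.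
Qed.

(** A creation operator is determined by its values on the fibers. *)
Lemma creation_opE (T : op) : creation_op X T ->
  exists s eta, X s eta /\ T = creation s eta.
Proof.
move=> [bT [s [eta [Xe TE]]]]; exists s, eta; split=> //.
apply: bounded_ext => // [|t x Xx]; first exact: creation_bounded.
by apply: val_inj; rewrite /= (TE _ _ Xx) (creation_fiber Xe Xx).
Qed.

Lemma creation_comb s c eta xi : X s eta -> X s xi ->
  creation s (c *: eta + xi) = c \*: creation s eta \+ creation s xi.
Proof.
move=> Xe Xx; have Xex := fiberD c Xe Xx.
apply: bounded_ext => [||t x Xt]; first exact: creation_bounded.
  by apply: bounded_comb; exact: creation_bounded.
apply: fock_eqP => w; rewrite (creation_fiber Xex Xt) smulZDl//.
rewrite -[RHS]/((c *: creation s eta x + creation s xi x) w) fockZDE.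
by rewrite !(creation_fiber _ Xt).
Qed.

Lemma creationM s t eta xi : X s eta -> X t xi ->
  creation s eta \o creation t xi = creation (s + t) (smul X s t (tprod eta xi)).
Proof.
move=> Xe Xx; have Xex := smul_tprod_fiber Xe Xx.
apply: bounded_ext => [||r x Xr]; last 1 first.
- apply: fock_eqP => w; rewrite /= (creation_fiber Xex Xr) smulA//.
  have Xxx : X (t + r) (creation t xi x).
    by rewrite (creation_fiber Xx Xr); exact: smul_tprod_fiber.
  by rewrite (creation_fiber Xe Xxx) (creation_fiber Xx Xr).
- by apply: bounded_comp; exact: creation_bounded.
- exact: creation_bounded.
Qed.

Definition unit_tensor : tensor := fun w => (w == ([::], [::]))%:R.

Lemma fiber_unit : X (0, 0)%N unit_tensor.
Proof.
rewrite fiber0 => w; rewrite /unit_tensor.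
by have [->|//] := eqVneq w ([::], [::]); rewrite eqxx.
Qed.

Lemma creation_unit : creation (0, 0)%N unit_tensor = id.
Proof.
apply: bounded_ext => [||t x Xt]; first exact/creation_bounded/fiber_unit.
  by apply: (@bounded_opW _ _ _ _ _ 1) => // x; rewrite mul1r.
apply: fock_eqP => w; rewrite (creation_fiber fiber_unit Xt) smul_unitl//.
  by rewrite /unit_tensor eqxx scale1r.
exact: fiber_unit.
Qed.

End Creation.

Arguments creation {R m n} X s eta.

(** * Completeness and automatic continuity of characters *)

Section Complete.
Variables (R : realType) (m n : nat) (X : subproduct_system R m n).
Local Notation C := R[i].
Local Notation word := (seq 'I_m * seq 'I_n)%type.
Local Notation tensor := (word -> C).
Local Notation words := (words m n).
Local Notation box := (box m n).
Local Notation op := (fock X -> fock X).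
Implicit Types (x y : fock X) (s t : nat * nat) (A B T : op).

Lemma l2_le_sum (W : seq word) (x : tensor) : l2 W x <= \sum_(w <- W) cabs (x w).
Proof.
elim: W => [|w W IH]; first by rewrite /l2 !big_nil sqrtr0.
have s0 : 0 <= \sum_(w <- W) cabs (x w) by apply: sumr_ge0 => v _; exact: cabs_ge0.
rewrite -(@ler_pXn2r _ 2) ?nnegrE ?l2_ge0// ?sqr_l2 ?big_cons ?addr_ge0 ?cabs_ge0//.
rewrite -sqr_cabs -sqr_l2 sqrrD; have := cabs_ge0 (x w); have := l2_ge0 W x.
move: IH s0; move: (l2 W x) (\sum_(_ <- _) _) (cabs (x w)) => a b c ab b0 a0 c0.
nra.
Qed.

(** Limits are taken coordinatewise. The limit lies in the Fock space because the
fibers are closed, and its distance to [y k] can be tested on boxes, where only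
finitely many coordinates matter. *)
Lemma fock_complete (y : nat -> fock X) (d : nat -> R) :
  (forall k l, (k <= l)%N -> fock_norm (y l - y k) <= d k) ->
  (forall e : R, 0 < e -> exists k, d k < e) ->
  exists x, forall k, fock_norm (y k - x) <= d k.
Proof.
move=> yd d0.
have /choice[z zP] : forall w, exists c : C, forall k, cabs (y k w - c) <= d k.
  move=> w; apply: complex_cauchy_rate => // k l kl.
  by rewrite -fockBE (le_trans (coord_le_norm _ _))// yd.
have near k (e : R) : 0 < e -> exists2 l, (k <= l)%N & forall w, cabs (y l w - z w) <= e.
  move=> e0; have [j dj] := d0 (e / 2) (divr_gt0 e0 (ltr0Sn _ 1)).
  exists (maxn k j) => [|w]; first exact: leq_maxl.
  apply: (le_trans (cabs_dist _ (y j w) _)); rewrite (splitr e) lerD//.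
    rewrite -fockBE (le_trans (coord_le_norm _ _))// (le_trans _ (ltW dj))//.
    by rewrite yd// leq_maxr.
  exact: le_trans (zP _ _) (ltW dj).
have l2z (W : seq word) k :
    (forall l, (k <= l)%N -> l2 W (fun w => y k w - y l w) <= d k) ->
    l2 W (fun w => y k w - z w) <= d k.
  move=> H; apply/ler_addgt0Pl => e e0.
  have e1 : 0 < e / (size W).+1%:R by rewrite divr_gt0.
  have [l kl yz] := near k _ e1.
  rewrite (@eq_l2 _ _ _ _ (fun w => (y l w - z w) + (y k w - y l w))); last first.
    by move=> w; ring.
  rewrite (le_trans (l2D _ _ _))// lerD ?H// (le_trans (l2_le_sum _ _))//.
  apply: (@le_trans _ _ (\sum_(w <- W) e / (size W).+1%:R)).
    by apply: ler_sum => w _; exact: yz.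
  rewrite big_const_seq count_predT iter_addr_0 -[leLHS]mulr_natr mulrAC.
  by rewrite ler_pdivrMr ?ltr0Sn// ler_wpM2l ?(ltW e0)// ler_nat.
have boxz N k : l2 (box N) (fun w => y k w - z w) <= d k.
  apply: l2z => l kl.
  apply: (@le_trans _ _ (fock_norm (y k - y l))); first exact: (box_le_norm (y k - y l) N).
  by rewrite -fock_normN opprB yd.
have zX : z \in fock_pred X.
  apply: (@fock_intro _ _ _ _ _ ((d 0%N + fock_norm (y 0%N)) ^+ 2)) => [s|N].
    apply: fiber_limit; first exact: component_homog.
    move=> e e0; have [l _ yz] := near 0%N _ e0.
    exists (component s (y l)); first exact: fock_component.
    move=> w; rewrite /component; case: ifP => _; first by rewrite cabsB.
    by rewrite subrr cabs0 ltW.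
  have d00 : 0 <= d 0%N by apply: le_trans (boxz 0%N 0%N); exact: l2_ge0.
  rewrite -sqr_l2 ler_pXn2r ?nnegrE ?l2_ge0 ?addr_ge0 ?fock_norm_ge0//.
  rewrite (@eq_l2 _ _ _ _ (fun w => (-1) * (y 0%N w - z w) + y 0%N w)); last first.
    by move=> w; ring.
  rewrite (le_trans (l2D _ _ _))// l2Z cabsN cabs1 mul1r.
  by rewrite lerD ?boxz ?box_le_norm.
exists (to_fock X z) => k; apply: norm_le_box => [|N].
  by apply: le_trans (boxz 0%N k); exact: l2_ge0.
by rewrite (eq_l2 _ (fun w => fockBE _ _ w)) to_fockK.
Qed.

(** ** The tensor algebra *)

Lemma bounded_closed : closed_subalgebra (bounded_op X).
Proof.
split=> //; [exact: bounded0|by move=> c A B; exact: bounded_comb|].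
by move=> A B; exact: bounded_comp.
Qed.

Lemma algebra_bounded T : tensor_algebra X T -> bounded_op X T.
Proof. by apply; split; [exact: bounded_closed|move=> ? []]. Qed.

Lemma algebra_closed : closed_subalgebra (tensor_algebra X).
Proof.
split=> [|S [[_ S0 _ _ _] _]//|c A B HA HB S HS|A B HA HB S HS|T bT HT S HS].
- exact: algebra_bounded.
- by have [_ _ + _ _] := HS.1; apply; [exact: HA|exact: HB].
- by have [_ _ _ + _] := HS.1; apply; [exact: HA|exact: HB].
- have [_ _ _ _ cl] := HS.1; apply: cl => // e e0.
  by have [A HA AT] := HT e e0; exists A => //; exact: HA.
Qed.

Lemma algebra_comb c A B : tensor_algebra X A -> tensor_algebra X B ->
  tensor_algebra X (c \*: A \+ B).
Proof. by have [_ _ H _ _] := algebra_closed; exact: H. Qed.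

Lemma algebra_comp A B : tensor_algebra X A -> tensor_algebra X B ->
  tensor_algebra X (A \o B).
Proof. by have [_ _ _ H _] := algebra_closed; exact: H. Qed.

Lemma algebra_0 : tensor_algebra X (fun=> 0).
Proof. by have [_ H _ _ _] := algebra_closed. Qed.

Lemma algebra_creation s eta : X s eta -> tensor_algebra X (creation X s eta).
Proof. by move=> Xe S [_]; apply; exact: creation_is_creation_op. Qed.

Lemma algebra_id : tensor_algebra X id.
Proof. by have := algebra_creation (fiber_unit X); rewrite creation_unit. Qed.

Lemma algebraD A B : tensor_algebra X A -> tensor_algebra X B ->
  tensor_algebra X (A \+ B).
Proof.
move=> HA HB; have -> : A \+ B = (1 : C) \*: A \+ B.
  by apply/funext => x /=; rewrite scale1r.
exact: algebra_comb.
Qed.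

Lemma algebraZ c A : tensor_algebra X A -> tensor_algebra X (c \*: A).
Proof.
move=> HA; have -> : c \*: A = c \*: A \+ (fun=> 0).
  by apply/funext => x /=; rewrite addr0.
by apply: algebra_comb => //; exact: algebra_0.
Qed.

(** ** Neumann series *)

Lemma geometric_small (q M e : R) : 0 <= q < 1 -> 0 < e -> exists k, q ^+ k * M < e.
Proof.
move=> /andP[q0 q1] e0; have M0 : 0 < `|M| + 1 by rewrite ltr_wpDl.
have /cvgrPdist_lt /(_ (e / (`|M| + 1)) (divr_gt0 e0 M0)) [k _ /(_ k (leqnn k))] :
    (fun k => q ^+ k) @ \oo --> (0 : R).
  by apply: cvg_expr; rewrite ger0_norm.
rewrite /= sub0r normrN ger0_norm ?exprn_ge0// => qk; exists k.
apply: (@le_lt_trans _ _ (q ^+ k * (`|M| + 1))).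
  by rewrite ler_wpM2l ?exprn_ge0// ler_wpDr// ler_norm.
by rewrite -ltr_pdivlMr.
Qed.

(** [Y] is the sum of [S + S^2 + ...]. Its partial sums [P k] satisfy
[P (k + j) - P k = S^k (P j)], hence are Cauchy at a geometric rate that is uniform on
the unit ball; so [Y] is a norm limit of elements of the algebra. *)
Lemma neumann (S : op) (q : R) : tensor_algebra X S -> 0 <= q < 1 ->
  op_le_norm S q -> exists2 Y, tensor_algebra X Y & Y = S \+ (S \o Y).
Proof.
move=> HS q01 Sq; have /andP[q0 q1] := q01.
have lS : linear S by have [] := algebra_bounded HS.
pose P k := iter k (fun A : op => S \+ (S \o A)) (fun=> 0).
have HP k : tensor_algebra X (P k).
  elim: k => [|k IH]; first exact: algebra_0.
  by apply: algebraD => //; exact: algebra_comp.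
pose c := (1 - q)^-1; have c0 : 0 <= c by rewrite invr_ge0 subr_ge0 ltW.
have Pc j x : fock_norm (P j x) <= c * fock_norm x.
  elim: j => [|j IH]; first by rewrite fock_norm0 mulr_ge0 ?fock_norm_ge0.
  rewrite /= (le_trans (fock_normD _ _))//.
  apply: (@le_trans _ _ (q * fock_norm x + q * (c * fock_norm x))).
    by rewrite lerD ?Sq// (le_trans (Sq _))// ler_wpM2l.
  rewrite mulrA -mulrDl ler_wpM2r ?fock_norm_ge0//.
  have : c * (1 - q) = 1 by rewrite mulVf// subr_eq0 gt_eqF.
  by rewrite mulrBr mulr1 mulrC; lra.
have Pd k j x : fock_norm (P (k + j)%N x - P k x) <= q ^+ k * (c * fock_norm x).
  elim: k => [|k IH]; first by rewrite subr0 mul1r.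
  rewrite addSn /= opprD addrACA subrr add0r -linB// (le_trans (Sq _))//.
  by rewrite exprS -mulrA ler_wpM2l.
have /choice[Y YP] : forall x, exists y, forall k,
    fock_norm (P k x - y) <= q ^+ k * (c * fock_norm x).
  move=> x; apply: fock_complete => [k l kl|e e0]; last exact: geometric_small.
  by rewrite -(subnKC kl).
have uniq_lim (M : R) y : (forall k, fock_norm y <= q ^+ k * M) -> y = 0.
  move=> H; apply: fock_norm_eq0 => e e0.
  by have [k /ltW qk] := geometric_small M q01 e0; apply: le_trans qk.
have linP k : linear (P k) by have [] := algebra_bounded (HP k).
have lY : linear Y.
  move=> a x y; apply/eqP; rewrite -subr_eq0; apply/eqP.
  apply: (uniq_lim (c * fock_norm (a *: x + y) +
     (cabs a * (c * fock_norm x) + c * fock_norm y))) => k.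
  rewrite -fock_normN opprB.
  have -> : a *: Y x + Y y - Y (a *: x + y) = (P k (a *: x + y) - Y (a *: x + y)) -
      (a *: (P k x - Y x) + (P k y - Y y)).
    rewrite linP scalerBr; set u := Y (_ + _); set u1 := a *: P k x.
    set u2 := P k y; set u3 := a *: Y x; set u4 := Y y.
    by rewrite [u1 - u3 + _]addrACA -opprD opprB [RHS]addrC addrA subrK.
  apply: le_trans (fock_normD _ _) _; rewrite [in leRHS]mulrDr; apply: lerD.
    exact: YP.
  rewrite fock_normN; apply: le_trans (fock_normD _ _) _.
  rewrite [in leRHS]mulrDr; apply: lerD; last exact: YP.
  apply: le_trans (fock_normZ _ _) _; rewrite mulrCA; apply: ler_wpM2l.
    exact: cabs_ge0.
  exact: YP.
have bY : bounded_op X Y.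
  apply: (@bounded_opW _ _ _ _ _ c) => // x.
  by have := YP x 0%N; rewrite sub0r fock_normN mul1r.
exists Y.
  have [_ _ _ _ cl] := algebra_closed; apply: cl => // e e0.
  have [k qk] := geometric_small c q01 e0; exists (P k) => //.
  apply: le_lt_trans qk; apply: op_norm_le; first by rewrite mulr_ge0 ?exprn_ge0.
  by move=> x; rewrite -fock_normN opprB -mulrA YP.
apply/funext => x; apply/eqP; rewrite -subr_eq0; apply/eqP.
apply: (uniq_lim (c * fock_norm x + q * (c * fock_norm x))) => k.
rewrite (le_trans (fock_norm_dist _ (P k.+1 x) _))// mulrDr lerD//.
  rewrite -fock_normN opprB (le_trans (YP _ _))// exprS -mulrA.
  by rewrite ler_piMl ?(ltW q1)// ?mulr_ge0 ?exprn_ge0 ?fock_norm_ge0.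
rewrite /= opprD addrACA subrr add0r -linB// (le_trans (Sq _))//.
by rewrite mulrCA ler_wpM2l.
Qed.

(** ** Characters *)

(** A character as a function of arbitrary operators, with the junk value [0]
outside the tensor algebra, so that it can be applied to compound operators. *)
Definition ev (chi : tensor_algebra X -> C^o) (T : op) : C :=
  oapp chi 0 (insub T : option (tensor_algebra X)).

Lemma ev_val chi (A : tensor_algebra X) : ev chi (val A) = chi A.
Proof. by rewrite /ev valK. Qed.

Lemma algebraP T : tensor_algebra X T -> exists A : tensor_algebra X, val A = T.
Proof. by move=> HT; exists (exist _ T (mem_set HT)). Qed.

Lemma algebra_val (A : tensor_algebra X) : tensor_algebra X (val A).
Proof. by case: A => A HA; exact: set_mem. Qed.

Section Character.
Variable chi : tensor_algebra X -> C^o.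
Hypothesis chiX : characters X chi.

Lemma evZD c A B : tensor_algebra X A -> tensor_algebra X B ->
  ev chi (c \*: A \+ B) = c * ev chi A + ev chi B.
Proof.
move=> HA HB; have [A' eA] := algebraP HA; have [B' eB] := algebraP HB.
have [D eD] := algebraP (algebra_comb c HA HB); have [+ _ _] := chiX.
by rewrite -eD -eA -eB !ev_val; apply; rewrite eD eA eB.
Qed.

Lemma evM A B : tensor_algebra X A -> tensor_algebra X B ->
  ev chi (A \o B) = ev chi A * ev chi B.
Proof.
move=> HA HB; have [A' eA] := algebraP HA; have [B' eB] := algebraP HB.
have [D eD] := algebraP (algebra_comp HA HB); have [_ + _] := chiX.
by rewrite -eD -eA -eB !ev_val; apply; rewrite eD eA eB.
Qed.

Lemma ev0 : ev chi (fun=> 0) = 0.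
Proof.
have := evZD (-1) algebra_0 algebra_0; rewrite mulN1r addNr => <-.
by congr ev; apply/funext => x /=; rewrite scaler0 addr0.
Qed.

Lemma evD A B : tensor_algebra X A -> tensor_algebra X B ->
  ev chi (A \+ B) = ev chi A + ev chi B.
Proof.
move=> HA HB; rewrite -[ev chi A]mul1r -evZD//; congr ev.
by apply/funext => x /=; rewrite scale1r.
Qed.

Lemma evZ c A : tensor_algebra X A -> ev chi (c \*: A) = c * ev chi A.
Proof.
move=> HA; rewrite -[RHS]addr0 -ev0 -evZD//; last exact: algebra_0.
by congr ev; apply/funext => x /=; rewrite addr0.
Qed.

Lemma ev_id : ev chi id = 1.
Proof.
have [_ _ [A chiA]] := chiX; have := evM algebra_id (algebra_val A).
rewrite /comp /= -[X in ev chi X = _]/(val A) ev_val => /eqP.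
by rewrite -subr_eq0 -{1}[chi A]mul1r -mulrBl mulf_eq0 subr_eq0 (negPf chiA) orbF
  => /eqP <-.
Qed.

(** If [|T| < |chi T|], then [S = T / chi T] has norm less than [1] and
[chi S = 1], so applying [chi] to [Y = S + S Y] gives [chi Y = 1 + chi Y]. *)
Lemma character_contractive T : tensor_algebra X T -> cabs (ev chi T) <= op_norm T.
Proof.
move=> HT; have bT := algebra_bounded HT; have T0 := op_norm_ge0 bT.
rewrite leNgt; apply/negP => lt; have a0 := le_lt_trans T0 lt.
have evT0 : ev chi T != 0 by apply: contraTneq a0 => ->; rewrite cabs0 ltxx.
have HS := algebraZ (ev chi T)^-1 HT.
have [||Y HY YE] := @neumann _ (op_norm T / cabs (ev chi T)) HS.
- by rewrite divr_ge0 ?cabs_ge0//= ltr_pdivrMr// mul1r.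
- move=> x; apply: (le_trans (fock_normZ _ _)); rewrite cabsV mulrC.
  by rewrite mulrAC ler_wpM2r ?invr_ge0 ?cabs_ge0// op_normP.
have ev1 : ev chi ((ev chi T)^-1 \*: T) = 1 by rewrite (evZ _ HT) mulVf.
have := evD HS (algebra_comp HS HY); rewrite -YE (evM HS HY) ev1 mul1r => /eqP.
by rewrite -subr_eq subrr eq_sym oner_eq0.
Qed.

End Character.

End Complete.

(** * The commutation relation and evaluation of tensors at points *)

Section Words.
Variables m n : nat.
Local Notation word := (seq 'I_m * seq 'I_n)%type.
Local Notation words := (words m n).
Implicit Types (s t : nat * nat) (v w : word).

Definition wcat v w : word := (v.1 ++ w.1, v.2 ++ w.2).

Lemma deg_wcat v w : deg (wcat v w) = deg v + deg w.
Proof. by rewrite /deg /wcat /= !size_cat. Qed.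

Lemma big_words (V : nmodType) s (F : word -> V) :
  \sum_(w <- words s) F w =
  \sum_(a : s.1.-tuple 'I_m) \sum_(b : s.2.-tuple 'I_n) F (tval a, tval b).
Proof.
rewrite /words big_allpairs_dep big_enum; apply: eq_bigr => a _.
by rewrite big_enum.
Qed.

Lemma big_tuple_cons (T : finType) k (V : nmodType) (F : k.+1.-tuple T -> V) :
  \sum_t F t = \sum_a \sum_(t : k.-tuple T) F [tuple of a :: t].
Proof.
rewrite pair_big /= (reindex (fun p : T * k.-tuple T => [tuple of p.1 :: p.2]))//=.
exists (fun t : k.+1.-tuple T => (thead t, [tuple of behead t])) => [[a t] _|t _].
  by rewrite theadE; congr (_, _); apply: val_inj.
by rewrite /= -tuple_eta.
Qed.

Lemma big_tuple0 (T : finType) (V : nmodType) (F : 0.-tuple T -> V) :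
  \sum_t F t = F [tuple].
Proof.
by rewrite (bigD1 [tuple])//= big1 ?addr0// => t /eqP[]; rewrite tuple0.
Qed.

Lemma big_delta (A : comNzRingType) (T : eqType) (r : seq T) (x : T) (F : T -> A) :
  uniq r -> x \in r -> \sum_(y <- r) (y == x)%:R * F y = F x.
Proof.
move=> ur xr; rewrite (big_rem x)//= eqxx mul1r big1_seq ?addr0// => y /andP[_].
by rewrite mem_rem_uniq// inE => /andP[/negPf -> _]; rewrite mul0r.
Qed.

(** A word of degree [s + t] is cut after its first [s.1] letters [e] and its first
[s.2] letters [f]. This is not a cut of the tensor as it is written, since the letters
[f] of the first piece have to move past the letters [e] of the second one. *)
Lemma wcat_words s t : perm_eq (words (s + t))
  [seq wcat v w | v <- words s, w <- words t].
Proof.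
apply: uniq_perm; first exact: uniq_words.
  apply: allpairs_uniq; rewrite ?uniq_words//.
  move=> p q /allpairsP[[[a b] [c d]] /= [xs _ ->]].
  move=> /allpairsP[[[a' b'] [c' d']] /= [xs' _ ->]] [/eqP ea /eqP eb].
  move: xs xs'; rewrite !mem_words => /eqP <- /eqP[sa sb].
  by move: ea eb; rewrite !eqseq_cat// => /andP[/eqP -> /eqP ->]
    /andP[/eqP -> /eqP ->].
move=> w; rewrite mem_words; apply/eqP/allpairsP => [dw|[[v v'] /= []]]; last first.
  by rewrite !mem_words => /eqP dv /eqP dv' ->; rewrite deg_wcat dv dv'.
exists ((take s.1 w.1, take s.2 w.2), (drop s.1 w.1, drop s.2 w.2)) => /=.
case: w dw => a b [/= sa sb]; rewrite !mem_words /deg /wcat /= !cat_take_drop.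
rewrite !size_drop !size_take sa sb.
rewrite -![(_ + _)%R]/(_ + _)%N !addKn.
case: s {sa sb} => s1 s2; case: t => t1 t2 /=; split=> //; apply/eqP; congr (_, _);
by case: ltnP => //; rewrite -[leqRHS]addn0 leq_add2l leqn0 => /eqP ->; rewrite addn0.
Qed.

Lemma big_wcat (V : nmodType) s t (F : word -> V) :
  \sum_(w <- words (s + t)) F w =
  \sum_(v <- words s) \sum_(w <- words t) F (wcat v w).
Proof. by rewrite (perm_big _ (wcat_words s t)) big_allpairs_dep. Qed.

Lemma wcat_mem s t v w : v \in words s -> w \in words t ->
  wcat v w \in words (s + t).
Proof. by rewrite !mem_words deg_wcat => /eqP -> /eqP ->. Qed.

End Words.

Section Points.
Variables (R : realType) (m n : nat).
Local Notation C := R[i].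
Local Notation word := (seq 'I_m * seq 'I_n)%type.
Local Notation tensor := (word -> C).
Local Notation words := (words m n).
Implicit Types (s t : nat * nat) (v w : word).

Section Evaluation.
Variables (z : 'I_m -> C) (w : 'I_n -> C).

Definition monom (v : word) : C := (\prod_(a <- v.1) z a) * (\prod_(b <- v.2) w b).

Definition eval_tensor s (x : tensor) : C := \sum_(v <- words s) x v * monom v.

Lemma eval_tensorZD s c x y :
  eval_tensor s (c *: x + y) = c * eval_tensor s x + eval_tensor s y.
Proof.
rewrite /eval_tensor mulr_sumr -big_split; apply: eq_bigr => v _.
by rewrite /= !fctE -[c *: _]/(c * _); ring.
Qed.

(** The relations [w_j z_i = \sum_(k, l) u_((k, l), (i, j)) z_k w_l] say that
evaluation at [(z, w)] does not see [u]. *)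
Definition commutes (u : 'I_m * 'I_n -> 'I_n * 'I_m -> C) :=
  forall i j, w j * z i = \sum_(k < m) \sum_(l < n) u (k, l) (j, i) * (z k * w l).

Section Commutes.
Variable u : 'I_m * 'I_n -> 'I_n * 'I_m -> C.
Hypothesis zwu : commutes u.

(** Evaluation at [(z, w)] sends [u^(1,k)] to the identity, by one use of the
relations for each letter passed. *)
Lemma u1k_monom (c : seq 'I_m) j :
  \sum_(a : (size c).-tuple 'I_m) \sum_(l < n)
    u1k u a l j c * ((\prod_(i <- a) z i) * w l) = w j * \prod_(i <- c) z i.
Proof.
elim: c j => [|i c IH] j.
  rewrite big_tuple0 /= big_nil mulr1 (bigD1 j)//= eqxx !mul1r big1 ?addr0//.
  by move=> l /negPf ->; rewrite mul0r.
rewrite big_cons mulrA zwu mulr_suml big_tuple_cons; apply: eq_bigr => k _.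
rewrite mulr_suml.
transitivity (\sum_(h < n) u (k, h) (j, i) * z k *
   \sum_(a : (size c).-tuple 'I_m) \sum_(l < n)
     u1k u a l h c * ((\prod_(i <- a) z i) * w l)).
  transitivity (\sum_(a : (size c).-tuple 'I_m) \sum_(h < n) \sum_(l < n)
     u (k, h) (j, i) * z k * (u1k u a l h c * ((\prod_(i <- a) z i) * w l))).
    apply: eq_bigr => a _; rewrite exchange_big; apply: eq_bigr => l _ /=.
    rewrite big_cons mulr_suml; apply: eq_bigr => h _.
    by ring.
  rewrite exchange_big; apply: eq_bigr => h _.
  by rewrite mulr_sumr; apply: eq_bigr => a _; rewrite mulr_sumr.
by apply: eq_bigr => h _; rewrite IH; ring.
Qed.

Lemma ujk_monom (b : seq 'I_n) (a : seq 'I_m) :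
  \sum_(a' : (size a).-tuple 'I_m) \sum_(b' : (size b).-tuple 'I_n)
    ujk u a' b' b a * monom (tval a', tval b') = monom (a, b).
Proof.
elim: b => [|j b IH].
  rewrite (bigD1 (in_tuple a))//= big_tuple0 /= (eqxx a) mul1r.
  rewrite big1 ?addr0// => a' ne; rewrite big_tuple0 /=.
  by move: ne; rewrite -val_eqE => /negPf /= ->; rewrite mul0r.
transitivity (\sum_(c : (size a).-tuple 'I_m) \sum_(b' : (size b).-tuple 'I_n)
   (\sum_(a' : (size a).-tuple 'I_m) \sum_(l < n)
     u1k u a' l j c * ((\prod_(i <- a') z i) * w l)) *
   (ujk u c b' b a * \prod_(i <- b') w i)); last first.
  transitivity (w j * monom (a, b)); last by rewrite /monom /= big_cons mulrCA.
  rewrite -IH mulr_sumr; apply: eq_bigr => c _.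
  rewrite mulr_sumr; apply: eq_bigr => b' _.
  have := u1k_monom c j; rewrite size_tuple => ->; rewrite /monom /=; ring.
pose F c b' a' l : C := u1k u (a' : (size a).-tuple 'I_m) l j
  (c : (size a).-tuple 'I_m) * ((\prod_(i <- a') z i) * w l) *
  (ujk u c (b' : (size b).-tuple 'I_n) b a * \prod_(i <- b') w i).
transitivity (\sum_c \sum_b' \sum_a' \sum_l F c b' a' l); last first.
  apply: eq_bigr => c _; apply: eq_bigr => b' _; rewrite mulr_suml.
  by apply: eq_bigr => a' _; rewrite mulr_suml.
apply: esym; transitivity (\sum_a' \sum_l \sum_b' \sum_c F c b' a' l).
  under eq_bigr do rewrite exchange_big.
  rewrite exchange_big; apply: eq_bigr => a' _ /=.
  under eq_bigr do rewrite exchange_big.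
  rewrite exchange_big; apply: eq_bigr => l _ /=.
  by rewrite exchange_big.
apply: eq_bigr => a' _; rewrite big_tuple_cons; apply: eq_bigr => l _.
apply: eq_bigr => b' _ /=; rewrite mulr_suml; apply: eq_bigr => c _.
by rewrite /F /monom /= big_cons; ring.
Qed.

Lemma Wcoef_monom s t v v' : v \in words s -> v' \in words t ->
  \sum_(x <- words (s + t)) Wcoef u x v v' * monom x = monom v * monom v'.
Proof.
rewrite big_wcat !mem_words => /eqP <- /eqP <- {s t}.
case: v v' => a b [a' b']; rewrite !big_words /=.
rewrite (bigD1 (in_tuple a))//= [X in _ + X]big1 ?addr0; last first.
  move=> p pa; rewrite big1// => r _; rewrite big_words big1// => q1 _.
  rewrite big1// => q2 _; rewrite /Wcoef /wcat /= take_size_cat ?size_tuple//.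
  by move: pa; rewrite -val_eqE => /negPf /= ->; rewrite !mul0r.
transitivity (\sum_(r : (size b).-tuple 'I_n) \sum_(q : (size a').-tuple 'I_m)
    monom (a, b') * (ujk u q r b a' * monom (tval q, tval r))).
  apply: eq_bigr => r _; rewrite big_words; apply: eq_bigr => q _ /=.
  rewrite (bigD1 (in_tuple b'))//= [X in _ + X]big1 ?addr0; last first.
    move=> q2 qb; rewrite /Wcoef /wcat /= drop_size_cat ?size_tuple//.
    by move: qb; rewrite -val_eqE => /negPf /= ->; rewrite andbF !mul0r.
  rewrite /Wcoef /wcat /= take_size_cat// eqxx drop_size_cat ?size_tuple// eqxx.
  rewrite drop_size_cat// take_size_cat ?size_tuple// mul1r /monom /= !big_cat /=.
  by ring.
rewrite exchange_big /=.
transitivity (monom (a, b') * monom (a', b)); last by rewrite /monom /=; ring.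
rewrite -(ujk_monom b a') mulr_sumr; apply: eq_bigr => q _; by rewrite mulr_sumr.
Qed.

(** Hence evaluation turns the product of tensors through [W^u] into the product of
numbers. *)
Lemma eval_Wop s t (x y : tensor) :
  eval_tensor (s + t) (Wop u s t (tprod x y)) = eval_tensor s x * eval_tensor t y.
Proof.
transitivity (\sum_(v <- words s) \sum_(v' <- words t) x v * y v' *
    \sum_(p <- words (s + t)) Wcoef u p v v' * monom p).
  rewrite /eval_tensor /Wop.
  transitivity (\sum_(p <- words (s + t)) \sum_(v <- words s) \sum_(v' <- words t)
      x v * y v' * (Wcoef u p v v' * monom p)).
    apply: eq_bigr => p _; rewrite mulr_suml; apply: eq_bigr => v _.
    rewrite mulr_suml; apply: eq_bigr => v' _; rewrite /tprod /=; ring.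
  rewrite exchange_big; apply: eq_bigr => v _ /=; rewrite exchange_big.
  by apply: eq_bigr => v' _ /=; rewrite mulr_sumr.
rewrite /eval_tensor mulr_suml; apply: eq_big_seq => v vs; rewrite mulr_sumr.
by apply: eq_big_seq => v' vt; rewrite Wcoef_monom//; ring.
Qed.

End Commutes.
End Evaluation.
End Points.

(** * Standard subproduct systems: from characters to points *)

Section Standard.
Variables (R : realType) (m n : nat) (X : subproduct_system R m n).
Variable u : 'I_m * 'I_n -> 'I_n * 'I_m -> R[i].
Hypothesis hX : standard X u.
Local Notation C := R[i].
Local Notation word := (seq 'I_m * seq 'I_n)%type.
Local Notation tensor := (word -> C).
Local Notation words := (words m n).
Implicit Types (s t : nat * nat) (v w : word) (x y z : tensor).

Lemma std_smul s t x y : X s x -> X t y ->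
  smul X s t (tprod x y) = fproj X (s + t) (Wop u s t (tprod x y)).
Proof.
by have [_ _ + _ _] := hX => H Xx Xy; apply: H; exact: tprod_tensor_set.
Qed.

Lemma le_sqrt_le1 (a : R) : 0 <= a -> a <= Num.sqrt a -> a <= 1.
Proof.
move=> /sqr_sqrtr; have := sqrtr_ge0 a; move: (Num.sqrt a) => r r0 <-.
by have [r1|r1] := leP r 1; nra.
Qed.

(** Two degrees between which the commutation relation has nothing to exchange:
for those, [W^u] concatenates words. *)
Definition unbraided s t := (s.2 == 0%N) || (t.1 == 0%N).

Lemma ujk_nila (a' : seq 'I_m) (b' b : seq 'I_n) :
  ujk u a' b' b [::] = ((a' == [::]) && (b' == b))%:R.
Proof.
elim: b a' b' => [|j b IH] a' [|l b'] //=; rewrite ?andbT ?andbF//.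
rewrite big_tuple0 IH /=; case: a' => [|? ?] /=; rewrite ?mul0r//.
by rewrite eqseq_cons -natrM mulnb.
Qed.

(** Exchanging nothing, [u^(j,k)] is the identity when [j = 0] or [k = 0]. *)
Lemma Wcoef_unbraided s t v v' w : unbraided s t -> deg v = s -> deg v' = t ->
  Wcoef u w v v' = (w == wcat v v')%:R.
Proof.
case: v v' w => [a b] [a' b'] [c d] st dv dv'; rewrite /Wcoef /=.
have -> : ujk u (drop (size a) c) (take (size b) d) b a' =
    ((drop (size a) c == a') && (take (size b) d == b))%:R.
  move: st; rewrite /unbraided -dv -dv' /= => /orP[/nilP ->|/nilP ->].
    by rewrite take0 /= eqxx andbT.
  by rewrite ujk_nila.
rewrite -natrM mulnb; congr (nat_of_bool _)%:R.
rewrite /wcat /= -[RHS]/((c == a ++ a') && (d == b ++ b')).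
have cat_eq (T : eqType) (p q r : seq T) :
    (r == p ++ q) = (take (size p) r == p) && (drop (size p) r == q).
  apply/eqP/andP => [->|[/eqP e1 /eqP e2]]; last by rewrite -{1}e1 -e2 cat_take_drop.
  by rewrite take_size_cat// drop_size_cat.
rewrite !cat_eq; do 4![case: (_ == _)] => //.
Qed.

Definition delta v : tensor := fun w => (w == v)%:R.

Lemma delta_homog v : homog (deg v) (delta v).
Proof. by move=> w; rewrite /delta; have [->|//] := eqVneq w v; rewrite eqxx. Qed.

Lemma ip_delta s v z : v \in words s -> ip (words s) (delta v) z = conjc (z v).
Proof. by move=> vs; rewrite /ip big_delta ?uniq_words. Qed.

Lemma Wop_delta s t v y w : unbraided s t -> deg v = s ->
  Wop u s t (tprod (delta v) y) w = \sum_(v' <- words t) (w == wcat v v')%:R * y v'.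
Proof.
move=> st dv; rewrite /Wop.
transitivity (\sum_(p <- words s) (p == v)%:R *
    \sum_(v' <- words t) (w == wcat p v')%:R * y v').
  apply: eq_big_seq => p; rewrite mem_words => /eqP ps; rewrite mulr_sumr.
  apply: eq_big_seq => v'; rewrite mem_words => /eqP v't.
  by rewrite (Wcoef_unbraided _ st)// mulrCA /tprod /delta /=.
by rewrite big_delta ?uniq_words// mem_words dv.
Qed.

Definition slice v z : tensor := fun v' => z (wcat v v').

Lemma slice_homog s t v z : deg v = s -> homog (s + t) z -> homog t (slice v z).
Proof.
move=> dv hz w wt; apply: hz; rewrite deg_wcat dv.
apply: contraNN wt; case: s {dv} => s1 s2; case: t => t1 t2 /eqP[].
rewrite -!/(_ + _)%N /deg /= => /eqP + /eqP; rewrite !eqn_add2l => /eqP -> /eqP ->.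
exact: eqxx.
Qed.

Lemma ip_Wop_delta s t v y z : unbraided s t -> deg v = s -> X (s + t) z ->
  ip (words (s + t)) (Wop u s t (tprod (delta v) y)) z =
  ip (words t) y (slice v z).
Proof.
move=> st dv Xz; rewrite /ip.
under eq_bigr do rewrite Wop_delta// mulr_suml.
rewrite exchange_big; apply: eq_big_seq => v' v't /=.
under eq_bigr do rewrite -mulrA.
rewrite big_delta ?uniq_words//; apply: wcat_mem => //.
by rewrite mem_words dv.
Qed.

(** The inequality [p_(s + t) <= W (I (x) p_t) W^*] at [z] in [X (s + t)] says that
the squared norms of the slices of [z] add up to at most those of their projections
onto [X t], so that each slice lies in [X t]. *)
Lemma slice_fiber s t v z : unbraided s t -> deg v = s -> X (s + t) z ->
  X t (slice v z).
Proof.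
move=> st dv Xz; have hz := fiber_sub Xz; have [_ _ _ _ /(_ s t z hz)] := hX.
rewrite -/(fproj X t) -/(fproj X (s + t)) proj_fiber_id// !dotpE.
have -> : ip (words (s + t)) z z =
    \sum_(p <- words s) ip (words t) (slice p z) (slice p z).
  by rewrite /ip big_wcat.
have -> : ip (words (s + t)) (Wop u s t (id_proj (fproj X t) (Wadj u s t z))) z =
    \sum_(p <- words s) ip (words t) (fproj X t (slice p z)) (slice p z).
  rewrite {1}/ip; under eq_bigr do rewrite /Wop mulr_suml.
  rewrite exchange_big; apply: eq_big_seq => p; rewrite mem_words => /eqP ps /=.
  under eq_bigr do rewrite mulr_suml.
  rewrite exchange_big; apply: eq_big_seq => p' p't /=.
  have := p't; rewrite mem_words => /eqP dp'.
  under eq_bigr do rewrite (Wcoef_unbraided _ st)// -mulrA.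
  rewrite big_delta ?uniq_words//; last by rewrite wcat_mem// mem_words ps.
  congr (_ * _); rewrite /id_proj /=; congr (fproj X t _ p').
  apply/funext => w; rewrite /Wadj /= ps eqxx /=.
  case: eqP => [dw|/eqP dw]; last by rewrite (slice_homog ps hz).
  under eq_bigr do rewrite (Wcoef_unbraided _ st)// conjc_nat.
  by rewrite big_delta ?uniq_words// mem_words deg_wcat ps dw.
rewrite -subr_le0 -sumrB.
have defect p : deg p = s ->
    ip (words t) (slice p z) (slice p z) -
    ip (words t) (fproj X t (slice p z)) (slice p z) =
    (l2 (words t) (slice p z - fproj X t (slice p z)) ^+ 2)%:C.
  move=> dp; rewrite -ipBl -ipxx [RHS]ipBr.
  have [_ o] := proj_orth X (slice_homog dp hz).
  by rewrite -[X in _ = _ - X]dotpE o ?subr0//; exact: proj_fiber.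
have -> : \sum_(p <- words s) (ip (words t) (slice p z) (slice p z) -
      ip (words t) (fproj X t (slice p z)) (slice p z)) =
    (\sum_(p <- words s) l2 (words t) (slice p z - fproj X t (slice p z)) ^+ 2)%:C.
  rewrite rmorph_sum; apply: eq_big_seq => p; rewrite mem_words => /eqP.
  exact: defect.
rewrite lecR => le0.
have : \sum_(p <- words s) l2 (words t) (slice p z - fproj X t (slice p z)) ^+ 2 == 0.
  by rewrite eq_le le0 sumr_ge0// => p _; exact: sqr_ge0.
rewrite psumr_eq0 => [/allP /(_ v)|p _]; last exact: sqr_ge0.
rewrite mem_words dv eqxx => /(_ isT) /eqP l20.
suff -> : slice v z = fproj X t (slice v z) by exact: proj_fiber.
apply/eqP; rewrite -subr_eq0; apply/eqP/funext => w.
case: (boolP (w \in words t)) => wt.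
  by apply: (@ip_eq0 _ _ (words t)) => //; rewrite ipxx l20.
apply: (homogB (slice_homog dv hz) (@proj_homog _ _ _ X t _)).
by rewrite -mem_words.
Qed.

(** Projecting [delta w] before or after multiplying makes no difference: the two
vectors of [X (s + t)] have the same inner product with every [z] of [X (s + t)],
because the slice of [z] at [v] lies in [X t]. *)
Lemma smul_delta s t v w : X s = homog s -> unbraided s t -> deg v = s -> deg w = t ->
  smul X s t (tprod (delta v) (fproj X t (delta w))) =
  fproj X (s + t) (delta (wcat v w)).
Proof.
move=> Xs st dv dw; rewrite std_smul; last 2 first.
- by rewrite Xs -dv; exact: delta_homog.
- exact: proj_fiber.
apply: eq_proj => [|z Xz]; first exact: proj_fiber.
rewrite ip_Wop_delta// ip_proj; last exact: (slice_fiber st).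
by rewrite ip_proj// !ip_delta// mem_words ?deg_wcat ?dv ?dw.
Qed.

Definition letter_e (i : 'I_m) : word := ([:: i], [::]).
Definition letter_f (j : 'I_n) : word := ([::], [:: j]).

Lemma fiber_e : X (1, 0)%N = homog (1, 0)%N.
Proof. by have [_ []] := hX. Qed.

Lemma fiber_f : X (0, 1)%N = homog (0, 1)%N.
Proof. by have [_ []] := hX. Qed.

Lemma delta_e i : X (1, 0)%N (delta (letter_e i)).
Proof. rewrite fiber_e; exact: (@delta_homog (letter_e i)). Qed.

Lemma delta_f j : X (0, 1)%N (delta (letter_f j)).
Proof. rewrite fiber_f; exact: (@delta_homog (letter_f j)). Qed.

Definition gen_e i := creation X (1, 0)%N (delta (letter_e i)).
Definition gen_f j := creation X (0, 1)%N (delta (letter_f j)).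

Section CharacterPoint.
Variable chi : tensor_algebra X -> C^o.
Hypothesis chiX : characters X chi.

Definition char_e i := ev chi (gen_e i).
Definition char_f j := ev chi (gen_f j).

Definition create_word v := creation X (deg v) (fproj X (deg v) (delta v)).

Lemma create_word_algebra v : tensor_algebra X (create_word v).
Proof. by apply: algebra_creation; exact: proj_fiber. Qed.

(** Words are read from the left, first all letters [e] and then all letters [f], so
that each multiplication by a letter is unbraided. *)
Lemma ev_create_word v : ev chi (create_word v) = monom char_e char_f v.
Proof.
case: v => a b; elim: a => [|i a IHa].
  elim: b => [|j b IHb].
    rewrite /monom !big_nil mulr1 -(ev_id chiX) -creation_unit; congr (ev chi _).
    rewrite /create_word; congr creation; apply: proj_fiber_id.
    exact: fiber_unit.
  have -> : create_word ([::], j :: b) = gen_f j \o create_word ([::], b).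
    rewrite creationM ?(smul_delta fiber_f)//; [exact: delta_f|exact: proj_fiber].
  rewrite evM//; first by rewrite IHb /monom /= big_cons mulrCA.
    by apply: algebra_creation; exact: delta_f.
  exact: create_word_algebra.
have -> : create_word (i :: a, b) = gen_e i \o create_word (a, b).
  rewrite creationM ?(smul_delta fiber_e)//; [exact: delta_e|exact: proj_fiber].
rewrite evM//; first by rewrite IHa /monom /= big_cons mulrA.
  by apply: algebra_creation; exact: delta_e.
exact: create_word_algebra.
Qed.

Lemma component_decomp s x : component s x = \sum_(v <- words s) x v *: delta v.
Proof.
apply/funext => w; rewrite fct_sumE.
transitivity (\sum_(v <- words s) (v == w)%:R * x v); last first.
  apply: eq_bigr => v _; rewrite /delta eq_sym mulrC.
  by rewrite -[(_ *: _) w]/(x v * _).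
rewrite /component -mem_words; case: ifPn => ws; first by rewrite big_delta ?uniq_words.
rewrite big1_seq// => v /andP[_ vs]; have [vw|_] := eqVneq v w; last by rewrite mul0r.
by rewrite -vw vs in ws.
Qed.

Lemma proj_component s x : fproj X s (component s x) = fproj X s x.
Proof.
apply: eq_proj => [|z Xz]; first exact: proj_fiber.
rewrite ip_proj//; apply: eq_big_seq => w; rewrite mem_words /component => ->.
by [].
Qed.

Lemma ev_creation0 s : ev chi (creation X s 0) = 0.
Proof.
have X0 := fiber_0 X s; have := algebra_creation X0 => H0.
have := creation_comb (-1) X0 X0; rewrite scaler0 addr0 => /(congr1 (ev chi)).
by rewrite (evZD chiX _ H0 H0) mulN1r addNr.
Qed.

Lemma ev_creation s x : ev chi (creation X s (fproj X s x)) = eval_tensor char_e char_f s x.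
Proof.
rewrite -proj_component component_decomp proj_sum /eval_tensor.
have : {in words s, forall v, deg v = s} by move=> v; rewrite mem_words => /eqP.
elim: (words s) => [|v r IH] rs; first by rewrite !big_nil ev_creation0.
have Xr : X s (\sum_(v <- r) fproj X s (x v *: delta v)).
  by apply: fiber_sum => w; exact: proj_fiber.
rewrite !big_cons projZ (creation_comb _ (proj_fiber _ _ _) Xr).
rewrite (evZD chiX); last 2 first.
- by apply: algebra_creation; exact: proj_fiber.
- exact: algebra_creation.
rewrite IH => [|w wr]; last by rewrite rs// inE wr orbT.
by rewrite -ev_create_word /create_word rs// mem_head.
Qed.

Lemma ev_creation_fiber s x : X s x ->
  ev chi (creation X s x) = eval_tensor char_e char_f s x.
Proof.
by move=> Xx; rewrite -ev_creation proj_fiber_id.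
Qed.

(** A tensor orthogonal to [X s] projects to [0], whose creation operator is [0]. *)
Lemma char_orth s x : orth s (X s) x -> eval_tensor char_e char_f s x = 0.
Proof.
by move=> xo; rewrite -ev_creation orth_proj0// ev_creation0.
Qed.

Lemma sum_words_e (V : nmodType) (F : word -> V) :
  \sum_(v <- words (1, 0)%N) F v = \sum_(i < m) F (letter_e i).
Proof.
rewrite big_words /= big_tuple_cons; apply: eq_bigr => i _.
by rewrite !big_tuple0.
Qed.

Lemma sum_words_f (V : nmodType) (F : word -> V) :
  \sum_(v <- words (0, 1)%N) F v = \sum_(j < n) F (letter_f j).
Proof.
rewrite big_words /= big_tuple0 big_tuple_cons; apply: eq_bigr => i _.
by rewrite !big_tuple0.
Qed.

Lemma sum_words_ef (V : nmodType) (F : word -> V) :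
  \sum_(v <- words (1, 1)%N) F v = \sum_(i < m) \sum_(j < n) F ([:: i], [:: j]).
Proof.
rewrite big_words /= big_tuple_cons; apply: eq_bigr => i _.
rewrite big_tuple0 big_tuple_cons; apply: eq_bigr => j _.
by rewrite big_tuple0.
Qed.

Lemma Wop_exchange i j k l :
  Wop u (0, 1)%N (1, 0)%N (tprod (delta (letter_f j)) (delta (letter_e i)))
    ([:: k], [:: l]) = u (k, l) (j, i).
Proof.
rewrite /Wop; transitivity (\sum_(v <- words (0, 1)%N) (v == letter_f j)%:R *
   \sum_(v' <- words (1, 0)%N) (v' == letter_e i)%:R *
     Wcoef u ([:: k], [:: l]) v v').
  apply: eq_bigr => v _; rewrite mulr_sumr; apply: eq_bigr => v' _.
  by rewrite /tprod /delta /=; ring.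
rewrite !big_delta ?uniq_words ?mem_words//= /Wcoef /= mul1r big_tuple_cons.
rewrite (bigD1 i)//= big_tuple0 /= (eqxx [:: i]) mulr1 [X in _ + X]big1 ?addr0; last first.
  by move=> i' ii; rewrite big_tuple0 /= eqseq_cons (negPf ii) mulr0.
rewrite (bigD1 l)//= eqxx mulr1 big1 ?addr0// => h /negPf hl.
by rewrite eq_sym hl mulr0.
Qed.

(** Both sides are the value of [chi] at the product of two generators; the product
in the other order is computed by the exchange [u]. *)
Lemma char_commutes : commutes char_e char_f u.
Proof.
move=> i j; have He := algebra_creation (delta_e i).
have Hf := algebra_creation (delta_f j).
rewrite -(evM chiX Hf He) (creationM (delta_f j) (delta_e i)).
rewrite (std_smul (delta_f j) (delta_e i)) ev_creation.
rewrite /eval_tensor sum_words_ef; apply: eq_bigr => k _; apply: eq_bigr => l _.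
by rewrite Wop_exchange /monom /= !big_cons !big_nil !mulr1.
Qed.

(** With [a = \sum_i |z_i|^2] and [x] the conjugate of the point, the creation operator
of [x] has norm at most [sqrt a] while [chi] takes the value [a] on it; as [chi] is
contractive, [a <= sqrt a]. *)
Lemma char_ball_e : \sum_i sqmod (char_e i) <= 1.
Proof.
pose x : tensor := fun w => if w is ([:: i], [::]) then conjc (char_e i) else 0.
have hx : X (1, 0)%N x.
  by rewrite fiber_e => -[[|i [|i' a]] [|j b]].
have := character_contractive chiX (algebra_creation hx).
rewrite ev_creation_fiber// /eval_tensor sum_words_e => le.
have nx : l2 (words (1, 0)%N) x = Num.sqrt (\sum_i sqmod (char_e i)).
  rewrite /l2 sum_words_e; congr Num.sqrt; apply: eq_bigr => i _.
  by rewrite /= sqmod_conj.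
have := le_trans le (op_norm_le (l2_ge0 _ _) (creation_norm hx)).
rewrite nx (eq_bigr (fun i => (sqmod (char_e i))%:C)); last first.
  by move=> i _; rewrite /monom big_cons !big_nil !mulr1 /= mulrC mul_conj.
rewrite -rmorph_sum; set a := \sum_i _; have a0 : 0 <= a.
  by apply: sumr_ge0 => i _; exact: sqmod_ge0.
by rewrite cabs_real//; exact: le_sqrt_le1.
Qed.

Lemma char_ball_f : \sum_j sqmod (char_f j) <= 1.
Proof.
pose x : tensor := fun w => if w is ([::], [:: j]) then conjc (char_f j) else 0.
have hx : X (0, 1)%N x.
  by rewrite fiber_f => -[[|i a] [|j [|j' b]]].
have := character_contractive chiX (algebra_creation hx).
rewrite ev_creation_fiber// /eval_tensor sum_words_f => le.
have nx : l2 (words (0, 1)%N) x = Num.sqrt (\sum_j sqmod (char_f j)).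
  rewrite /l2 sum_words_f; congr Num.sqrt; apply: eq_bigr => i _.
  by rewrite /= sqmod_conj.
have := le_trans le (op_norm_le (l2_ge0 _ _) (creation_norm hx)).
rewrite nx (eq_bigr (fun i => (sqmod (char_f i))%:C)); last first.
  by move=> i _; rewrite /monom big_cons !big_nil mul1r mulr1 /= mulrC mul_conj.
rewrite -rmorph_sum; set a := \sum_i _; have a0 : 0 <= a.
  by apply: sumr_ge0 => i _; exact: sqmod_ge0.
by rewrite cabs_real//; exact: le_sqrt_le1.
Qed.

End CharacterPoint.
End Standard.

(** * From points to characters *)

(** The powers decrease, so each of the last [k] terms is at most the average of the
first [N - k] ones. *)
Lemma geometric_tail (R : realType) (a : R) (k : nat) (e : R) : 0 <= a <= 1 -> 0 < e ->
  exists N0, forall N, (N0 <= N)%N ->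
  \sum_(0 <= i < N | (N <= i + k)%N) a ^+ i <= e * \sum_(0 <= i < N) a ^+ i.
Proof.
move=> /andP[a0 a1] e0; pose K := Num.truncn (k%:R / e).
exists (k + K.+1)%N => N kN; have kN' : (k <= N)%N.
  by apply: leq_trans kN; exact: leq_addr.
set A := \sum_(0 <= i < N) a ^+ i.
have A0 : 0 <= A by apply: sumr_ge0 => i _; exact: exprn_ge0.
have M0 : 0 < ((N - k)%:R : R).
  by rewrite ltr0n subn_gt0 (leq_trans _ kN)// addnS ltnS leq_addr.
have small i : (N - k <= i)%N -> a ^+ i <= A / (N - k)%:R.
  move=> ki; rewrite ler_pdivlMr// /A (@big_cat_nat _ _ _ (N - k))//= ?leq_subr//.
  apply: (@le_trans _ _ (\sum_(0 <= j < N - k) a ^+ j)); last first.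
    by rewrite lerDl; apply: sumr_ge0 => j _; exact: exprn_ge0.
  rewrite -{1}[(N - k)%N]subn0 mulr_natr -sumr_const_nat.
  by apply: ler_sum_nat => j /andP[_ jN]; apply: ler_wiXn2l => //;
    rewrite ?a0// (leq_trans _ ki)// ltnW.
have -> : \sum_(0 <= i < N | (N <= i + k)%N) a ^+ i = \sum_(N - k <= i < N) a ^+ i.
  rewrite (@big_cat_nat _ _ _ (N - k))//= ?leq_subr//.
  rewrite big_nat_cond big1 ?add0r => [|i /andP[/andP[_ iN] Ni]]; last first.
    by move: iN; rewrite ltn_subRL addnC ltnNge Ni.
  by rewrite big_nat_cond [RHS]big_nat_cond; apply: eq_bigl => i;
    rewrite andbT; case: (boolP (N - k <= i < N)%N) => //= /andP[Ni _];
    rewrite addnC -leq_subLR.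
apply: (@le_trans _ _ (\sum_(N - k <= i < N) A / (N - k)%:R)).
  by apply: ler_sum_nat => i /andP[/small].
rewrite sumr_const_nat subKn// -[leLHS]mulr_natl mulrCA [e * A]mulrC.
rewrite ler_wpM2l// ler_pdivrMr// mulrC -ler_pdivrMr//.
apply: ltW; apply: lt_le_trans (truncnS_gt _) _.
by rewrite ler_nat leq_subRL.
Qed.

Section Eigenvectors.
Variables (R : realType) (m n : nat) (X : subproduct_system R m n).
Local Notation C := R[i].
Local Notation word := (seq 'I_m * seq 'I_n)%type.
Local Notation tensor := (word -> C).
Local Notation words := (words m n).
Local Notation box := (box m n).
Local Notation op := (fock X -> fock X).
Implicit Types (s t : nat * nat) (x y : fock X) (A B T : op).

Section Approximate.
Variables (z : 'I_m -> C) (w : 'I_n -> C).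

Definition kills_orth := forall s (x : tensor), orth s (X s) x -> eval_tensor z w s x = 0.

Definition phi N (x : tensor) : C := \sum_(v <- box N) x v * monom z w v.

Definition weight N : R := l2 (box N) (monom z w).

(** [phi N] is the inner product with the truncation to the box of degrees below
[N] of the formal vector with coordinates the conjugates of [monom z w]. The
condition says that these truncations are approximate eigenvectors of the adjoint
of [T], with eigenvalue the conjugate of [c]. Truncating makes sense of this even
on the boundary of the polyball, where the vector is not square summable. *)
Definition approx_eigen T (c : C) := forall e : R, 0 < e ->
  exists N0, forall N, (N0 <= N)%N -> forall x,
    cabs (phi N (T x) - c * phi N x) <= e * (fock_norm x * weight N).

Lemma phiZD N c x y : phi N (c *: x + y : fock X) = c * phi N x + phi N y.
Proof.
rewrite /phi mulr_sumr -big_split; apply: eq_bigr => v _.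
by rewrite fockZDE /=; ring.
Qed.

Lemma weight_ge0 N : 0 <= weight N. Proof. exact: l2_ge0. Qed.

Lemma weight_gt0 N : 0 < weight N.+1.
Proof.
apply: (@lt_le_trans _ _ 1) => //.
rewrite -(@ler_pXn2r _ 2) ?nnegrE ?weight_ge0// sqr_l2 expr1n.
rewrite (big_rem ([::], [::])) ?mem_box ?mem_degs//=.
rewrite /monom !big_nil mulr1 -{1}(expr1n _ 2) -(cabs1 R) sqr_cabs lerDl.
by apply: sumr_ge0 => v _; exact: sqmod_ge0.
Qed.

Lemma phi_le N x : cabs (phi N x) <= fock_norm x * weight N.
Proof.
apply: (le_trans (cauchy_schwarz _ _ _)).
by rewrite ler_wpM2r ?weight_ge0 ?box_le_norm.
Qed.

Section Kills.
Hypothesis zwX : kills_orth.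

Definition eigenvector N : fock X :=
  to_fock X (fun v => if v \in box N then conjc (monom z w v) else 0).

(** The truncated vector lies in the Fock space: in each degree it is orthogonal to
[orth s (X s)] because evaluation at the point vanishes there. *)
Lemma eigenvectorE N v :
  eigenvector N v = if v \in box N then conjc (monom z w v) else 0.
Proof.
rewrite /eigenvector to_fockK//.
apply: (@fock_intro _ _ _ _ _ (weight N ^+ 2)) => [s|M].
  apply: fiber_bidual => [|y yo]; first exact: component_homog.
  case: (boolP (s \in degs N)) => sN; last first.
    rewrite /ip big1_seq// => v' /andP[_]; rewrite mem_words /component => /eqP dv.
    by rewrite dv eqxx mem_box dv (negPf sN) mul0r.
  transitivity (conjc (eval_tensor z w s y)); last by rewrite zwX ?conjc0.
  rewrite /ip /eval_tensor rmorph_sum.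
  apply: eq_big_seq => v'; rewrite mem_words /component => /eqP dv.
  rewrite mem_box dv eqxx sN -[RHS]/(conjc (y v' * monom z w v')) [RHS]rmorphM.
  exact: mulrC.
rewrite /weight sqr_l2 (bigID (mem (box N)))/= [X in _ + X]big1 ?addr0; last first.
  by move=> v' /negPf ->; rewrite /sqmod expr0n addr0.
rewrite -big_filter.
apply: (@le_trans _ _ (\sum_(v' <- [seq v' <- box M | v' \in box N])
    sqmod (monom z w v'))).
  rewrite !big_filter; apply: ler_sum => v' ->.
  by rewrite sqmod_conj.
apply: ler_sum_sub; rewrite ?filter_uniq ?uniq_box//.
  by move=> v'; rewrite mem_filter => /andP[].
by move=> v'; exact: sqmod_ge0.
Qed.

Lemma phi_eigenvector N : phi N (eigenvector N) = (weight N ^+ 2)%:C.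
Proof.
rewrite /phi sqr_l2 rmorph_sum; apply: eq_big_seq => v vN.
by rewrite eigenvectorE vN mulrC mul_conj.
Qed.

Lemma eigenvector_norm N : fock_norm (eigenvector N) <= weight N.
Proof.
apply: norm_le_box => [|M]; first exact: weight_ge0.
rewrite -(@ler_pXn2r _ 2) ?nnegrE ?weight_ge0 ?l2_ge0// !sqr_l2.
rewrite (bigID (mem (box N)))/= [X in _ + X]big1 ?addr0; last first.
  by move=> v' vN; rewrite eigenvectorE (negPf vN) /sqmod expr0n addr0.
rewrite -big_filter.
apply: (@le_trans _ _ (\sum_(v' <- [seq v' <- box M | v' \in box N])
    sqmod (monom z w v'))).
  rewrite !big_filter; apply: ler_sum => v' vN.
  by rewrite eigenvectorE vN sqmod_conj.
apply: ler_sum_sub; rewrite ?filter_uniq ?uniq_box//.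
  by move=> v'; rewrite mem_filter => /andP[].
by move=> v'; exact: sqmod_ge0.
Qed.

(** Test the condition on the approximate eigenvector itself. *)
Lemma approx_eigen_le T c K : 0 <= K -> op_le_norm T K -> approx_eigen T c ->
  cabs c <= K.
Proof.
move=> K0 TK Tc; apply/ler_addgt0Pl => e e0; have [N0 /(_ N0.+1 (leqnSn _))] := Tc e e0.
move=> /(_ (eigenvector N0.+1)); rewrite phi_eigenvector.
have := eigenvector_norm N0.+1; have := weight_gt0 N0.
set r := weight _; set nu := eigenvector _ => r0 nur le.
have r2 : 0 < r ^+ 2 by rewrite exprn_gt0.
rewrite -(ler_pM2r r2) -{1}(cabs_real (ltW r2)) -cabsM.
apply: (@le_trans _ _ (cabs (c * (r ^+ 2)%:C - phi N0.+1 (T nu)) +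
  cabs (phi N0.+1 (T nu)))).
  by rewrite -{1}[c * _](subrK (phi N0.+1 (T nu))) cabsD.
rewrite mulrDl lerD//.
  by rewrite cabsB (le_trans le)// ler_wpM2l ?(ltW e0)// ler_wpM2r ?(ltW r0).
apply: (le_trans (phi_le _ _)); rewrite expr2 mulrA ler_wpM2r ?(ltW r0)//.
by apply: (le_trans (TK _)); rewrite ler_wpM2l.
Qed.

Lemma approx_eigen_comb k A B a b : approx_eigen A a -> approx_eigen B b ->
  approx_eigen (k \*: A \+ B) (k * a + b).
Proof.
move=> Aa Bb e e0; have k1 : 0 < cabs k + 1 by rewrite ltr_wpDl ?cabs_ge0.
have [N1 H1] := Aa (e / (cabs k + 1) / 2) (divr_gt0 (divr_gt0 e0 k1) (ltr0Sn _ 1)).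
have [N2 H2] := Bb (e / 2) (divr_gt0 e0 (ltr0Sn _ 1)).
exists (maxn N1 N2) => N; rewrite geq_max => /andP[/H1 {}H1 /H2 {}H2] x.
rewrite /= phiZD.
have -> : k * phi N (A x) + phi N (B x) - (k * a + b) * phi N x =
  k * (phi N (A x) - a * phi N x) + (phi N (B x) - b * phi N x) by ring.
apply: (le_trans (cabsD _ _)); rewrite (splitr e) mulrDl lerD// cabsM.
have r0 : 0 <= fock_norm x * weight N by rewrite mulr_ge0 ?fock_norm_ge0 ?weight_ge0.
apply: (@le_trans _ _ ((cabs k + 1) * (e / (cabs k + 1) / 2 * (fock_norm x * weight N)))).
  apply: ler_pM; rewrite ?cabs_ge0 ?lerDl//.
rewrite mulrA ler_wpM2r// !mulrA [_ * e]mulrC -[e * _ / _]mulrA mulfV ?gt_eqF//.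
by rewrite mulr1.
Qed.

Lemma approx_eigen_comp A B a b : bounded_op X B ->
  approx_eigen A a -> approx_eigen B b -> approx_eigen (A \o B) (a * b).
Proof.
move=> /bounded_opP[_ [K K0 BK]] Aa Bb e e0.
have a1 : 0 < cabs a + 1 by rewrite ltr_wpDl ?cabs_ge0.
have K1 : 0 < K + 1 by rewrite ltr_wpDl.
have [N1 H1] := Aa (e / 2 / (K + 1)) (divr_gt0 (divr_gt0 e0 (ltr0Sn _ 1)) K1).
have [N2 H2] := Bb (e / 2 / (cabs a + 1)) (divr_gt0 (divr_gt0 e0 (ltr0Sn _ 1)) a1).
exists (maxn N1 N2) => N; rewrite geq_max => /andP[/H1 {}H1 /H2 {}H2] x.
have -> : phi N ((A \o B) x) - a * b * phi N x =
  (phi N (A (B x)) - a * phi N (B x)) + a * (phi N (B x) - b * phi N x).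
  by rewrite /=; ring.
have r0 : 0 <= fock_norm x * weight N by rewrite mulr_ge0 ?fock_norm_ge0 ?weight_ge0.
apply: (le_trans (cabsD _ _)); rewrite (splitr e) mulrDl lerD//.
  apply: (le_trans (H1 _)).
  apply: (@le_trans _ _ (e / 2 / (K + 1) * ((K + 1) * (fock_norm x * weight N)))).
    rewrite ler_wpM2l ?divr_ge0 ?(ltW e0) ?(ltW K1)// mulrA ler_wpM2r ?weight_ge0//.
    by rewrite (le_trans (BK _))// ler_wpM2r ?fock_norm_ge0// lerDl.
  by rewrite [leLHS]mulrA divfK ?gt_eqF.
rewrite cabsM.
apply: (@le_trans _ _ ((cabs a + 1) * (e / 2 / (cabs a + 1) * (fock_norm x * weight N)))).
  by apply: ler_pM; rewrite ?cabs_ge0 ?lerDl.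
by rewrite [leLHS]mulrA [_ * (_ / _ / _)]mulrC divfK ?gt_eqF.
Qed.

Lemma approx_eigen_sub A B a b : approx_eigen A a -> approx_eigen B b ->
  approx_eigen (A \- B) (a - b).
Proof.
move=> Aa Bb; have -> : a - b = -1 * b + a by ring.
rewrite sub_comb; exact: approx_eigen_comb.
Qed.

Lemma approx_eigen_uniq T a b : approx_eigen T a -> approx_eigen T b -> a = b.
Proof.
move=> Ta Tb; apply/eqP; rewrite -subr_eq0; apply/eqP/cabs_eq0P => e e0.
apply: (@approx_eigen_le (T \- T)); rewrite ?(ltW e0)//; last exact: approx_eigen_sub.
by move=> x /=; rewrite subrr fock_norm0 mulr_ge0 ?fock_norm_ge0 ?(ltW e0).
Qed.

Lemma approx_eigen_limit T c : bounded_op X T ->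
  (forall e : R, 0 < e -> exists A a, [/\ bounded_op X A, op_norm (T \- A) <= e,
     approx_eigen A a & cabs (a - c) <= e]) ->
  approx_eigen T c.
Proof.
move=> bT H e e0; have [A [a [bA TA Aa ac]]] := H (e / 3) (divr_gt0 e0 (ltr0Sn _ 2)).
have [N0 H0] := Aa (e / 3) (divr_gt0 e0 (ltr0Sn _ 2)).
exists N0 => N /H0 {}H0 x.
have -> : phi N (T x) - c * phi N x = phi N ((T \- A) x) +
   ((phi N (A x) - a * phi N x) + (a - c) * phi N x).
  rewrite sub_comb /= phiZD; ring.
have r0 : 0 <= fock_norm x * weight N by rewrite mulr_ge0 ?fock_norm_ge0 ?weight_ge0.
apply: (le_trans (cabsD _ _)); have -> : e = e / 3 + (e / 3 + e / 3) by field.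
rewrite [leRHS]mulrDl lerD//.
  apply: (le_trans (phi_le _ _)); rewrite mulrA ler_wpM2r ?weight_ge0//.
  apply: (le_trans (op_normP (bounded_sub bT bA) _)).
  by rewrite ler_wpM2r ?fock_norm_ge0.
apply: (le_trans (cabsD _ _)); rewrite [leRHS]mulrDl lerD// cabsM.
by apply: ler_pM; rewrite ?cabs_ge0 ?phi_le.
Qed.

End Kills.
End Approximate.
End Eigenvectors.

Arguments kills_orth {R m n} X z w.

Section CreationEigen.
Variables (R : realType) (m n : nat) (X : subproduct_system R m n).
Variable u : 'I_m * 'I_n -> 'I_n * 'I_m -> R[i].
Hypothesis hX : standard X u.
Local Notation C := R[i].
Local Notation word := (seq 'I_m * seq 'I_n)%type.
Local Notation tensor := (word -> C).
Local Notation words := (words m n).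
Local Notation box := (box m n).
Implicit Types (s t : nat * nat) (x y : fock X).
Variables (z : 'I_m -> C) (w : 'I_n -> C).
Hypothesis zwX : kills_orth X z w.
Hypothesis zwu : commutes z w u.
Hypothesis z1 : \sum_i sqmod (z i) <= 1.
Hypothesis w1 : \sum_j sqmod (w j) <= 1.
Local Notation ev_at := (eval_tensor z w).

Lemma eval_component s (x : tensor) : ev_at s (component s x) = ev_at s x.
Proof. by apply: eq_big_seq => v; rewrite mem_words /component => ->. Qed.

Lemma eval_proj s (x : tensor) : ev_at s (fproj X s x) = ev_at s x.
Proof.
rewrite -proj_component -[RHS]eval_component; apply/esym/eqP.
rewrite -subr_eq0 -[X in _ - X]mul1r -mulNr addrC -eval_tensorZD scaleN1r addrC.
by apply/eqP; apply: zwX; apply: proj_orth; exact: component_homog.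
Qed.

(** Evaluation does not see the projection in [U = p W^u], as it vanishes on the
orthogonal complement of the fiber. *)
Lemma eval_smul s t (x y : tensor) : X s x -> X t y ->
  ev_at (s + t) (smul X s t (tprod x y)) = ev_at s x * ev_at t y.
Proof.
by move=> Xx Xy; rewrite (std_smul hX)// eval_proj (eval_Wop zwu).
Qed.

Lemma eval_creation s eta x t : X s eta ->
  ev_at t (creation X s eta x) =
  if deg_le s t then ev_at s eta * ev_at (deg_sub t s) x else 0.
Proof.
move=> Xe; rewrite creationE// -eval_component component_create//.
case: ifP => [st|_]; last by rewrite /eval_tensor big1// => v _; rewrite mul0r.
rewrite -[in LHS](deg_subK st) deg_addK eval_smul// ?eval_component//.
exact: fock_component.
Qed.

Lemma phi_degs N (x : tensor) : phi z w N x = \sum_(t <- degs N) ev_at t x.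
Proof. by rewrite /phi big_box. Qed.

Lemma sum_shift N s (V : nmodType) (G : nat * nat -> V) :
  \sum_(t <- degs N | deg_le s t) G (deg_sub t s) =
  \sum_(t <- degs N | s + t \in degs N) G t.
Proof.
rewrite -big_filter -[RHS]big_filter -(big_map (deg_sub^~ s) xpredT G).
apply: perm_big; apply: uniq_perm; rewrite ?filter_uniq ?uniq_degs//.
  rewrite map_inj_in_uniq ?filter_uniq ?uniq_degs// => a b.
  rewrite !mem_filter => /andP[sa _] /andP[sb _] ab.
  by rewrite -(deg_subK sa) -(deg_subK sb) ab.
move=> t; rewrite mem_filter; apply/mapP/andP => [[v]|[st tN]].
  rewrite mem_filter => /andP[sv vN] ->; rewrite deg_subK//; split=> //.
  move: vN; rewrite !mem_degs => /andP[a b].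
  by rewrite !(leq_ltn_trans (leq_subr _ _)).
exists (s + t); last by rewrite deg_addK.
by rewrite mem_filter st deg_leD.
Qed.

Definition outside N s := [seq v <- box N | s + deg v \notin degs N].

Lemma phi_creation N s eta x : X s eta ->
  phi z w N (creation X s eta x) - ev_at s eta * phi z w N x =
  - (ev_at s eta * \sum_(v <- outside N s) x v * monom z w v).
Proof.
move=> Xe; rewrite !phi_degs.
under eq_bigr do rewrite eval_creation//.
rewrite -big_mkcond -mulr_sumr (sum_shift N s (fun t => ev_at t x)).
rewrite [in X in _ - X](bigID (fun t => s + t \in degs N))/=.
rewrite mulrDr opprD addNKr; congr (- (_ * _)).
rewrite [RHS]big_filter [RHS]big_mkcond [RHS]big_box [LHS]big_mkcond; apply: eq_bigr => t _.
rewrite /eval_tensor; case: ifP => tN.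
  by apply: eq_big_seq => v; rewrite mem_words => /eqP ->; rewrite tN.
by apply/esym; rewrite big1_seq// => v /andP[_]; rewrite mem_words => /eqP ->; rewrite tN.
Qed.

Lemma sum_tuple_prod (I : finType) (F : I -> R) k :
  \sum_(a : k.-tuple I) \prod_(i <- a) F i = (\sum_i F i) ^+ k.
Proof.
elim: k => [|k IH]; first by rewrite big_tuple0 big_nil.
rewrite big_tuple_cons exprS mulr_suml; apply: eq_bigr => i _.
by rewrite -IH mulr_sumr; apply: eq_bigr => a _; rewrite big_cons.
Qed.

Lemma sqmod_prod I (r : seq I) (F : I -> C) :
  sqmod (\prod_(i <- r) F i) = \prod_(i <- r) sqmod (F i).
Proof.
elim: r => [|i r IH]; last by rewrite !big_cons sqmodM IH.
by rewrite !big_nil -sqr_cabs cabs1 expr1n.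
Qed.

Lemma sum_sqmod_monom s : \sum_(v <- words s) sqmod (monom z w v) =
  (\sum_i sqmod (z i)) ^+ s.1 * (\sum_j sqmod (w j)) ^+ s.2.
Proof.
rewrite big_words -!sum_tuple_prod mulr_suml; apply: eq_bigr => a _.
by rewrite mulr_sumr; apply: eq_bigr => b _; rewrite sqmodM !sqmod_prod.
Qed.

Lemma outside_small s (e : R) : 0 < e -> exists N0, forall N, (N0 <= N)%N ->
  l2 (outside N s) (monom z w) ^+ 2 <= e * weight z w N ^+ 2.
Proof.
move=> e0; have := w1; have := z1.
set a := \sum_i sqmod (z i); set b := \sum_i sqmod (w i) => a1 b1.
have ab : (0 <= a <= 1) && (0 <= b <= 1).
  by rewrite a1 b1 !sumr_ge0// => i _; exact: sqmod_ge0.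
case/andP: ab => a01 b01; have /andP[a0 _] := a01; have /andP[b0 _] := b01.
have e2 : 0 < e / 2 by rewrite divr_gt0.
have [N1 H1] := geometric_tail s.1 a01 e2; have [N2 H2] := geometric_tail s.2 b01 e2.
exists (maxn N1 N2) => N; rewrite geq_max => /andP[/H1 {}H1 /H2 {}H2].
set A := \sum_(0 <= i < N) a ^+ i in H1; set B := \sum_(0 <= i < N) b ^+ i in H2.
have A0 : 0 <= A by apply: sumr_ge0 => i _; exact: exprn_ge0.
have B0 : 0 <= B by apply: sumr_ge0 => i _; exact: exprn_ge0.
have -> : weight z w N ^+ 2 = A * B.
  rewrite sqr_l2 big_box big_degs mulr_suml; apply: eq_bigr => i _.
  by rewrite mulr_sumr; apply: eq_bigr => j _; rewrite sum_sqmod_monom.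
have -> : l2 (outside N s) (monom z w) ^+ 2 =
    \sum_(0 <= i < N) \sum_(0 <= j < N | (N <= i + s.1)%N || (N <= j + s.2)%N)
      a ^+ i * b ^+ j.
  rewrite sqr_l2 big_filter big_mkcond big_box big_degs.
  apply: eq_big_nat => i iN; rewrite [RHS]big_mkcond; apply: eq_big_nat => j jN.
  transitivity (if s + (i, j) \notin degs N
     then \sum_(v <- words (i, j)) sqmod (monom z w v) else 0).
    case: ifP => sN.
      by apply: eq_big_seq => v; rewrite mem_words => /eqP ->; rewrite sN.
    by rewrite big1_seq// => v /andP[_]; rewrite mem_words => /eqP ->; rewrite sN.
  rewrite sum_sqmod_monom degsD negb_and -!leqNgt.
  by rewrite ![(s.1 + _)%N]addnC ![(s.2 + _)%N]addnC.
apply: (@le_trans _ _ (\sum_(0 <= i < N)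
  ((\sum_(0 <= j < N | (N <= i + s.1)%N) a ^+ i * b ^+ j)
   + \sum_(0 <= j < N | (N <= j + s.2)%N) a ^+ i * b ^+ j))).
  apply: ler_sum => i _; rewrite ![X in _ <= X + _]big_mkcond ![X in _ <= _ + X]big_mkcond.
  rewrite -big_split big_mkcond; apply: ler_sum => j _.
  have ab0 : 0 <= a ^+ i * b ^+ j by rewrite mulr_ge0 ?exprn_ge0.
  by case: (N <= i + _)%N; case: (N <= j + _)%N; rewrite /= ?addr0 ?add0r// lerDl.
rewrite big_split (splitr e) [leRHS]mulrDl; apply: lerD.
  apply: (@le_trans _ _ ((\sum_(0 <= i < N | (N <= i + s.1)%N) a ^+ i) * B)); last first.
    by rewrite mulrA ler_wpM2r.
  rewrite mulr_suml [leRHS]big_mkcond; apply: ler_sum => i _.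
  case: ifP => _; last by rewrite big_pred0.
  by rewrite mulr_sumr.
apply: (@le_trans _ _ (A * (\sum_(0 <= j < N | (N <= j + s.2)%N) b ^+ j))); last first.
  by rewrite mulrCA ler_wpM2l.
by rewrite mulr_suml; apply: ler_sum => i _; rewrite mulr_sumr.
Qed.

(** The error comes from the degrees that [creation X s eta] moves out of the box;
as [\sum_i |z_i|^2] and [\sum_j |w_j|^2] are at most [1], the weights of the
degrees decrease, and these boundary degrees have negligible weight. *)
Lemma approx_creation s eta : X s eta ->
  approx_eigen z w (creation X s eta) (ev_at s eta).
Proof.
move=> Xe e e0; set c := ev_at s eta.
have c1 : 0 < cabs c + 1 by rewrite ltr_wpDl ?cabs_ge0.
have [d d0 dE] : exists2 d, 0 < d & d * (cabs c + 1) = e.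
  by exists (e / (cabs c + 1)); rewrite ?divr_gt0// divfK ?gt_eqF.
have [N0 H0] := outside_small s (exprn_gt0 2 d0); exists N0 => N /H0 {}H0 x.
rewrite phi_creation// cabsN cabsM.
have small : l2 (outside N s) (monom z w) <= d * weight z w N.
  rewrite -(@ler_pXn2r _ 2) ?nnegrE ?l2_ge0 ?mulr_ge0 ?weight_ge0 ?(ltW d0)//.
  by rewrite exprMn.
have sub : l2 (outside N s) x <= fock_norm x.
  apply: le_trans (box_le_norm x N).
  rewrite -(@ler_pXn2r _ 2) ?nnegrE ?l2_ge0// !sqr_l2.
  apply: ler_sum_sub; rewrite ?filter_uniq ?uniq_box//.
    by move=> v; rewrite mem_filter => /andP[].
  by move=> v; exact: sqmod_ge0.
apply: (@le_trans _ _ ((cabs c + 1) * (fock_norm x * (d * weight z w N)))).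
  apply: ler_pM; rewrite ?cabs_ge0 ?lerDl//.
  by apply: (le_trans (cauchy_schwarz _ _ _)); apply: ler_pM; rewrite ?l2_ge0.
by rewrite [fock_norm x * _]mulrCA [leLHS]mulrA [_ * d]mulrC dE.
Qed.

End CreationEigen.

(** ** Continuous families of points *)

Section Family.
Variables (R : realType) (m n : nat) (X : subproduct_system R m n).
Variable u : 'I_m * 'I_n -> 'I_n * 'I_m -> R[i].
Hypothesis hX : standard X u.
Local Notation C := R[i].
Local Notation op := (fock X -> fock X).

(** The topology of [C^o] is given by balls with radii in [C]; this passes to real
radii. *)
Lemma cvg_cabs (T : topologicalType) (f : T -> C^o) (p : T) :
  (forall e : R, 0 < e -> \forall q \near p, cabs (f p - f q) < e) ->
  {for p, continuous f}.
Proof.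
move=> H; apply/cvgrPdist_lt => e; rewrite ltcE /= => /andP[/eqP e0 e1].
have -> : e = (complex.Re e)%:C by case: e e0 {e1} => a b /= ->.
by apply: filterS (H _ e1) => q; rewrite norm_cabs ltcR.
Qed.

Lemma cabs_cvg (T : topologicalType) (f : T -> C^o) (p : T) (e : R) :
  {for p, continuous f} -> 0 < e -> \forall q \near p, cabs (f p - f q) < e.
Proof.
move=> /cvgrPdist_lt fp e0; have /fp : 0 < e%:C by rewrite ltcR.
by apply: filterS => q; rewrite norm_cabs ltcR.
Qed.

Variables (T : topologicalType) (z : T -> 'I_m -> C) (w : T -> 'I_n -> C).
Hypothesis zwX : forall p, kills_orth X (z p) (w p).
Hypothesis zwu : forall p, commutes (z p) (w p) u.
Hypothesis z1 : forall p, \sum_i sqmod (z p i) <= 1.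
Hypothesis w1 : forall p, \sum_j sqmod (w p j) <= 1.
Hypothesis zc : forall i, continuous (fun p => z p i : C^o).
Hypothesis wc : forall j, continuous (fun p => w p j : C^o).

(** Asking for all points at once, with a continuous dependence, gives the continuity
of the map from points to characters together with its existence. *)
Definition symbol (A : op) (c : T -> C^o) :=
  continuous c /\ forall p, approx_eigen (z p) (w p) A (c p).

Lemma continuous_prod_seq (I : Type) (r : seq I) (F : I -> T -> C^o) :
  (forall i, continuous (F i)) ->
  continuous (fun p => \prod_(i <- r) (F i p : C) : C^o).
Proof.
move=> Fc; apply: (@continuous_big C^o I *%R 1 xpredT) => [|i _]; last exact: Fc.
exact: (@mul_continuous C).
Qed.

Lemma continuous_sum_seq (I : Type) (r : seq I) (F : I -> T -> C^o) :
  (forall i, continuous (F i)) ->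
  continuous (fun p => \sum_(i <- r) (F i p : C) : C^o).
Proof.
move=> Fc; apply: (@continuous_big C^o I +%R 0 xpredT) => [|i _]; last exact: Fc.
exact: add_continuous.
Qed.

Lemma symbol_creation s eta : X s eta ->
  symbol (creation X s eta) (fun p => eval_tensor (z p) (w p) s eta).
Proof.
move=> Xe; split=> [|p]; last exact: (approx_creation hX (@zwX p) (@zwu p)).
apply: continuous_sum_seq => v p; apply: cvgM; first exact: cvg_cst.
by apply: cvgM; apply: continuous_prod_seq.
Qed.

(** A uniform limit argument: the symbols of operators converging in norm converge
uniformly, because a symbol is bounded by the norm of its operator. *)
Lemma symbol_exists (A : op) : tensor_algebra X A -> exists c, symbol A c.
Proof.
move=> HA; have [//] : (bounded_op X `&` [set A | exists c, symbol A c]) A.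
apply: HA; split; last first.
  move=> B cB; split; first by case: cB.
  have [s [eta [Xe ->]]] := creation_opE cB.
  by exists (fun p => eval_tensor (z p) (w p) s eta); exact: symbol_creation.
split=> [B []//||k B D [bB [b [bc Bb]]] [bD [d [dc Dd]]]|
    B D [bB [b [bc Bb]]] [bD [d [dc Dd]]]|B bB HB].
- split; first exact: bounded0.
  exists (fun=> 0); split=> [p|p e e0]; first exact: cvg_cst.
  exists 0%N => N _ x; rewrite mul0r subr0 /phi big1 ?cabs0 => [|v _]; last exact: mul0r.
  by rewrite mulr_ge0 ?(ltW e0)// mulr_ge0 ?fock_norm_ge0 ?weight_ge0.
- split; first exact: bounded_comb.
  exists (fun p => k * (b p : C) + d p); split=> p; last exact: approx_eigen_comb.
  by apply: cvgD; [apply: cvgM; [exact: cvg_cst|exact: bc]|exact: dc].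
- split; first exact: bounded_comp.
  exists (fun p => (b p : C) * d p); split=> p; last exact: approx_eigen_comp.
  by apply: cvgM; [exact: bc|exact: dc].
split=> //.
pose d k : R := 2 / k.+1%:R.
have d_gt0 k : 0 < d k by rewrite divr_gt0.
have d_mono k l : (k <= l)%N -> d l <= d k.
  by move=> kl; rewrite ler_pM2l// lef_pV2 ?posrE// ler_nat.
have d_small (e : R) : 0 < e -> exists k, d k < e.
  move=> e0; exists (Num.truncn (2 / e)); rewrite /d ltr_pdivrMr// mulrC.
  by rewrite -ltr_pdivrMr// truncnS_gt.
have /choice[D DP] : forall k, exists D : op * (T -> C^o),
    [/\ bounded_op X D.1, op_norm (B \- D.1) < d k / 2 & symbol D.1 D.2].
  move=> k; have [|D [bD [c Dc]] BD] := HB (d k / 2); first by rewrite divr_gt0.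
  by exists (D, c).
have cauchy p k l : (k <= l)%N -> cabs ((D l).2 p - (D k).2 p) <= d k.
  move=> kl; have [bk nk [_ sk]] := DP k; have [bl nl [_ sl]] := DP l.
  apply: (@approx_eigen_le _ _ _ X (z p) (w p) (@zwX p) ((D l).1 \- (D k).1)).
  - exact: ltW.
  - move=> x; apply: (le_trans (op_norm_dist bl bk bB _)).
    rewrite ler_wpM2r ?fock_norm_ge0// (splitr (d k)) lerD ?(ltW nk)//.
    by rewrite (le_trans (ltW nl))// ler_wpM2r ?invr_ge0// d_mono.
  - exact: approx_eigen_sub.
have /choice[c cP] : forall p, exists c : C, forall k, cabs ((D k).2 p - c) <= d k.
  by move=> p; apply: complex_cauchy_rate => // k l; exact: cauchy.
exists c; split=> p.
  apply: cvg_cabs => e e0; have [k dk] := d_small (e / 3) (divr_gt0 e0 (ltr0Sn _ 2)).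
  have [_ _ [ck _]] := DP k.
  have := cabs_cvg (ck p) (divr_gt0 e0 (ltr0Sn _ 2)); apply: filterS => q pq.
  have -> : e = e / 3 + (e / 3 + e / 3) by field.
  apply: (le_lt_trans (cabs_dist _ ((D k).2 p) _)); apply: ltr_leD.
    by rewrite cabsB (le_lt_trans (cP _ _)).
  apply: (le_trans (cabs_dist _ ((D k).2 q) _)); apply: lerD; first exact: ltW.
  exact: le_trans (cP _ _) (ltW dk).
apply: approx_eigen_limit => // e e0; have [k dk] := d_small e e0.
have [bk nk [_ sk]] := DP k; exists (D k).1, ((D k).2 p); split=> //.
  rewrite (le_trans (ltW nk))// (le_trans _ (ltW dk))// ler_pdivrMr//.
  by rewrite ler_peMr ?(ltW (d_gt0 k))// ler1n.
exact: le_trans (cP _ _) (ltW dk).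
Qed.

End Family.

(** * The ideal of the variety *)

Section Bihomogeneous.
Variables (R : realType) (m n : nat).
Local Notation C := R[i].
Local Notation poly_zw := (mpoly (m + n) C).
Implicit Types p q : poly_zw.

Lemma bihomogeneousD a b p q : bihomogeneous a b p -> bihomogeneous a b q ->
  bihomogeneous a b (p + q).
Proof.
by move=> hp hq mu /msuppD_le; rewrite mem_cat => /orP[/hp|/hq].
Qed.

Lemma bihomogeneousZ a b c p : bihomogeneous a b p -> bihomogeneous a b (c *: p).
Proof. by move=> hp mu /msuppZ_le/hp. Qed.

Lemma bihomogeneous0 a b : @bihomogeneous R m n a b 0.
Proof. by move=> mu; rewrite msupp0. Qed.

Lemma bihomogeneous1 : @bihomogeneous R m n 0 0 1.
Proof.
move=> mu; rewrite msupp1 inE => /eqP ->.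
by split; rewrite big1// => i _; rewrite mnm0E.
Qed.

Lemma bihomogeneous_sum a b I (r : seq I) (F : I -> poly_zw) :
  (forall i, bihomogeneous a b (F i)) -> bihomogeneous a b (\sum_(i <- r) F i).
Proof.
move=> hF; elim: r => [|i r IH]; first by rewrite big_nil; exact: bihomogeneous0.
by rewrite big_cons; apply: bihomogeneousD.
Qed.

Lemma bihomogeneousM a b c d p q : bihomogeneous a b p -> bihomogeneous c d q ->
  bihomogeneous (a + c)%N (b + d)%N (p * q).
Proof.
move=> hp hq mu /msuppM_le /allpairsP[[nu xi] /= [/hp [<- <-] /hq [<- <-] ->]].
by split; rewrite -big_split; apply: eq_bigr => i _; rewrite mnmDE.
Qed.

Lemma bihomogeneous_zvar i : bihomogeneous 1 0 (zvar R n i : mpoly (m + n) C).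
Proof.
move=> mu; rewrite msuppX inE => /eqP ->; split.
  rewrite (bigD1 i)//= mnm1E eqxx big1 => [|k ki]; first by rewrite addn0.
  by rewrite mnm1E (inj_eq (@lshift_inj _ _)) eq_sym (negPf ki).
by rewrite big1// => j _; rewrite mnm1E eq_lrshift.
Qed.

Lemma bihomogeneous_wvar j : bihomogeneous 0 1 (wvar R m j : mpoly (m + n) C).
Proof.
move=> mu; rewrite msuppX inE => /eqP ->; split.
  by rewrite big1// => i _; rewrite mnm1E eq_rlshift.
rewrite (bigD1 j)//= mnm1E eqxx big1 => [|k ki]; first by rewrite addn0.
by rewrite mnm1E (inj_eq (@rshift_inj _ _)) eq_sym (negPf ki).
Qed.

Lemma bihomogeneous_monomial (a : seq 'I_m) (b : seq 'I_n) :
  bihomogeneous (size a) (size b)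
    ((\prod_(i <- a) zvar R n i) * (\prod_(j <- b) wvar R m j)).
Proof.
rewrite -[size a]addn0 -[size b]add0n; apply: bihomogeneousM.
  elim: a => [|i a IH]; first by rewrite big_nil; exact: bihomogeneous1.
  rewrite big_cons.
  exact: (@bihomogeneousM 1 0 (size a) 0 _ _ (@bihomogeneous_zvar i) IH).
elim: b => [|j b IH]; first by rewrite big_nil; exact: bihomogeneous1.
rewrite big_cons.
exact: (@bihomogeneousM 0 1 0 (size b) _ _ (@bihomogeneous_wvar j) IH).
Qed.

Lemma bihomogeneous_tensor_poly e f s x :
  bihomogeneous s.1 s.2 (@tensor_poly R m n e f s x).
Proof.
rewrite /tensor_poly big_seq_cond.
apply: (big_ind (bihomogeneous s.1 s.2)) => [|p q|v]; first exact: bihomogeneous0.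
  exact: bihomogeneousD.
rewrite andbT mem_words => /eqP <-; apply: bihomogeneousZ.
exact: bihomogeneous_monomial.
Qed.

Lemma bihomogeneous_comm_poly e f u i j :
  bihomogeneous 1 1 (@Defs.comm_poly R m n e f u i j).
Proof.
rewrite /Defs.comm_poly -scaleN1r; apply: bihomogeneousD.
  exact: (bihomogeneousM (@bihomogeneous_wvar j) (@bihomogeneous_zvar i)).
apply: bihomogeneousZ; apply: bihomogeneous_sum => k; apply: bihomogeneous_sum => l.
apply: bihomogeneousZ.
exact: (bihomogeneousM (@bihomogeneous_zvar k) (@bihomogeneous_wvar l)).
Qed.

Lemma assoc_ideal_homogeneous e f X u :
  homogeneous_ideal (@assoc_ideal R m n e f X u).
Proof.
eexists; split; last by reflexivity.
move=> p [[[i j] _ <-]|[s _ [x _ <-]]].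
  by exists 1%N, 1%N; exact: bihomogeneous_comm_poly.
by exists s.1, s.2; exact: bihomogeneous_tensor_poly.
Qed.

End Bihomogeneous.

Lemma pair_bigA_curry (V : nmodType) (I J : finType) (F : I * J -> V) :
  \sum_i \sum_j F (i, j) = \sum_p F p.
Proof. by rewrite pair_bigA; apply: eq_bigr => -[]. Qed.

Section UnitaryChange.
Variables (R : realType).
Local Notation C := R[i].

(** The coordinates in the standard basis of the functional whose value at the
[i]-th row of the unitary matrix [e] is [z i]. *)
Definition std_coord k (e : 'M[C]_k) (z : 'I_k -> C) (c : 'I_k) : C :=
  \sum_i conjc (e i c) * z i.

Section Unitary.
Variables (k : nat) (e : 'M[C]_k).
Hypothesis eU : e \is unitarymx.

Lemma unitary_rows i j : \sum_c e i c * conjc (e j c) = (i == j)%:R.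
Proof.
have /unitarymxP/matrixP/(_ i j) := eU; rewrite !mxE => <-.
by apply: eq_bigr => c _; rewrite !mxE.
Qed.

Lemma unitary_cols c d : \sum_i conjc (e i c) * e i d = (c == d)%:R.
Proof.
have /unitarymxP/mulmx1C/matrixP/(_ c d) := eU; rewrite !mxE => <-.
by apply: eq_bigr => i _; rewrite !mxE.
Qed.

Lemma sum_delta (I : finType) (i : I) (F : I -> C) :
  \sum_j (i == j)%:R * F j = F i.
Proof.
rewrite (bigD1 i)//= eqxx mul1r big1 ?addr0// => j ji.
by rewrite eq_sym (negPf ji) mul0r.
Qed.

Lemma std_coordK z i : \sum_c e i c * std_coord e z c = z i.
Proof.
rewrite /std_coord; under eq_bigr do rewrite mulr_sumr.
rewrite exchange_big /= -[RHS](sum_delta i); apply: eq_bigr => j _.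
by rewrite -unitary_rows mulr_suml; apply: eq_bigr => c _; rewrite mulrA.
Qed.

Lemma std_coord_row z c : std_coord e (fun i => \sum_d e i d * z d) c = z c.
Proof.
rewrite /std_coord; under eq_bigr do rewrite mulr_sumr.
rewrite exchange_big /= -[RHS](sum_delta c); apply: eq_bigr => d _.
by rewrite -unitary_cols mulr_suml; apply: eq_bigr => i _; rewrite mulrA.
Qed.

Lemma unitary_inj (g : 'I_k -> C) : (forall i, \sum_c e i c * g c = 0) ->
  forall c, g c = 0.
Proof.
move=> H c; rewrite -(std_coord_row g) /std_coord big1// => i _.
by rewrite H mulr0.
Qed.

Lemma std_coord_norm z : \sum_c sqmod (std_coord e z c) = \sum_i sqmod (z i).
Proof.
suff : (\sum_c sqmod (std_coord e z c))%:C = (\sum_i sqmod (z i))%:C by move/complexI.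
rewrite !rmorph_sum; transitivity (\sum_c std_coord e z c * conjc (std_coord e z c)).
  by apply: eq_bigr => c _; rewrite mul_conj.
transitivity (\sum_i z i * conjc (z i)); last by apply: eq_bigr => i _; rewrite mul_conj.
transitivity (\sum_c \sum_i conjc (e i c) * z i * conjc (std_coord e z c)).
  by apply: eq_bigr => c _; rewrite -mulr_suml.
rewrite exchange_big; apply: eq_bigr => i _ /=.
rewrite -{3}(std_coordK z i) rmorph_sum mulr_sumr; apply: eq_bigr => c _.
by rewrite rmorphM /=; ring.
Qed.

(** The change of basis on a tensor power acts on each factor separately. *)
Lemma sum_tuple_std_coord z (c : seq 'I_k) :
  \sum_(a : (size c).-tuple 'I_k)
     conjc (\prod_(p <- zip a c) e p.1 p.2) * \prod_(i <- a) z i =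
  \prod_(j <- c) std_coord e z j.
Proof.
elim: c => [|j c IH].
  by rewrite big_tuple0 !big_nil conjc1 mulr1.
rewrite big_tuple_cons big_cons {1}/std_coord mulr_suml; apply: eq_bigr => i _.
rewrite -IH mulr_sumr; apply: eq_bigr => a _.
by rewrite /= !big_cons rmorphM /=; ring.
Qed.

End Unitary.
End UnitaryChange.

Section Variety.
Variables (R : realType) (m n : nat) (X : subproduct_system R m n).
Variable u : 'I_m * 'I_n -> 'I_n * 'I_m -> R[i].
Local Notation C := R[i].
Local Notation word := (seq 'I_m * seq 'I_n)%type.
Variables (e : 'M[C]_m) (f : 'M[C]_n).
Hypotheses (eU : e \is unitarymx) (fU : f \is unitarymx).

Lemma is_ideal_kernel (v : 'I_(m + n) -> C) :
  is_ideal [set p : mpoly (m + n) C | meval v p = 0].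
Proof.
split=> [|p q /= p0 q0|a p /= p0]; first exact: meval0.
  by rewrite mevalD p0 q0 addr0.
by rewrite mevalM p0 mulr0.
Qed.

Lemma ideal_gen_vanish (v : 'I_(m + n) -> C) (G : set (mpoly (m + n) C)) :
  (forall p, ideal_gen G p -> meval v p = 0) <-> (forall p, G p -> meval v p = 0).
Proof.
split=> H p; last by move=> /(_ _ (conj (is_ideal_kernel v) H)).
by move=> Gp; apply: H => J [_]; exact.
Qed.

Variable zw : ('rV[C^o]_m * 'rV[C^o]_n)%type.
Let z i : C := zw.1 0 i.
Let w j : C := zw.2 0 j.
Let v i : C := row_mx zw.1 zw.2 0 i.

Lemma meval_sum I (r : seq I) (F : I -> mpoly (m + n) C) :
  meval v (\sum_(i <- r) F i) = \sum_(i <- r) meval v (F i).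
Proof.
elim: r => [|i r IH]; first by rewrite !big_nil meval0.
by rewrite !big_cons mevalD IH.
Qed.

Lemma meval_zvar i : meval v (zvar R n i) = z i.
Proof. by rewrite mevalXU /v row_mxEl. Qed.

Lemma meval_wvar j : meval v (wvar R m j) = w j.
Proof. by rewrite mevalXU /v row_mxEr. Qed.

(** The polynomial of a tensor, evaluated in the coordinates of the chosen bases, is
the evaluation of the tensor in the coordinates of the standard bases. *)
Lemma meval_tensor_poly s x : meval v (tensor_poly e f s x) =
  eval_tensor (std_coord e z) (std_coord f w) s x.
Proof.
rewrite /tensor_poly meval_sum.
transitivity (\sum_(a <- words m n s) dotp s x (basis_tensor e f a) * monom z w a).
  apply: eq_bigr => a _; rewrite mevalZ mevalM !rmorph_prod /=.
  by congr (_ * (_ * _)); apply: eq_bigr => i _;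
    rewrite ?meval_zvar ?meval_wvar.
rewrite /dotp; under eq_bigr do rewrite mulr_suml.
rewrite exchange_big; apply: eq_big_seq => -[c d]; rewrite mem_words => /eqP <- /=.
under eq_bigr do rewrite -mulrA; rewrite -mulr_sumr; congr (_ * _).
rewrite big_words /monom /= -(sum_tuple_std_coord e) -(sum_tuple_std_coord f).
rewrite mulr_suml; apply: eq_bigr => a _; rewrite mulr_sumr; apply: eq_bigr => b _.
rewrite /basis_tensor /deg /= !size_tuple eqxx rmorphM /=; ring.
Qed.

Definition comm_defect i j : C := std_coord f w j * std_coord e z i -
  \sum_(k < m) \sum_(l < n) u (k, l) (j, i) * (std_coord e z k * std_coord f w l).

(** The relations for the chosen bases are the images under the invertible matrix
[e (x) f] of the relations for the standard bases. *)
Lemma meval_comm_poly i j : meval v (Defs.comm_poly e f u i j) =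
  \sum_i' e i i' * \sum_j' f j j' * comm_defect i' j'.
Proof.
rewrite /Defs.comm_poly mevalB mevalM meval_zvar meval_wvar.
pose F (p : 'I_m * 'I_n) (q : 'I_m * 'I_n) (r : 'I_m * 'I_n) : C :=
  e i r.1 * (f j r.2 * (u (q.1, q.2) (r.2, r.1) *
    (conjc (e p.1 q.1) * z p.1 * (conjc (f p.2 q.2) * w p.2)))).
have -> : meval v (\sum_(k < m) \sum_(l < n)
    basis_coef e f u k l i j *: (zvar R n k * wvar R m l)) =
    \sum_p \sum_q \sum_r F p q r.
  rewrite meval_sum -[RHS]pair_bigA_curry; apply: eq_bigr => k _.
  rewrite meval_sum; apply: eq_bigr => l _.
  rewrite mevalZ mevalM meval_zvar meval_wvar -[RHS]pair_bigA_curry mulr_suml.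
  apply: eq_bigr => k' _; rewrite mulr_suml; apply: eq_bigr => l' _.
  rewrite -[RHS]pair_bigA_curry [RHS]exchange_big mulr_suml.
  apply: eq_bigr => j' _; rewrite mulr_suml; apply: eq_bigr => i' _.
  by rewrite /F /= rmorphM /=; ring.
transitivity ((\sum_i' e i i' * std_coord e z i') * (\sum_j' f j j' * std_coord f w j') -
    \sum_r \sum_q \sum_p F p q r).
  rewrite !std_coordK// [w j * _]mulrC; congr (_ - _).
  by rewrite exchange_big [RHS]exchange_big; apply: eq_bigr => q _; rewrite exchange_big.
rewrite -[X in _ - X]pair_bigA_curry mulr_suml -sumrB; apply: eq_bigr => i' _.
rewrite -mulrA mulr_sumr [in RHS]mulr_sumr [in LHS]mulr_sumr -sumrB.
apply: eq_bigr => j' _.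
transitivity (e i i' * (f j j' * (std_coord f w j' * std_coord e z i' -
   \sum_(k < m) \sum_(l < n) u (k, l) (j', i') * (std_coord e z k * std_coord f w l)))) => //.
rewrite !mulrBr; congr (_ - _); first by ring.
rewrite -pair_bigA_curry !mulr_sumr; apply: eq_bigr => k _.
rewrite !mulr_sumr; apply: eq_bigr => l _.
rewrite -pair_bigA_curry /std_coord mulr_suml !mulr_sumr; apply: eq_bigr => k1 _.
by rewrite !mulr_sumr; apply: eq_bigr => l1 _.
Qed.

(** The description of the variety that does not mention the bases. *)
Lemma variety_iff :
  polyball_variety (assoc_ideal e f X u) zw <->
  [/\ kills_orth X (std_coord e z) (std_coord f w),
      commutes (std_coord e z) (std_coord f w) u,
      \sum_i sqmod (std_coord e z i) <= 1 &
      \sum_j sqmod (std_coord f w j) <= 1].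
Proof.
rewrite !std_coord_norm//.
have ball k (y : 'rV[C^o]_k) : euclidean_norm y <= 1 <-> \sum_i sqmod (y 0 i) <= 1.
  have y0 : 0 <= \sum_i sqmod (y 0 i) by apply: sumr_ge0 => i _; exact: sqmod_ge0.
  by rewrite /euclidean_norm -{1}sqrtr1 ler_sqrt.
have van : (forall p, assoc_ideal e f X u p -> meval v p = 0) <->
    kills_orth X (std_coord e z) (std_coord f w) /\
    commutes (std_coord e z) (std_coord f w) u.
  apply: iff_trans (ideal_gen_vanish _ _) _; split=> [H|[zwX zwu] p].
    split=> [s x xo|i j].
      by rewrite -meval_tensor_poly; apply: H; right; exists s => //; exists x.
    apply/eqP; rewrite -subr_eq0; apply/eqP; rewrite -/(comm_defect i j).
    move: i j; suff H1 j i : \sum_j' f j j' * comm_defect i j' = 0.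
      by move=> i j; apply: (unitary_inj fU) => j'; exact: H1.
    apply: (unitary_inj eU (g := fun i => \sum_j' f j j' * comm_defect i j')) => i'.
    by rewrite -meval_comm_poly; apply: H; left; exists (i', j).
  move=> [[[i j] _ <-]|[s _ [x xo <-]]]; last by rewrite meval_tensor_poly zwX.
  rewrite meval_comm_poly big1// => i' _; rewrite big1 ?mulr0// => j' _.
  by rewrite /comm_defect (zwu i' j') subrr mulr0.
split=> [[/van[? ?] /ball ? /ball ?]|[? ? ? ?]]; first by [].
by split; [apply/van|apply/ball|apply/ball].
Qed.

End Variety.

(** * The homeomorphism *)

Section Topology.

Lemma continuous_scale (R : realType) (T : topologicalType) (a : R[i]) (h : T -> R[i]^o) :
  continuous h -> continuous (fun p => a * (h p : R[i]) : R[i]^o).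
Proof. by move=> hc p; apply: cvgM; [exact: cvg_cst|exact: hc]. Qed.

Lemma continuous_ptws (S : topologicalType) (U : choiceType) (V : topologicalType)
    (h : S -> {ptws U -> V}) :
  (forall a, continuous (fun p => h p a)) -> continuous h.
Proof.
move=> hc p; apply/cvg_sup => a.
exact: (@continuous_comp_initial _ _ _ (fun g : U -> V => g a) h (hc a) p).
Qed.

Lemma continuous_pair (S T U : topologicalType) (h : S -> T) (k : S -> U) :
  continuous h -> continuous k -> continuous (fun p => (h p, k p)).
Proof. by move=> hc kc p; apply: cvg_pair; [exact: hc|exact: kc]. Qed.

Lemma continuous_set_type (S T : topologicalType) (V : set T) (h : S -> V) :
  continuous (fun p => set_val (h p)) -> continuous h.
Proof. exact: continuous_comp_initial. Qed.

Lemma continuous_set_val (T : topologicalType) (V : set T) :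
  continuous (set_val : V -> T).
Proof. exact: initial_continuous. Qed.

Lemma continuous_row (S V : topologicalType) k (h : S -> 'I_k -> V) :
  (forall i, continuous (h^~ i)) -> continuous (fun p => \row_i h p i).
Proof.
move=> hc p A [P hP PA].
have near : \forall q \near p, forall i j, P i j ((\row_i h q i) i j).
  apply: filter_forall => i; apply: filter_forall => j.
  rewrite ord1; have := hP 0 j; rewrite mxE => hPj.
  have := hc j p _ hPj; rewrite nbhs_simpl /=; apply: filterS => q /=.
  by rewrite mxE.
by apply: filterS near => q Pq; exact: PA.
Qed.

Lemma continuous_coord (V : topologicalType) k (i : 'I_k) :
  continuous (fun y : 'rV[V]_k => y 0 i).
Proof.
move=> y A yA; exists (fun _ j => if j == i then A else setT).
  by move=> i0 j; case: eqP => [->|_]; [rewrite ord1|exact: filterT].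
by move=> y' /(_ 0 i); rewrite eqxx.
Qed.

End Topology.

Section Main.
Variables (R : realType) (m n : nat) (X : subproduct_system R m n).
Variable u : 'I_m * 'I_n -> 'I_n * 'I_m -> R[i].
Hypothesis hX : standard X u.
Local Notation C := R[i].

(** A character is determined by its values on the generators: [chi T] is the
approximate eigenvalue of [T] at the point of [chi]. *)
Lemma character_approx chi T : characters X chi -> tensor_algebra X T ->
  approx_eigen (char_e chi) (char_f chi) T (ev chi T).
Proof.
move=> chiX HT; have [//] : (tensor_algebra X `&` [set T |
   approx_eigen (char_e chi) (char_f chi) T (ev chi T)]) T.
have kills : kills_orth X (char_e chi) (char_f chi) by exact: (char_orth hX chiX).
apply: HT; split; last first.
  move=> _ /creation_opE[s [eta [Xe ->]]]; split; first exact: algebra_creation.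
  rewrite /= (ev_creation_fiber hX chiX)//; apply: (approx_creation hX) => //.
  - exact: (char_commutes hX chiX).
  - exact: (char_ball_e hX chiX).
  - exact: (char_ball_f hX chiX).
split=> [B [/algebra_bounded]//||k A B [HA Aa] [HB Bb]|A B [HA Aa] [HB Bb]|B bB H].
- split; first exact: algebra_0.
  move=> e e0; exists 0%N => N _ x; rewrite /= ev0// mul0r subr0 /phi.
  rewrite big1 ?cabs0 => [|v _]; last exact: mul0r.
  by rewrite mulr_ge0 ?(ltW e0)// mulr_ge0 ?fock_norm_ge0 ?weight_ge0.
- split; first exact: algebra_comb.
  by rewrite /= evZD//; exact: approx_eigen_comb.
- split; first exact: algebra_comp.
  by rewrite /= evM//; apply: approx_eigen_comp => //; exact: algebra_bounded.
have HB : tensor_algebra X B.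
  have [_ _ _ _ cl] := algebra_closed X; apply: cl => // e e0.
  by have [A [HA _] AB] := H e e0; exists A.
split=> //; apply: approx_eigen_limit => // e e0.
have [A [HA Aa] AB] := H e e0; exists A, (ev chi A); split=> //.
- exact: algebra_bounded.
- exact: ltW.
have HAB : tensor_algebra X (B \- A) by rewrite sub_comb; exact: algebra_comb.
have -> : ev chi A - ev chi B = - ev chi (B \- A).
  by rewrite sub_comb evZD//; ring.
by rewrite cabsN (le_trans (character_contractive chiX HAB))// ltW.
Qed.

Lemma approx_id (z : 'I_m -> C) (w : 'I_n -> C) :
  approx_eigen z w (id : fock X -> fock X) 1.
Proof.
move=> e e0; exists 0%N => N _ x; rewrite mul1r subrr cabs0.
by rewrite mulr_ge0 ?(ltW e0)// mulr_ge0 ?fock_norm_ge0 ?weight_ge0.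
Qed.

Variables (e : 'M[C]_m) (f : 'M[C]_n).
Hypotheses (eU : e \is unitarymx) (fU : f \is unitarymx).
Let V := polyball_variety (assoc_ideal e f X u).

(** The values of [chi] at the generators of the chosen bases. *)
Definition row_point (chi : tensor_algebra X -> C^o) : 'rV[C^o]_m * 'rV[C^o]_n :=
  (\row_i \sum_c e i c * char_e chi c, \row_j \sum_c f j c * char_f chi c).

(** The values at the generators of the standard bases that belong to a point of the
variety. *)
Definition pt_z (zw : 'rV[C^o]_m * 'rV[C^o]_n) : 'I_m -> C :=
  std_coord e (fun i => zw.1 0 i).
Definition pt_w (zw : 'rV[C^o]_m * 'rV[C^o]_n) : 'I_n -> C :=
  std_coord f (fun j => zw.2 0 j).

Lemma pt_z_row_point chi : pt_z (row_point chi) = char_e chi.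
Proof.
apply/funext => c; rewrite -[RHS](std_coord_row eU); congr std_coord.
by apply/funext => i; rewrite mxE.
Qed.

Lemma pt_w_row_point chi : pt_w (row_point chi) = char_f chi.
Proof.
apply/funext => c; rewrite -[RHS](std_coord_row fU); congr std_coord.
by apply/funext => i; rewrite mxE.
Qed.

Lemma pointP (p : V) : [/\ kills_orth X (pt_z (set_val p)) (pt_w (set_val p)),
  commutes (pt_z (set_val p)) (pt_w (set_val p)) u,
  \sum_i sqmod (pt_z (set_val p) i) <= 1 & \sum_j sqmod (pt_w (set_val p) j) <= 1].
Proof. by have /(variety_iff X u eU fU) := set_valP p. Qed.

Lemma row_point_variety chi : characters X chi -> V (row_point chi).
Proof.
move=> chiX; apply/(variety_iff X u eU fU).
rewrite -/(pt_z _) -/(pt_w _) pt_z_row_point pt_w_row_point; split.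
- exact: (char_orth hX chiX).
- exact: (char_commutes hX chiX).
- exact: (char_ball_e hX chiX).
- exact: (char_ball_f hX chiX).
Qed.

Lemma pt_z_continuous i : continuous (fun p : V => pt_z (set_val p) i : C^o).
Proof.
apply: continuous_sum_seq => k; apply: continuous_scale => p.
apply: (@continuous_comp _ _ _ (fun p : V => (set_val p).1) (fun y : 'rV[C^o]_m => y 0 k)).
  apply: continuous_comp; first exact: continuous_set_val.
  exact: cvg_fst.
exact: continuous_coord.
Qed.

Lemma pt_w_continuous i : continuous (fun p : V => pt_w (set_val p) i : C^o).
Proof.
apply: continuous_sum_seq => k; apply: continuous_scale => p.
apply: (@continuous_comp _ _ _ (fun p : V => (set_val p).2) (fun y : 'rV[C^o]_n => y 0 k)).
  apply: continuous_comp; first exact: continuous_set_val.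
  exact: cvg_snd.
exact: continuous_coord.
Qed.

Lemma ev_continuous T : tensor_algebra X T ->
  continuous (fun chi : characters X => ev (set_val chi) T : C^o).
Proof.
move=> HT; have [A <-] := algebraP HT.
have -> : (fun chi : characters X => ev (set_val chi) (val A) : C^o) =
    (fun chi => (set_val chi : {ptws tensor_algebra X -> C^o}) A).
  by apply/funext => chi; rewrite ev_val.
move=> chi; apply: (@continuous_comp _ _ _ set_val
  (fun g : {ptws tensor_algebra X -> C^o} => g A)); first exact: continuous_set_val.
exact: (@proj_continuous _ (fun=> C^o) A).
Qed.

Theorem characters_homeomorphic : homeomorphic (characters X) V.
Proof.
have /choice[c cP] : forall A : tensor_algebra X, exists c : V -> C^o,
    symbol (fun p => pt_z (set_val p)) (fun p => pt_w (set_val p)) (val A) c.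
  move=> A; apply: (symbol_exists hX) (algebra_val A) => [p|p|p|p||];
    try by have [] := pointP p.
  - exact: pt_z_continuous.
  - exact: pt_w_continuous.
have uniq_c p A a : approx_eigen (pt_z (set_val p)) (pt_w (set_val p)) (val A) a ->
    c A p = a.
  by have [kp _ _ _] := pointP p => Aa; apply: (approx_eigen_uniq kp) Aa; exact: (cP A).2.
have gP (p : V) : characters X (fun A => c A p).
  split=> [k A B D DE|A B D DE|].
  - apply: uniq_c; rewrite DE; apply: approx_eigen_comb; exact: (cP _).2.
  - apply: uniq_c; rewrite DE; apply: approx_eigen_comp; try exact: (cP _).2.
    by apply: algebra_bounded; exact: algebra_val.
  - have [I EI] := algebraP (@algebra_id _ _ _ X); exists I.
    by rewrite (@uniq_c _ _ 1) ?oner_eq0// EI; exact: approx_id.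
pose F (chi : characters X) : V :=
  exist _ (row_point (set_val chi)) (mem_set (row_point_variety (set_valP chi))).
pose G (p : V) : characters X := exist _ (fun A => c A p) (mem_set (gP p)).
exists F, G; split.
- apply: continuous_set_type; apply: continuous_pair.
    apply: continuous_row => i.
    apply: continuous_sum_seq => k; apply: continuous_scale.
    exact: (ev_continuous (algebra_creation (delta_e hX k))).
  apply: continuous_row => i.
  apply: continuous_sum_seq => k; apply: continuous_scale.
  exact: (ev_continuous (algebra_creation (delta_f hX k))).
- apply: continuous_set_type; apply: continuous_ptws => A; exact: (cP A).1.
- move=> chi; apply: val_inj; apply/funext => A /=.
  apply: uniq_c; rewrite /= pt_z_row_point pt_w_row_point -ev_val.
  by apply: character_approx; [exact: set_valP|exact: algebra_val].
move=> p; apply: val_inj => /=; have [kp cp zp wp] := pointP p.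
have evG s eta : X s eta -> ev (fun A => c A p) (creation X s eta) =
    eval_tensor (pt_z (set_val p)) (pt_w (set_val p)) s eta.
  move=> Xe; have [A EA] := algebraP (algebra_creation Xe).
  by rewrite -EA ev_val; apply: uniq_c; rewrite EA; exact: (approx_creation hX).
have evE i : char_e (fun A => c A p) i = pt_z (set_val p) i.
  rewrite /char_e evG; last exact: (delta_e hX).
  rewrite /eval_tensor big_delta ?uniq_words ?mem_words//.
  by rewrite /monom big_cons !big_nil !mulr1.
have evF j : char_f (fun A => c A p) j = pt_w (set_val p) j.
  rewrite /char_f evG; last exact: (delta_f hX).
  rewrite /eval_tensor big_delta ?uniq_words ?mem_words//.
  by rewrite /monom big_cons !big_nil mul1r mulr1.
rewrite [RHS]surjective_pairing; congr (_, _); apply/rowP => i; rewrite mxE.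
  under eq_bigr do rewrite evE; exact: (std_coordK eU).
under eq_bigr do rewrite evF; exact: (std_coordK fU).
Qed.

End Main.

Theorem theorem3p11 (R : realType) (m n : nat) (X : subproduct_system R m n)
    (u : 'I_m * 'I_n -> 'I_n * 'I_m -> R[i]) (hX : standard X u) :
  (exists J : set (mpoly (m + n) R[i]),
     homogeneous_ideal J /\ homeomorphic (characters X) (polyball_variety J)) /\
  (forall (e : 'M[R[i]]_m) (f : 'M[R[i]]_n),
     e \is unitarymx -> f \is unitarymx ->
     homogeneous_ideal (assoc_ideal e f X u) /\
     homeomorphic (characters X) (polyball_variety (assoc_ideal e f X u))).
Proof.
have main (e : 'M[R[i]]_m) (f : 'M[R[i]]_n) : e \is unitarymx -> f \is unitarymx ->
     homogeneous_ideal (assoc_ideal e f X u) /\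
     homeomorphic (characters X) (polyball_variety (assoc_ideal e f X u)).
  move=> eU fU; split; first exact: assoc_ideal_homogeneous.
  exact: characters_homeomorphic.
split=> //; exists (assoc_ideal 1%:M 1%:M X u).
by apply: main; apply/unitarymxP; rewrite mul1mx ?trmx1 ?map_mx1.
Qed.
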